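(* Assume: (A1) $\mathbb E[\phi_i^4]<\infty$; (A2) $F$ is of class $C^2$ on $[-1,1]$; (A3) $f$ and $f'$ are bounded. Assume that $n$ and $N$ tend to infinity sequentially and let $m=m_N\to\infty$ be such that $$\Big(\frac{2N}{\log\log N}\Big)^{1/2}\frac{\log m}{m^2}\longrightarrow0.$$ Then $\widehat F_{m,n,N}$ satisfies the Chung-Smirnov property, that is, $$\limsup_{N\to\infty}\Big(\frac{2N}{\log\log N}\Big)^{1/2}\sup_{x\in[-1,1]}\big|\widehat F_{m,n,N}(x)-F(x)\big|\le1\quad\text{a.s.}$$
   Context: Model. Fix $\sigma>0$, $\gamma>0$, $H\in(\frac12,1)$ and a time step $h>0$. For $i=1,2,\dots$ let $B^i$ be standard Brownian motions and $B^{H,i}$ fractional Brownian motions with Hurst index $H$ (centered Gaussian, covariance $\frac12(t^{2H}+s^{2H}-|t-s|^{2H})$), all mutually independent, and set $M^{H,i}_t=\sigma B^i_t+\gamma B^{H,i}_t$. The random effects $\phi_1,\phi_2,\dots$ are i.i.d. with distribution function $F$ supported on $[-1,1]$ and density $f$, independent of the family $\{M^{H,i}\}$. Put $\theta_i=\phi_i-\frac{\sigma^2}{2}$ and $Y^i_t=\theta_it+M^{H,i}_t$ (so $X^i_t=e^{Y^i_t}$ solves $dX^i_t=\phi_iX^i_t\,dt+X^i_t\,dM^{H,i}_t$, $X^i_0=1$). Statistics. $\Delta Y^i_k:=Y^i_{(k+1)h}-Y^i_{kh}$, $\widehat\theta_i=\frac1{nh}\sum_{k=0}^{n-1}\Delta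 Y^i_k$, and $\xi^i_n=\frac1n\sum_{k=0}^{n-1}(\Delta Y^i_k)^2$, $\eta^i_n=\frac1n\sum_{k=0}^{n-1}\Delta Y^i_k\Delta Y^i_{k+1}$, $\zeta^i_n=\frac1n\sum_{k=0}^{n-1}(Y^i_{(k+2)h}-Y^i_{kh})(Y^i_{(k+4)h}-Y^i_{(k+2)h})$. Averages over $N$ subjects: $\bar V_{n,N}=\frac1N\sum_{i=1}^N\widehat\theta_i^2$, $\bar\xi_{n,N}=\frac1N\sum_{i=1}^N\xi^i_n$, $\bar\eta_{n,N}=\frac1N\sum_{i=1}^N\eta^i_n$, $\bar\zeta_{n,N}=\frac1N\sum_{i=1}^N\zeta^i_n$. Estimators. With $\log_2^+(x):=\mathbf 1_{\{x>0\}}\log_2x$, $\widehat H=\frac12\log_2^+\!\Big(\frac{\bar\zeta_{n,N}-4h^2\bar V_{n,N}}{\bar\eta_{n,N}-h^2\bar V_{n,N}}\Big)$, $\ \widehat\gamma^2=\frac{\bar\eta_{n,N}-h^2\bar V_{n,N}}{h^{2\widehat H}(2^{2\widehat H-1}-1)}$, $\ \widehat\sigma^2=\frac{\bar\xi_{n,N}-h^2\bar V_{n,N}-\widehat\gamma^2h^{2\widehat H}}{h}$, and $\widehat\phi_i=\widehat\theta_i+\frac12\widehat\sigma^2$ for $i=1,\dots,N$. Lagrange estimator. For $m\ge1$ let $x_j=\cos\big(\frac{(2j-1)\pi}{2m}\big)$ for $j=1,\dots,m$ (Chebyshev-Gauss nodes), $\mathcal L_j(x)=\prod_{i=1,\,i\ne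 j}^m\frac{x-x_i}{x_j-x_i}$, $\widehat F_N(y)=\frac1N\sum_{i=1}^N\mathbf 1_{\{\widehat\phi_i\le y\}}$, and $\widehat F_{m,n,N}(x)=\sum_{j=1}^m\widehat F_N(x_j)\mathcal L_j(x)$ for $x\in[-1,1]$. ''$n$ and $N$ tend to infinity sequentially'' means: first $n\to\infty$ with $N$ fixed, then $N\to\infty$. *)

(* Defs.v *)
From HB Require Import structures.
From mathcomp Require Import all_boot all_order all_algebra finmap.
From mathcomp Require Import all_classical all_reals all_analysis.

Set Implicit Arguments.
Unset Strict Implicit.
Unset Printing Implicit Defensive.

Import Order.TTheory GRing.Theory Num.Theory.
Import numFieldNormedType.Exports.

Local Open Scope classical_set_scope.
Local Open Scope ring_scope.

(* Subjects i = 1, 2, ... and nodes j = 1, ..., m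
   are indexed from 0. *)

Section independence.
Context (d : measure_display) (T : measurableType d) (R : realType)
  (P : probability T R).

(* sigma(X_i : i in D) *)
Definition sigma_gen (I : Type) (D : set I) (X : I -> T -> R) : set (set T) :=
  <<s [set E | exists i (A : set R),
         [/\ D i, measurable A & E = X i @^-1` A]] >>.

Definition mutually_independent (I : choiceType) (G : I -> set (set T)) : Prop :=
  forall (J : {fset I}) (A : I -> set T), (forall i, i \in J -> G i (A i)) ->
    P (\bigcap_(i in [set` J]) A i) = (\prod_(i <- J) P (A i))%E.

Definition independent_pair (G1 G2 : set (set T)) : Prop :=
  forall A B, G1 A -> G2 B -> P (A `&` B) = (P A * P B)%E.

End independence.

Section gaussian.
Context (d : measure_display) (T : measurableType d) (R : realType)
  (P : probability T R).

(* N(m, v), v being the variance.  The case v = 0 is treated apart because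
   [normal_prob m 0] is by convention the uniform law on [0, 1]. *)
Definition gaussian_law (m v : R) (A : set R) : \bar R :=
  if v == 0 then \d_m A else normal_prob m (Num.sqrt v) A.

Definition has_gaussian_law (X : T -> R) (m v : R) : Prop :=
  forall A : set R, measurable A -> P (X @^-1` A) = gaussian_law m v A.

Definition centered_gaussian_process (X : R -> {RV P >-> R}) : Prop :=
  forall (n : nat) (t a : 'I_n -> R), (forall k, 0 <= t k) ->
    exists v : R, 0 <= v /\
      has_gaussian_law (fun w => \sum_(k < n) a k * X (t k) w) 0 v.

(* Processes are indexed by R; only the times t >= 0 are constrained. *)
Definition brownian_motion (B : R -> {RV P >-> R}) : Prop :=
  [/\ {ae P, forall w, B 0 w = 0},
      forall s t : R, 0 <= s -> s <= t ->
        has_gaussian_law (fun w => B t w - B s w) 0 (t - s),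
      forall t : nat -> R, 0 <= t 0%N -> (forall k, t k <= t k.+1) ->
        mutually_independent P (fun k : nat =>
          sigma_gen [set: unit] (fun _ w => B (t k.+1) w - B (t k) w)) &
      {ae P, forall w, {within `[0, +oo[, continuous (fun t => B t w)}}].

Definition fractional_brownian_motion (H : R) (X : R -> {RV P >-> R}) : Prop :=
  centered_gaussian_process X /\
  forall s t : R, 0 <= s -> 0 <= t ->
    covariance P (X s) (X t) =
      (2^-1 * (t `^ (2 * H) + s `^ (2 * H) - `|t - s| `^ (2 * H)))%:E.

End gaussian.

Section calculus.
Context (R : realType).

(* Derivative relative to D, hence one-sided at the end points of an interval. *)
Definition derivable_on (D : set R) (g : R -> R) : Prop :=
  forall x, D x -> cvg ((g y - g x) / (y - x) @[y --> within D x^']).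

Definition derivative_on (D : set R) (g : R -> R) (x : R) : R :=
  lim ((g y - g x) / (y - x) @[y --> within D x^']).

Definition C2_on (D : set R) (g : R -> R) : Prop :=
  [/\ derivable_on D g, derivable_on D (derivative_on D g) &
      {within D, continuous (derivative_on D (derivative_on D g))}].

Definition bounded_on (D : set R) (g : R -> R) : Prop :=
  exists C : R, forall x, D x -> `|g x| <= C.

End calculus.

Section model.
Context (R : realType) (T : Type).

Definition mixed_fbm (sigma gamma : R) (B BH : nat -> R -> T -> R)
    (i : nat) (t : R) (w : T) : R :=
  sigma * B i t w + gamma * BH i t w.

Definition log_process (sigma : R) (phi : nat -> T -> R) (M : nat -> R -> T -> R)
    (w : T) (i : nat) (t : R) : R :=
  (phi i w - sigma ^+ 2 / 2) * t + M i t w.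

End model.

(* Here y is the trajectory of one subject and Y the family of all trajectories. *)
Section estimators.
Context (R : realType) (h : R).

Definition increment (y : R -> R) (k : nat) : R := y (k.+1%:R * h) - y (k%:R * h).

Definition theta_hat (n : nat) (y : R -> R) : R :=
  (n%:R * h)^-1 * \sum_(0 <= k < n) increment y k.

Definition xi (n : nat) (y : R -> R) : R :=
  n%:R^-1 * \sum_(0 <= k < n) increment y k ^+ 2.

Definition eta (n : nat) (y : R -> R) : R :=
  n%:R^-1 * \sum_(0 <= k < n) increment y k * increment y k.+1.

Definition zeta (n : nat) (y : R -> R) : R :=
  n%:R^-1 * \sum_(0 <= k < n)
    (y ((k + 2)%:R * h) - y (k%:R * h)) *
    (y ((k + 4)%:R * h) - y ((k + 2)%:R * h)).

Definition average (N : nat) (v : nat -> R) : R :=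
  N%:R^-1 * \sum_(0 <= i < N) v i.

Definition log2p (x : R) : R := if 0 < x then ln x / ln 2 else 0.

Variables (n N : nat) (Y : nat -> R -> R).

Definition V_bar : R := average N (fun i => theta_hat n (Y i) ^+ 2).
Definition xi_bar : R := average N (fun i => xi n (Y i)).
Definition eta_bar : R := average N (fun i => eta n (Y i)).
Definition zeta_bar : R := average N (fun i => zeta n (Y i)).

Definition H_hat : R :=
  2^-1 * log2p ((zeta_bar - 4 * h ^+ 2 * V_bar) / (eta_bar - h ^+ 2 * V_bar)).

Definition gamma2_hat : R :=
  (eta_bar - h ^+ 2 * V_bar) /
  (h `^ (2 * H_hat) * (2 `^ (2 * H_hat - 1) - 1)).

Definition sigma2_hat : R :=
  (xi_bar - h ^+ 2 * V_bar - gamma2_hat * h `^ (2 * H_hat)) / h.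

Definition phi_hat (i : nat) : R := theta_hat n (Y i) + 2^-1 * sigma2_hat.

Definition F_hat (y : R) : R := average N (fun i => (phi_hat i <= y)%R%:R).

End estimators.

Section lagrange.
Context (R : realType) (m : nat).

Definition cheb_node (j : 'I_m) : R :=
  cos ((2 * j.+1%:R - 1) * pi / (2 * m%:R)).

Definition lagrange_basis (j : 'I_m) (x : R) : R :=
  \prod_(i < m | i != j) ((x - cheb_node i) / (cheb_node j - cheb_node i)).

Definition lagrange_interp (g : R -> R) (x : R) : R :=
  \sum_(j < m) g (cheb_node j) * lagrange_basis j x.

End lagrange.

Section chung_smirnov.
Context (R : realType).

Definition sup_dist (a b : R) (g1 g2 : R -> R) : \bar R :=
  ereal_sup [set `|g1 x - g2 x|%:E | x in `[a, b]].

Definition cs_rate (N : nat) : R := Num.sqrt (2 * N%:R / ln (ln N%:R)).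

End chung_smirnov.

(* Main.v *)
Require Import Defs.
From HB Require Import structures.
From mathcomp Require Import all_boot all_order all_algebra finmap.
From mathcomp Require Import all_classical all_reals all_analysis.
From mathcomp Require Import measurable_realfun.
From mathcomp Require Import ring lra zify.

Set Implicit Arguments.
Unset Strict Implicit.
Unset Printing Implicit Defensive.

Import Order.TTheory GRing.Theory Num.Theory.
Import numFieldNormedType.Exports.

Local Open Scope classical_set_scope.
Local Open Scope ring_scope.

(* For fixed N the estimators of theta, H, gamma and sigma converge almost
   surely as n tends to infinity, hence so does the estimator of each random
   effect; no random effect equals a Chebyshev node, so in the inner limit
   [F_hat] agrees at the nodes with the empirical distribution function F_N.
   The outer limit concerns
     L F_N - F = (F_N - F) + (L (F_N - F) - (F_N - F)) + (L F - F),
   where L is interpolation at m_N nodes.  The first term obeys the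
   Chung-Smirnov law with constant 1 (maximal exponential inequality at finitely
   many points, chaining between them).  The weights of L alternate in sign
   around x and decrease like the inverse of the distance to x, counted in
   nodes: one Abel summation bounds the second term by the modulus of
   continuity of F_N - F at scale 1/m_N times a logarithm, and two Abel
   summations bound the third by log m_N / m_N^2 because F is C^2.
   The convergence in n rests on the law of large numbers for products of
   stationary Gaussian increments with nonnegative covariances: Var of the
   n-th sum is O(n^(2H)), which gives convergence along n = i^p, and averages of
   squares, being nonnegative, are controlled between these times. *)

(** * Chebyshev interpolation *)

(** The norm of L on bounded functions grows like log m_N, so bounding L (F_N - F) by the supremum
    of F_N - F would lose the constant 1: the interpolation error of F_N - F has to be of smaller
    order than the rate, which its continuity provides. Two obstacles shape that estimate. Nothing
    bounds m_N from above, so log m_N may exceed every power of N; and chaining resolves F_N - F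
    only down to a negative power of N. The rate condition forces m_N to exceed a power of N, where
    the modulus already gains a power of N; and since F_N - F is a difference of two distribution
    functions, its total variation controls the remote nodes, so that log m_N is replaced by log N.
    The constant 1 comes from the variance p (1 - p) <= 1/4 of an indicator, kept sharp by blocks of
    times of ratio close to 1; chaining tolerates any constant and uses dyadic blocks. In the noise,
    H > 1/2 makes all covariances r nonnegative, so that r^2 <= v r, and double sums of r are
    explicit. Gaussian laws are represented by Laplace transforms, which are stable under
    independent sums and yield the moments up to order four. *)

Section alternating_sums.
Variable R : realFieldType.
Implicit Types (d a : nat -> R) (n k : nat).

(** The sign is counted from k, so that for k < n the term [d k] is the sum of the tails at k and
    k+1: this makes [(-1) ^+ k * d k] a first difference. *)
Definition alt_tail d n k : R := \sum_(i < n - k) (-1) ^+ i * d (k + i)%N.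

Lemma alt_tail_geq d n k : (n <= k)%N -> alt_tail d n k = 0.
Proof. by rewrite /alt_tail -subn_eq0 => /eqP ->; rewrite big_ord0. Qed.

Lemma alt_tail_rec d n k : (k < n)%N ->
  alt_tail d n k = d k - alt_tail d n k.+1.
Proof.
move=> kn; rewrite /alt_tail subnS.
have -> : (n - k = (n - k).-1.+1)%N by rewrite prednK// subn_gt0.
rewrite big_ord_recl /= expr0 mul1r addn0; congr (_ + _).
rewrite -sumrN; apply: eq_bigr => i _.
by rewrite /bump /= add1n exprS addSnnS mulN1r mulNr.
Qed.

Lemma alt_tail_bound d n k : (forall i, 0 <= d i) ->
  (forall i, d i.+1 <= d i) -> 0 <= alt_tail d n k <= d k.
Proof.
move=> d0 dd; have [|kn] := leqP n k.
  by move=> nk; rewrite alt_tail_geq// lexx d0.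
elim: (n - k)%N {-2}k (erefl (n - k)%N) kn => [k0|j IH k0] h kn.
  by rewrite alt_tail_geq ?lexx ?d0// -subn_eq0 h.
have [kn'|nk'] := ltnP k0 n; last by rewrite alt_tail_geq// lexx d0.
rewrite alt_tail_rec//.
have := dd k0; have := d0 k0.
have [nk|kn1] := leqP n k0.+1; first by rewrite (alt_tail_geq _ nk); lra.
have /andP[] := IH k0.+1 ltac:(by rewrite subnS h) kn1; lra.
Qed.

(** Both bounds propagate backwards together: the lower one at k+1 gives the upper one at k, and the
    upper one at k+1 gives, by convexity, the lower one at k. The vanishing of d from n on starts
    the induction. *)
Lemma alt_tail_convex d n k : (forall i, 0 <= d i) ->
  (forall i, d i.+1 <= d i) -> (forall i, (n <= i)%N -> d i = 0) ->
  (forall i, 0 <= d i - 2 * d i.+1 + d i.+2) ->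
  d k / 2 <= alt_tail d n k <= d k - d k.+1 / 2.
Proof.
move=> d0 dd dn dc.
have base k0 : (n <= k0)%N -> d k0 / 2 <= alt_tail d n k0 <= d k0 - d k0.+1 / 2.
  by move=> h; rewrite alt_tail_geq// !dn ?leqW//; lra.
elim: (n - k)%N {-2}k (erefl (n - k)%N) => [k0|j IH k0] h.
  by apply: base; rewrite -subn_eq0 h.
have [kn'|nk'] := ltnP k0 n; last exact: base.
rewrite alt_tail_rec//.
have /andP[] := IH k0.+1 ltac:(by rewrite subnS h).
have := dc k0; lra.
Qed.

(** The difference of consecutive tails is [d k] minus twice the tail at k+1, which dominates a
    second difference of d. The tails can thus serve as weights of a second Abel summation. *)
Lemma alt_tail_decr d n k : (forall i, 0 <= d i) ->
  (forall i, d i.+1 <= d i) -> (forall i, (n <= i)%N -> d i = 0) ->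
  (forall i, 0 <= d i - 2 * d i.+1 + d i.+2) ->
  alt_tail d n k.+1 <= alt_tail d n k.
Proof.
move=> d0 dd dn dc; have [nk|kn] := leqP n k.
  by rewrite !alt_tail_geq// leqW.
have /andP[_] := alt_tail_convex k.+1 d0 dd dn dc.
by rewrite (alt_tail_rec _ kn); have := dc k; lra.
Qed.

Lemma alt_abel d a n :
  \sum_(k < n) (-1) ^+ k * d k * a k =
  a 0%N * alt_tail d n 0 -
  \sum_(k < n.-1) (-1) ^+ k * alt_tail d n k.+1 * (a k.+1 - a k).
Proof.
case: n => [|n]; first by rewrite !big_ord0 alt_tail_geq// mulr0 subr0.
rewrite /=; set e := alt_tail d n.+1.
(* Partial sums carry a boundary term; it vanishes at j = n, where the next tail is empty. *)
suff H j : (j <= n)%N -> \sum_(k < j.+1) (-1) ^+ k * d k * a k =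
  a 0%N * e 0%N - \sum_(k < j) (-1) ^+ k * e k.+1 * (a k.+1 - a k)
    + (-1) ^+ j * e j.+1 * a j.
  by rewrite H// {3}/e alt_tail_geq// mulr0 mul0r addr0.
elim: j => [|j IH] jn.
  rewrite big_ord_recr !big_ord0 /= /e (@alt_tail_rec d n.+1 0)//.
  by rewrite expr0 mul1r; ring.
rewrite big_ord_recr /= IH ?(ltnW jn)// [in RHS]big_ord_recr /=.
have -> : d j.+1 = e j.+1 + e j.+2 by rewrite /e (@alt_tail_rec d n.+1 j.+1)// subrK.
by rewrite !exprS; ring.
Qed.

Lemma alt_sum_bound1 d a n : (forall i, 0 <= d i) ->
  (forall i, d i.+1 <= d i) ->
  `|\sum_(k < n) (-1) ^+ k * d k * a k| <=
  d 0%N * `|a 0%N| + \sum_(k < n.-1) d k.+1 * `|a k.+1 - a k|.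
Proof.
move=> d0 dd; rewrite alt_abel.
apply: (le_trans (ler_normB _ _)); apply: lerD.
  rewrite normrM mulrC ler_wpM2r//.
  by have /andP[? ?] := alt_tail_bound n 0 d0 dd; rewrite ger0_norm.
apply: (le_trans (ler_norm_sum _ _ _)); apply: ler_sum => k _.
rewrite !normrM normrX normrN1 expr1n mul1r ler_wpM2r//.
by have /andP[? ?] := alt_tail_bound n k.+1 d0 dd; rewrite ger0_norm.
Qed.

(** The bound with one summation is applied to the tails of d as weights and to the differences of a
    as terms. *)
Lemma alt_sum_bound2 d a n : (forall i, 0 <= d i) ->
  (forall i, d i.+1 <= d i) -> (forall i, (n <= i)%N -> d i = 0) ->
  (forall i, 0 <= d i - 2 * d i.+1 + d i.+2) ->
  `|\sum_(k < n) (-1) ^+ k * d k * a k| <=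
  d 0%N * `|a 0%N| + d 1%N * `|a 1%N - a 0%N| +
  \sum_(k < n.-2) d k.+2 * `|a k.+2 - 2 * a k.+1 + a k|.
Proof.
move=> d0 dd dn dc; rewrite alt_abel.
have eb k := alt_tail_bound n k d0 dd.
have e0 k : 0 <= alt_tail d n k.+1 by have /andP[] := eb k.+1.
have ed k : alt_tail d n k.+2 <= alt_tail d n k.+1 by exact: alt_tail_decr.
have := alt_sum_bound1 (fun k => a k.+1 - a k) n.-1 e0 ed => /= H.
apply: (le_trans (ler_normB _ _)); rewrite -addrA; apply: lerD.
  rewrite normrM mulrC ler_wpM2r//.
  by have /andP[? ?] := eb 0%N; rewrite ger0_norm.
apply: (le_trans H); apply: lerD.
  by rewrite ler_wpM2r//; have /andP[] := eb 1%N.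
apply: ler_sum => k _.
have -> : a k.+2 - a k.+1 - (a k.+1 - a k) = a k.+2 - 2 * a k.+1 + a k by ring.
by rewrite ler_wpM2r//; have /andP[] := eb k.+2.
Qed.

End alternating_sums.

(** * Chebyshev polynomials and the Lagrange basis in angular form *)

Section chebyshev_polynomials.
Variable R : realType.
Implicit Types (k m : nat) (u t : R).

Fixpoint chebyshev k : {poly R} :=
  if k is k1.+1 then
    if k1 is k2.+1 then 2 *: 'X * chebyshev k1 - chebyshev k2 else 'X
  else 1.

Lemma size_chebyshev k : (size (chebyshev k) <= k.+1)%N.
Proof.
suff: (size (chebyshev k) <= k.+1)%N && (size (chebyshev k.+1) <= k.+2)%N.
  by case/andP.
elim: k => [|k /andP[IH1 IH2]]; first by rewrite /= size_poly1 size_polyX.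
rewrite IH2 /= (leq_trans (size_polyD _ _))// geq_max size_polyN.
rewrite (leq_trans IH1) ?andbT; last by rewrite ltnW.
rewrite -scalerAl (leq_trans (size_scale_leq _ _))//.
by rewrite (leq_trans (size_polyMleq _ _))// size_polyX.
Qed.

Lemma chebyshev_cos k t : (chebyshev k).[cos t] = cos (k%:R * t).
Proof.
suff: (chebyshev k).[cos t] = cos (k%:R * t) /\
      (chebyshev k.+1).[cos t] = cos (k.+1%:R * t) by case.
elim: k => [|k [IH1 IH2]]; first by rewrite /= hornerC hornerX mul0r cos0 mul1r.
split => //=; rewrite hornerD hornerN hornerM hornerZ hornerX.
rewrite [X in _ * X](_ : _ = cos (k.+1%:R * t)); last by rewrite -IH2.
rewrite IH1.
have -> : k.+2%:R * t = k.+1%:R * t + t by rewrite -[k.+2]addn1 natrD; ring.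
have -> : k%:R * t = k.+1%:R * t - t by rewrite -[k.+1]addn1 natrD; ring.
by rewrite cosB cosD; ring.
Qed.

(* The kernel of trigonometric interpolation at 2m equispaced points, equal to
   sin(m u) cot(u/2) / (2m) off the zeros of sin(u/2). *)
Definition interp_kernel m u : R :=
  (2 * m%:R)^-1 * (1 + 2 * (\sum_(1 <= k < m) cos (k%:R * u)) + cos (m%:R * u)).

(** The closed form is multiplied out so that it also holds at the zeros of sin (u/2). *)
Lemma interp_kernelE m u : (0 < m)%N ->
  2 * m%:R * interp_kernel m u * sin (u / 2) = sin (m%:R * u) * cos (u / 2).
Proof.
case: m => // m _; rewrite /interp_kernel mulrA mulfV ?mul1r; last first.
  by rewrite mulf_neq0// pnatr_eq0.
elim: m => [|m IH].
  rewrite big_geq// mulr0 addr0 !mul1r.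
  have -> : cos u = cos (u / 2 + u / 2) by congr cos; field.
  have -> : sin u = sin (u / 2 + u / 2) by congr sin; field.
  rewrite cosD sinD; have := cos2Dsin2 (u / 2).
  move: (cos _) (sin _) => x y h; have -> : y * y = 1 - x * x by rewrite -!expr2 -h; ring.
  by ring.
rewrite big_nat_recr//=.
have -> : (1 + 2 * (\sum_(1 <= i < m.+1) cos (i%:R * u) + cos (m.+1%:R * u)) +
     cos (m.+2%:R * u)) =
     (1 + 2 * (\sum_(1 <= i < m.+1) cos (i%:R * u)) + cos (m.+1%:R * u)) +
     (cos (m.+1%:R * u) + cos (m.+2%:R * u)) by ring.
rewrite mulrDl IH.
have -> : m.+2%:R * u = m.+1%:R * u + (u / 2 + u / 2).
  by rewrite -[m.+2]addn1 natrD; field.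
set a := m.+1%:R * u; set b := u / 2.
rewrite !cosD !sinD !cosD; have := cos2Dsin2 b => H.
have -> : sin b * sin b = 1 - cos b * cos b by rewrite -!expr2 -H; ring.
transitivity (sin a * cos b + cos a * sin b + cos a * sin b * (cos b * cos b - (1 - cos b * cos b)) - sin a * (2 * cos b) * (sin b * sin b)); first by rewrite /b; ring.
have -> : sin b * sin b = 1 - cos b * cos b by rewrite -!expr2 -H; ring.
by ring.
Qed.

Lemma interp_kernelN m u : interp_kernel m (- u) = interp_kernel m u.
Proof.
rewrite /interp_kernel mulrN cosN; congr (_ * (_ + _ * _ + _)).
by apply: eq_bigr => k _; rewrite mulrN cosN.
Qed.

Lemma interp_kernelD2pi m u : interp_kernel m (u + 2 * pi) = interp_kernel m u.
Proof.
have H k : cos (k%:R * (u + 2 * pi)) = cos (k%:R * u).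
  rewrite mulrDr.
  have -> : k%:R * (2 * pi) = (pi *+ 2) *+ k :> R by rewrite !mulr_natl.
  exact: (periodicn (@cosD2pi R)).
by rewrite /interp_kernel H; under eq_bigr do rewrite H.
Qed.

Lemma interp_kernel0 m : (0 < m)%N -> interp_kernel m 0 = 1.
Proof.
move=> m0; rewrite /interp_kernel mulr0 cos0.
under eq_bigr do rewrite mulr0 cos0.
case: m m0 => // m _; rewrite big_const_nat iter_addr_0 subn1 /= -(natr1 m).
have := ler0n R m; move: (m%:R) => x x0.
by field; rewrite gt_eqF//; lra.
Qed.

Lemma interp_kernel_le1 m u : (0 < m)%N -> `|interp_kernel m u| <= 1.
Proof.
move=> m0; rewrite -(interp_kernel0 m0) /interp_kernel normrM ger0_norm; last first.
  by rewrite invr_ge0 mulr_ge0.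
rewrite ler_wpM2l ?invr_ge0 ?mulr_ge0//.
apply: (le_trans (ler_normD _ _)); rewrite mulr0 cos0; apply: lerD; last exact: cos_max.
apply: (le_trans (ler_normD _ _)); rewrite normr1 lerD2l normrM normr_nat ler_wpM2l//.
apply: (le_trans (ler_norm_sum _ _ _)); apply: ler_sum => k _.
by rewrite mulr0 cos0 cos_max.
Qed.

Definition cheb_angle m (j : nat) : R := (2 * j.+1%:R - 1) * pi / (2 * m%:R).

Lemma cheb_nodeE m (j : 'I_m) : cheb_node R j = cos (cheb_angle m j).
Proof. by []. Qed.

Lemma cheb_angle_bound m j : (j < m)%N -> 0 < cheb_angle m j < pi.
Proof.
move=> jm; have m0 : 0 < m%:R :> R by rewrite ltr0n; case: m jm.
have j1 : 1 <= j.+1%:R :> R by rewrite ler1n.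
have jm' : j.+1%:R <= m%:R :> R by rewrite ler_nat.
have := pi_gt0 R => p0; rewrite /cheb_angle; apply/andP; split.
  by rewrite !(mulr_gt0, invr_gt0)//; lra.
by rewrite ltr_pdivrMr ?mulr_gt0// [ltRHS]mulrC ltr_pM2r//; lra.
Qed.

Lemma sin_natpi k : sin (k%:R * pi) = 0 :> R.
Proof. by elim: k => [|k IH]; rewrite ?mul0r ?sin0// -natr1 mulrDl mul1r sinDpi IH oppr0. Qed.

Lemma cos_natpi k : cos (k%:R * pi) = (-1) ^+ k :> R.
Proof. by elim: k => [|k IH]; rewrite ?mul0r ?cos0// -natr1 mulrDl mul1r cosDpi IH exprS mulN1r. Qed.

Lemma cheb_angle_mulr m j : (0 < m)%N -> m%:R * cheb_angle m j = j%:R * pi + pi / 2.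
Proof.
move=> m0; rewrite /cheb_angle -addn1 natrD; field.
by rewrite pnatr_eq0 -lt0n.
Qed.

Lemma cos_cheb_angle m j : (0 < m)%N -> cos (m%:R * cheb_angle m j) = 0.
Proof. by move=> m0; rewrite cheb_angle_mulr// cosDpihalf sin_natpi oppr0. Qed.

Lemma cheb_node_inj m : injective (@cheb_node R m).
Proof.
move=> i j; rewrite !cheb_nodeE => /cos_inj.
have Hi := cheb_angle_bound (ltn_ord i); have Hj := cheb_angle_bound (ltn_ord j).
have m0 : 0 < m%:R :> R by rewrite ltr0n; case: m i Hi {Hj j} => [[]|].
rewrite !in_itv /= => /(_ ltac:(lra) ltac:(lra)); rewrite /cheb_angle.
move/(congr1 (fun x => x * (2 * m%:R) / pi)).
rewrite !divfK ?mulf_neq0 ?gt_eqF// !mulfK ?gt_eqF ?pi_gt0//.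
move/(congr1 (fun x => (x + 1) / 2)); rewrite !subrK ![2 * _]mulrC !mulfK// => /eqP.
by rewrite eqr_nat eqSS => /eqP/val_inj.
Qed.

(** Candidate for the j-th basis polynomial: its expansion in Chebyshev polynomials, the
    coefficients being those given by the discrete orthogonality of cosines at the nodes. *)
Definition cheb_fundamental m (j : nat) : {poly R} :=
  (m%:R)^-1 *: (1 + 2 *: (\sum_(1 <= k < m)
     cos (k%:R * cheb_angle m j) *: chebyshev k)).

Lemma size_cheb_fundamental m j : (0 < m)%N ->
  (size (cheb_fundamental m j) <= m)%N.
Proof.
move=> m0; rewrite (leq_trans (size_scale_leq _ _))//.
rewrite (leq_trans (size_polyD _ _))// geq_max size_poly1 m0 /=.
rewrite (leq_trans (size_scale_leq _ _))//.
rewrite big_nat; elim/big_ind : _ => [|p q pm qm|k /andP[_ km]].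
- by rewrite size_poly0.
- by rewrite (leq_trans (size_polyD _ _))// geq_max pm qm.
- by rewrite (leq_trans (size_scale_leq _ _))// (leq_trans (size_chebyshev _)).
Qed.

(** Product-to-sum formula; the terms of frequency m in the two kernels cancel because the node
    angle is a zero of cos (m t), which leaves a polynomial of degree below m. *)
Lemma cheb_fundamental_cos m j t : (0 < m)%N ->
  (cheb_fundamental m j).[cos t] =
  interp_kernel m (t - cheb_angle m j) + interp_kernel m (t + cheb_angle m j).
Proof.
move=> m0; have mn : m%:R != 0 :> R by rewrite pnatr_eq0 -lt0n.
rewrite /cheb_fundamental hornerZ hornerD hornerC hornerZ horner_sum.
under eq_bigr do rewrite hornerZ chebyshev_cos.
rewrite /interp_kernel.
have -> : cos (m%:R * (t - cheb_angle m j)) = - cos (m%:R * (t + cheb_angle m j)).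
  by rewrite mulrBr mulrDr cosB cosD cos_cheb_angle// mulr0 !add0r opprK.
rewrite -mulrDr.
set S1 := \sum_(_ <= _ < _) cos (_ * (_ - _)).
set S2 := \sum_(_ <= _ < _) cos (_ * (_ + _)).
set S := \sum_(_ <= _ < _) _ * _.
have -> : S = (S1 + S2) / 2.
  rewrite /S1 /S2 -big_split /= mulr_suml; apply: eq_bigr => k _.
  by rewrite mulrBr mulrDr cosB cosD; field.
by field.
Qed.

(** The kernel vanishes where sin (m u) does and sin (u/2) does not; this covers all sums and all
    nonzero differences of node angles. *)
Lemma cheb_fundamental_node m (i j : 'I_m) :
  (cheb_fundamental m j).[cheb_node R i] = (i == j)%:R.
Proof.
have m0 : (0 < m)%N by case: m i {j} => [[]|].
have mn : m%:R != 0 :> R by rewrite pnatr_eq0 -lt0n.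
rewrite cheb_nodeE cheb_fundamental_cos//.
have /andP[i0 ipi] := cheb_angle_bound (ltn_ord i).
have /andP[j0 jpi] := cheb_angle_bound (ltn_ord j).
have K0 u : sin (u / 2) != 0 -> sin (m%:R * u) = 0 -> interp_kernel m u = 0.
  move=> su smu; have := interp_kernelE u m0; rewrite smu mul0r => /eqP.
  have m2 : 2 * m%:R != 0 :> R by rewrite mulf_neq0// pnatr_eq0.
  by rewrite mulf_eq0 (negbTE su) orbF mulf_eq0 (negbTE m2) => /eqP.
have smi k : sin (m%:R * cheb_angle m k) = (-1) ^+ k.
  by rewrite cheb_angle_mulr// sinDpihalf cos_natpi.
rewrite (K0 (cheb_angle m i + cheb_angle m j)) ?addr0; last 2 first.
- by rewrite gt_eqF// sin_gt0_pi//; apply/andP; split; lra.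
- by rewrite mulrDr sinD !cos_cheb_angle// mulr0 mul0r addr0.
have [->|ij] := eqVneq i j; first by rewrite subrr interp_kernel0.
rewrite K0//; last by rewrite mulrBr sinB !cos_cheb_angle// mulr0 mul0r subr0.
have : cheb_angle m i != cheb_angle m j.
  by apply: contra ij => /eqP h; apply/eqP/cheb_node_inj; rewrite !cheb_nodeE h.
rewrite neq_lt => /orP[h|h].
  by rewrite -oppr_eq0 -sinN gt_eqF// sin_gt0_pi//; apply/andP; split; lra.
by rewrite gt_eqF// sin_gt0_pi//; apply/andP; split; lra.
Qed.

(** The difference of the two sides is a polynomial of size at most m with the m distinct nodes as
    roots. *)
Lemma lagrange_interp_poly m (q : {poly R}) x : (size q <= m)%N ->
  lagrange_interp m (fun y => q.[y]) x = q.[x].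
Proof.
move=> qm.
pose L (j : 'I_m) : {poly R} := \prod_(i < m | i != j)
   ((cheb_node R j - cheb_node R i)^-1 *: ('X - (cheb_node R i)%:P)).
have LE j y : (L j).[y] = lagrange_basis j y.
  rewrite /L /lagrange_basis horner_prod; apply: eq_bigr => i _.
  by rewrite hornerZ hornerXsubC mulrC.
have sL j : (size (L j) <= m)%N.
  rewrite (leq_trans (size_poly_prod_leq _ _))//.
  have h : (\sum_(i < m | i != j) size ((cheb_node R j - cheb_node R i)^-1 *: ('X - (cheb_node R i)%:P)) <= \sum_(i < m | i != j) 2)%N.
    apply: leq_sum => i _; rewrite (leq_trans (size_scale_leq _ _))//.
    by rewrite size_XsubC.
  rewrite sum_nat_const in h.
  have c : (#|[pred i | i != j]|.+1 = m)%N.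
    by rewrite -[RHS](card_ord m) [RHS](cardD1 j) inE add1n; congr _.+1; apply: eq_card => i; rewrite !inE andbT.
  by move: h c; move: (\sum_(_ < _ | _) _)%N #|_| => S C; lia.
have LN i j : (L j).[cheb_node R i] = (i == j)%:R.
  rewrite LE /lagrange_basis; have [->|ij] := eqVneq i j.
    rewrite big1// => k kj; rewrite mulfV// subr_eq0.
    by apply: contra kj => /eqP/cheb_node_inj ->.
  by rewrite (bigD1 i)//= subrr !mul0r.
pose p := \sum_(j < m) q.[cheb_node R j] *: L j - q.
suff p0 : p = 0.
  have /(congr1 (fun r : {poly R} => r.[x])) := p0.
  rewrite /p hornerD hornerN horner_sum horner0 => /eqP; rewrite subr_eq0 => /eqP <-.
  by apply: eq_bigr => j _; rewrite hornerZ LE.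
apply: (@roots_geq_poly_eq0 _ p [seq cheb_node R i | i <- enum 'I_m]).
- apply/allP => _ /mapP[i _ ->]; rewrite /root /p hornerD hornerN horner_sum.
  rewrite (bigD1 i)//= hornerZ LN eqxx mulr1 big1 ?addr0 ?subrr// => j ji.
  by rewrite hornerZ LN eq_sym (negbTE ji) mulr0.
- by rewrite map_inj_uniq ?enum_uniq//; exact: cheb_node_inj.
- rewrite size_map size_enum_ord (leq_trans (size_polyD _ _))// size_polyN geq_max qm andbT.
  elim/big_ind : _ => [|r s rm sm|k _].
  + by rewrite size_poly0.
  + by rewrite (leq_trans (size_polyD _ _))// geq_max rm sm.
  + by rewrite (leq_trans (size_scale_leq _ _)).
Qed.

Lemma lagrange_basis_cos m (j : 'I_m) t :
  lagrange_basis j (cos t) =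
  interp_kernel m (t - cheb_angle m j) + interp_kernel m (t + cheb_angle m j).
Proof.
have m0 : (0 < m)%N by case: m j => [[]|].
rewrite -cheb_fundamental_cos// -(lagrange_interp_poly _ (size_cheb_fundamental j m0)).
rewrite /lagrange_interp (bigD1 j)//= cheb_fundamental_node eqxx mul1r big1 ?addr0//.
by move=> i ij; rewrite cheb_fundamental_node (negbTE ij) mul0r.
Qed.

Lemma lagrange_interp_cos m (g : R -> R) t :
  lagrange_interp m g (cos t) = \sum_(j < m) g (cos (cheb_angle m j)) *
  (interp_kernel m (t - cheb_angle m j) + interp_kernel m (t + cheb_angle m j)).
Proof. by apply: eq_bigr => j _; rewrite lagrange_basis_cos. Qed.

End chebyshev_polynomials.

(** * Inequalities for sine, cosine and cotangent *)

Section trig_inequalities.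
Variable R : realType.
Implicit Types x y a e : R.

Lemma cos_lipschitz x y : `|cos x - cos y| <= `|x - y|.
Proof.
wlog xy : x y / x <= y => [H|].
  have [xy|/ltW xy] := leP x y; first exact: H.
  by rewrite distrC [leRHS]distrC; exact: H.
rewrite distrC [leRHS]distrC.
have D z : z \in `]x, y[%R -> is_derive z 1 cos (- sin z).
  by move=> _; exact: is_derive_cos.
have C : {within `[x, y], continuous (@cos R)}.
  by apply: continuous_subspaceT; exact: continuous_cos.
have [c _ ->] := MVT_segment xy D C.
rewrite normrM ler_piMl// normrN; exact: sin_max.
Qed.

Lemma sin_le_id x : `|sin x| <= `|x|.
Proof.
have := cos_lipschitz (pi / 2 - x) (pi / 2).
by rewrite cosB cos_pihalf sin_pihalf mul0r add0r mul1r subr0 addrAC subrr add0r normrN.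
Qed.

Lemma one_sub_cos_le x : 1 - cos x <= x ^+ 2 / 2.
Proof.
have -> : cos x = cos (x / 2 + x / 2) by congr cos; field.
have := sin_le_id (x / 2); rewrite cosD -[_ * _ in X in _ - X]expr2 cos2sin2.
rewrite -ler_sqr ?nnegrE// !real_normK ?num_real// => h.
have : (x / 2) ^+ 2 = x ^+ 2 / 4 by field.
by move: h; move: (sin _) ((x / 2) ^+ 2) => s t h ht; nra.
Qed.

Lemma mul_cos_le_sin x : 0 <= x <= pi -> x * cos x <= sin x.
Proof.
move=> /andP[x0 xpi].
pose f (z : R) : R := sin z - z * cos z.
have D z : z \in `]0, x[%R -> is_derive z 1 f (z * sin z).
  move=> _; have -> : z * sin z = cos z - (z *: (- sin z) + cos z *: 1).
    by rewrite /GRing.scale /=; ring.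
  by apply: is_deriveB.
have C : {within `[0, x], continuous f}.
  apply: continuous_subspaceT => z; apply: cvgB; first exact: continuous_sin.
  by apply: cvgM; [exact: cvg_id|exact: continuous_cos].
have [c] := MVT_segment x0 D C.
rewrite in_itv /= => /andP[c0 cx].
rewrite /f sin0 mul0r !subr0 => h.
rewrite -subr_ge0 h !mulr_ge0// sin_ge0_pi// c0 /=; exact: le_trans xpi.
Qed.

(** The sum on the right equals 2 cos a sin a / (sin^2 a - sin^2 e). The point a + e may exceed
    pi/2, as the last of three consecutive half angles does at the end of a window. *)
Lemma cot_convex a e : 0 <= e -> 0 < a - e -> a <= pi / 2 -> a + e < pi ->
  2 * (cos a / sin a) <= cos (a - e) / sin (a - e) + cos (a + e) / sin (a + e).
Proof.
move=> e0 ae api aepi.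
have p0 := pi_gt0 R.
have s0 : 0 < sin a by apply: sin_gt0_pi; apply/andP; split; lra.
have s1 : 0 < sin (a - e) by apply: sin_gt0_pi; apply/andP; split; lra.
have s2 : 0 < sin (a + e) by apply: sin_gt0_pi; apply/andP; split; lra.
have c0 : 0 <= cos a by apply: cos_ge0_pihalf; apply/andP; split; lra.
rewrite addf_div ?gt_eqF// mulrA ler_pdivrMr// mulrAC ler_pdivlMr ?mulr_gt0//.
have -> : cos (a - e) * sin (a + e) + cos (a + e) * sin (a - e) = 2 * cos a * sin a.
  rewrite sinB cosB sinD cosD; have := cos2Dsin2 e.
  move: (cos a) (sin a) (cos e) (sin e) => A B C D h.
  transitivity (2 * A * B * (C ^+ 2 + D ^+ 2)); first by ring.
  by rewrite h mulr1.
have -> : sin (a - e) * sin (a + e) = sin a ^+ 2 - sin e ^+ 2.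
  rewrite sinB sinD.
  transitivity (sin a ^+ 2 * cos e ^+ 2 - cos a ^+ 2 * sin e ^+ 2); first by ring.
  by rewrite !cos2sin2; ring.
rewrite -[leRHS]mulrA ler_wpM2l ?mulr_ge0// -expr2.
by rewrite lerBlDr lerDl sqr_ge0.
Qed.

Lemma cot_decr a b : 0 < a -> a <= b -> b < pi ->
  cos b / sin b <= cos a / sin a.
Proof.
move=> a0 ab bpi.
have s1 : 0 < sin a by apply: sin_gt0_pi; apply/andP; split; lra.
have s2 : 0 < sin b by apply: sin_gt0_pi; apply/andP; split; lra.
rewrite ler_pdivrMr// mulrAC ler_pdivlMr// -subr_ge0.
have -> : cos a * sin b - cos b * sin a = sin (b - a) by rewrite sinB; ring.
by apply: sin_ge0_pi; apply/andP; split; lra.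
Qed.

End trig_inequalities.

(** * Interpolation as two alternating sums around the point *)

Section interpolation_windows.
Variable R : realType.
Implicit Types (m k : nat) (u x y t : R).

(* Weight, up to sign, of the k-th node at angular distance u + k pi/m; cut off
   after m nodes so that one window covers half of the circle. *)
Definition kernel_window m u k : R :=
  if (k < m)%N then (-1) ^+ k * interp_kernel m (u + k%:R * (pi / m%:R)) else 0.

Lemma kernel_window_sign m u k : (k < m)%N ->
  interp_kernel m (u + k%:R * (pi / m%:R)) = (-1) ^+ k * kernel_window m u k.
Proof.
by move=> km; rewrite /kernel_window km signrMK.
Qed.

(** Half the angular distance to the k-th node, at which the cotangent is taken. *)
Let ypos m u k : R := u / 2 + k%:R * (pi / m%:R / 2).

Lemma kernel_window0 m k : (0 < m)%N -> kernel_window m 0 k = (k == 0%N)%:R.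
Proof.
move=> m0; rewrite /kernel_window; case: k => [|k].
  by rewrite m0 expr0 mul1r mul0r addr0 interp_kernel0.
case: ifP => // km; rewrite add0r.
have mn : m%:R != 0 :> R by rewrite pnatr_eq0 -lt0n.
have := interp_kernelE (k.+1%:R * (pi / m%:R) : R) m0.
have -> : m%:R * (k.+1%:R * (pi / m%:R)) = k.+1%:R * pi :> R by field.
rewrite sin_natpi mul0r => /eqP; rewrite mulf_eq0 mulf_eq0.
have m2 : 2 * m%:R != 0 :> R by rewrite mulf_neq0.
rewrite (negbTE m2) /= => /orP[/eqP ->|]; first by rewrite mulr0.
rewrite gt_eqF// sin_gt0_pi//.
have k0 : 0 < k.+1%:R :> R by rewrite ltr0n.
have mm : 0 < m%:R :> R by rewrite ltr0n.
have k1 : k.+1%:R < m%:R :> R by rewrite ltr_nat.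
have p0 := pi_gt0 R.
apply/andP; split; first by rewrite !mulr_gt0 ?invr_gt0.
have dm : m%:R * (pi / m%:R) = pi :> R by rewrite mulrC divfK.
have d0 : 0 < pi / m%:R :> R by rewrite divr_gt0.
by move: (pi / m%:R) dm d0 => d dm d0; nra.
Qed.

(** As sin (m (u + k pi/m)) = (-1)^k sin (m u), the sign in the window removes the alternation, and
    the weight is a constant times a cotangent; monotonicity, convexity and decay come from the
    latter. *)
Lemma kernel_windowE m u k : (0 < u) -> u <= pi / m%:R -> (k < m)%N ->
  0 < ypos m u k <= pi / 2 /\
  kernel_window m u k =
    sin (m%:R * u) / (2 * m%:R) * (cos (ypos m u k) / sin (ypos m u k)).
Proof.
move=> u0 um km.
have m0 : (0 < m)%N by case: m km {um}.
have mm : 0 < m%:R :> R by rewrite ltr0n.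
have p0 := pi_gt0 R.
have d0 : 0 < pi / m%:R :> R by rewrite divr_gt0.
have k1 : k%:R <= m%:R - 1 :> R by rewrite lerBrDr natr1 ler_nat.
have kk : 0 <= k%:R :> R by [].
have dm : m%:R * (pi / m%:R) = pi :> R by rewrite mulrC divfK// gt_eqF.
have yb : 0 < ypos m u k <= pi / 2.
  rewrite /ypos; move: (pi / m%:R) d0 dm um => d d0 dm um.
  by apply/andP; split; nra.
split=> //; have /andP[y0 y1] := yb.
have sy : 0 < sin (ypos m u k) by apply: sin_gt0_pi; apply/andP; split; lra.
rewrite /kernel_window km.
have := interp_kernelE (u + k%:R * (pi / m%:R)) m0.
have -> : (u + k%:R * (pi / m%:R)) / 2 = ypos m u k by rewrite /ypos; ring.
have -> : m%:R * (u + k%:R * (pi / m%:R)) = m%:R * u + k%:R * pi.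
  by rewrite mulrDr mulrCA dm.
rewrite (sinD (m%:R * u) (k%:R * pi)) cos_natpi sin_natpi mulr0 addr0 => h.
have -> : interp_kernel m (u + k%:R * (pi / m%:R)) =
   sin (m%:R * u) * (-1) ^+ k * cos (ypos m u k) / (2 * m%:R * sin (ypos m u k)).
  by rewrite -h; field; rewrite !gt_eqF.
have -> : sin (m%:R * u) * (-1) ^+ k = (-1) ^+ k * sin (m%:R * u) by rewrite mulrC.
rewrite -!mulrA signrMK.
by field; rewrite !gt_eqF.
Qed.

(** The first position cut off lies at or past pi/2, where the cotangent is nonpositive; replacing
    its value by 0 therefore preserves convexity. *)
Lemma ypos_last m u : (1 < m)%N -> 0 < u -> u <= pi / m%:R ->
  pi / 2 <= ypos m u m < pi.
Proof.
move=> m1 u0 um.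
have mm : 2 <= m%:R :> R by rewrite ler_nat.
have p0 := pi_gt0 R.
have dm : m%:R * (pi / m%:R) = pi :> R by rewrite mulrC divfK// gt_eqF//; lra.
rewrite /ypos; move: (pi / m%:R) dm um => d dm um.
by apply/andP; split; nra.
Qed.

Lemma yposS m u k : ypos m u k.+1 = ypos m u k + pi / m%:R / 2.
Proof. by rewrite /ypos -natr1; ring. Qed.

Section bounds.
Variables (m : nat) (u : R).
Hypotheses (m1 : (1 < m)%N) (u0 : 0 <= u) (um : u <= pi / m%:R).

Let m0 : (0 < m)%N. Proof. exact: ltnW. Qed.
Let mm : 0 < m%:R :> R. Proof. by rewrite ltr0n. Qed.
Let d0 : 0 < pi / m%:R :> R. Proof. by rewrite divr_gt0 ?pi_gt0. Qed.

Let s0 : 0 <= sin (m%:R * u) / (2 * m%:R).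
Proof.
rewrite divr_ge0 ?mulr_ge0// sin_ge0_pi// mulr_ge0//=.
by rewrite mulrC -ler_pdivlMr.
Qed.

Lemma kernel_window_ge0 k : 0 <= kernel_window m u k.
Proof.
have [km|mk] := ltnP k m; last by rewrite /kernel_window ltnNge mk.
move: u0; rewrite le_eqVlt => /predU1P[<-|u1]; first by rewrite kernel_window0.
have [/andP[y0 y1] ->] := kernel_windowE u1 um km.
rewrite mulr_ge0// divr_ge0//.
  by apply: cos_ge0_pihalf; apply/andP; split; have := pi_gt0 R; lra.
by apply: sin_ge0_pi; apply/andP; split; have := pi_gt0 R; lra.
Qed.

Lemma kernel_window_decr k : kernel_window m u k.+1 <= kernel_window m u k.
Proof.
have [km|mk] := ltnP k.+1 m; last first.
  by rewrite {1}/kernel_window ltnNge mk kernel_window_ge0.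
move: u0; rewrite le_eqVlt => /predU1P[<-|u1]; first by rewrite !kernel_window0.
have [/andP[y0 y1] ->] := kernel_windowE u1 um km.
have [/andP[y2 y3] ->] := kernel_windowE u1 um (ltnW km).
rewrite ler_wpM2l//; apply: cot_decr => //; last by have := pi_gt0 R; lra.
by rewrite yposS lerDl divr_ge0// ltW.
Qed.

Lemma kernel_window_convex k :
  0 <= kernel_window m u k - 2 * kernel_window m u k.+1 + kernel_window m u k.+2.
Proof.
have [km|mk] := ltnP k.+1 m; last first.
  rewrite {2 3}/kernel_window ltnNge mk /= ltnNge leqW//= mulr0 subr0 addr0.
  exact: kernel_window_ge0.
move: (u0); rewrite le_eqVlt => /predU1P[<-|u1].
  by rewrite !kernel_window0//= mulr0n mulr0 subr0 addr0.
have [/andP[y0 y1] ->] := kernel_windowE u1 um km.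
have [/andP[y2 y3] ->] := kernel_windowE u1 um (ltnW km).
have p0 := pi_gt0 R.
have e2 : ypos m u k.+2 < pi.
  have /andP[_] := ypos_last m1 u1 um; apply: le_lt_trans.
  by rewrite /ypos lerD2l ler_wpM2r ?ler_nat// ltW// divr_gt0.
have C : 2 * (cos (ypos m u k.+1) / sin (ypos m u k.+1)) <=
   cos (ypos m u k) / sin (ypos m u k) + cos (ypos m u k.+2) / sin (ypos m u k.+2).
  have := @cot_convex R (ypos m u k.+1) (pi / m%:R / 2).
  have -> : ypos m u k.+1 - pi / m%:R / 2 = ypos m u k by rewrite yposS addrK.
  have d1 := d0; rewrite -yposS; apply => //; lra.
move: C; set A := _ / _; set B := _ / _; set D := _ / _ => C.
have [km2|mk2] := ltnP k.+2 m.
  have [_ ->] := kernel_windowE u1 um km2; rewrite -/D.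
  by move: s0; move: (sin _ / _) => S S0; nra.
have e3 : k.+2 = m by apply/eqP; rewrite eqn_leq km mk2.
have D0 : D <= 0.
  have /andP[z0 z1] := ypos_last m1 u1 um; rewrite /D e3.
  have sz : 0 < sin (ypos m u m) by apply: sin_gt0_pi; apply/andP; split; lra.
  have -> : cos (ypos m u m) = - cos (ypos m u m - pi) by rewrite -cosDpi subrK.
  rewrite ler_pdivrMr// mul0r oppr_le0.
  by apply: cos_ge0_pihalf; apply/andP; split; lra.
rewrite /kernel_window e3 ltnn addr0.
by move: s0; move: (sin _ / _) => S S0; nra.
Qed.

Lemma kernel_window_head : kernel_window m u 0 <= 1.
Proof.
rewrite /kernel_window m0 expr0 mul1r.
exact: (le_trans (ler_norm _) (interp_kernel_le1 _ m0)).
Qed.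

(** Here cot y <= 1/y, and the half angle y satisfies 2 m y = m u + (k+1) pi, which is at least
    k+1. *)
Lemma kernel_window_inv k : kernel_window m u k.+1 <= k.+1%:R^-1.
Proof.
have [km|mk] := ltnP k.+1 m; last by rewrite /kernel_window ltnNge mk/= invr_ge0.
move: (u0); rewrite le_eqVlt => /predU1P[<-|u1].
  by rewrite !kernel_window0//= invr_ge0.
have [/andP[y0 y1] ->] := kernel_windowE u1 um km.
have p2 := pi_ge2 R.
have sy : 0 < sin (ypos m u k.+1) by apply: sin_gt0_pi; apply/andP; split; lra.
have c1 : cos (ypos m u k.+1) / sin (ypos m u k.+1) <= (ypos m u k.+1)^-1.
  rewrite ler_pdivrMr// -ler_pdivrMl ?invr_gt0// invrK.
  by apply: mul_cos_le_sin; apply/andP; split; lra.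
have c0 : 0 <= cos (ypos m u k.+1) / sin (ypos m u k.+1).
  by rewrite divr_ge0 ?(ltW sy)// cos_ge0_pihalf//; apply/andP; split; lra.
have s1 : sin (m%:R * u) / (2 * m%:R) <= (2 * m%:R)^-1.
  by rewrite ler_piMl ?invr_ge0 ?mulr_ge0// sin_le1.
apply: (le_trans (ler_pM _ _ s1 c1)) => //.
have k0 : 0 < k.+1%:R :> R by rewrite ltr0n.
rewrite -invfM lef_pV2 ?posrE// ?mulr_gt0//.
have dm : m%:R * (pi / m%:R) = pi :> R by rewrite mulrC divfK// gt_eqF.
have : 2 * m%:R * ypos m u k.+1 = m%:R * u + k.+1%:R * pi.
  by rewrite /ypos; field; rewrite gt_eqF.
move=> ->; have : 0 <= m%:R * u by rewrite mulr_ge0 ?ltW.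
by move: (m%:R * u) k.+1%:R k0 => v w w0 v0; nra.
Qed.

End bounds.

(** The 2m angles of the nodes and of their opposites are equally spaced on the circle. From t, one
    window runs upwards, starting at distance v with the first node angle beyond t and passing
    through pi to the reflected nodes; the other runs downwards through 0. Each has m terms, with
    signs alternating with the rank. *)
Lemma cheb_interp_windows m t : (0 < m)%N -> 0 <= t <= pi ->
  exists2 v, 0 <= v <= pi / m%:R & forall g : R -> R,
  lagrange_interp m g (cos t) =
  \sum_(k < m) (-1) ^+ k * kernel_window m v k *
      g (cos (v + t + k%:R * (pi / m%:R))) +
  \sum_(k < m) (-1) ^+ k * kernel_window m (pi / m%:R - v) k *
      g (cos (pi / m%:R - v - t + k%:R * (pi / m%:R))).
Proof.
move=> m0 /andP[t0 tpi].
have mm : 0 < m%:R :> R by rewrite ltr0n.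
have mn : m%:R != 0 :> R by rewrite gt_eqF.
have p0 := pi_gt0 R.
pose a j := cheb_angle R m j.
have aE j : a j = (j%:R + 2^-1) * (pi / m%:R).
  by rewrite /a /cheb_angle -(natr1 j); field.
have d0 : 0 < pi / m%:R :> R by rewrite divr_gt0.
have dm : m%:R * (pi / m%:R) = pi :> R by rewrite mulrC divfK.
(* The angle [a m] lies beyond pi, so that p = m covers the points past the last node. *)
have ex : exists p, t < a p.
  by exists m; rewrite aE mulrDl dm (le_lt_trans tpi)// ltrDl mulr_gt0.
case: (ex_minnP ex) => p tp pmin.
have pm : (p <= m)%N by apply: pmin; rewrite aE mulrDl dm (le_lt_trans tpi)// ltrDl mulr_gt0.
have vle : a p - t <= pi / m%:R.
  case: p tp pmin {pm} => [|p] tp pmin.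
    by rewrite aE add0r; lra.
  have : a p <= t by rewrite leNgt; apply/negP => /pmin; rewrite ltnn.
  by rewrite !aE -(natr1 p); lra.
exists (a p - t); first by rewrite vle andbT subr_ge0 ltW.
move=> g; rewrite lagrange_interp_cos.
under [in RHS]eq_bigr => k _ do rewrite -kernel_window_sign//.
under [X in _ = _ + X]eq_bigr => k _ do rewrite -kernel_window_sign//.
pose A j := g (cos (a j)) * interp_kernel m (t - a j).
pose B j := g (cos (a j)) * interp_kernel m (t + a j).
rewrite (eq_bigr (fun j : 'I_m => A j + B j)); last by move=> j _; rewrite mulrDr.
rewrite big_split /=.
pose WR k := interp_kernel m (a p - t + k%:R * (pi / m%:R)) *
  g (cos (a p - t + t + k%:R * (pi / m%:R))).
pose WL k := interp_kernel m (pi / m%:R - (a p - t) + k%:R * (pi / m%:R)) *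
  g (cos (pi / m%:R - (a p - t) - t + k%:R * (pi / m%:R))).
rewrite -!(big_mkord xpredT A) -!(big_mkord xpredT B).
rewrite -!(big_mkord xpredT WR) -!(big_mkord xpredT WL).
rewrite (@big_cat_nat _ _ _ p 0 m)//=.
rewrite (@big_cat_nat _ _ _ (m - p) 0 m _ B)//= ?leq_subr//.
rewrite (@big_cat_nat _ _ _ (m - p) 0 m _ WR)//= ?leq_subr//.
rewrite (@big_cat_nat _ _ _ p 0 m _ WL)//=.
have -> : \sum_(p <= i < m) A i = \sum_(0 <= i < m - p) WR i.
  rewrite -{1}[p]add0n big_addn; apply: eq_bigr => i _.
  rewrite /A /WR mulrC -interp_kernelN; congr (interp_kernel _ _ * g (cos _)).
    by rewrite !aE natrD; ring.
  by rewrite !aE natrD; ring.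
have -> : \sum_(0 <= i < p) A i = \sum_(0 <= i < p) WL i.
  rewrite big_nat_rev /= !big_nat; apply: eq_bigr => i /andP[_ ip].
  rewrite /A /WL mulrC add0n; congr (interp_kernel _ _ * g _).
    by rewrite !aE natrB// -natr1; ring.
  by rewrite -cosN !aE natrB// -natr1; congr cos; ring.
have -> : \sum_(m - p <= i < m) B i = \sum_(m - p <= i < m) WR i.
  rewrite big_nat_rev /= !big_nat; apply: eq_bigr => i /andP[ip im].
  rewrite /B /WR mulrC.
  have e : a (m - p + m - i.+1)%N = 2 * pi - a (p + i)%N.
    rewrite !aE !natrB ?natrD ?natrB -?natr1//; last by lia.
    by rewrite -dm; field.
  rewrite e; congr (_ * g _).
    rewrite -interp_kernelN -interp_kernelD2pi; congr interp_kernel.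
    by rewrite !aE natrD; ring.
  rewrite -cosN opprB -(cosD2pi (_ - _)); congr cos.
  by rewrite !aE natrD mulr2n; ring.
have -> : \sum_(0 <= i < m - p) B i = \sum_(p <= i < m) WL i.
  rewrite -{2}[p]add0n big_addn; apply: eq_bigr => i _.
  rewrite /B /WL mulrC; congr (interp_kernel _ _ * g (cos _)).
    by rewrite !aE (natrD R i p); field.
  by rewrite !aE (natrD R i p); field.
by ring.
Qed.

End interpolation_windows.

(** * Interpolation error of rough and of smooth functions *)

Section interpolation_bounds.
Variable R : realType.
Implicit Types (m k K : nat) (x y z t : R) (U F D : R -> R).

Definition harmonic_sum K : R := \sum_(k < K) (k.+1%:R)^-1.

Lemma harmonic_sum_ge0 K : 0 <= harmonic_sum K.
Proof. by apply: sumr_ge0 => k _; rewrite invr_ge0. Qed.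

Lemma le_harmonic_sum : {homo harmonic_sum : j k / (j <= k)%N >-> j <= k}.
Proof.
move=> j k /subnK <-; elim: (k - j)%N => // i IH.
by rewrite addSn /harmonic_sum big_ord_recr/= -/(harmonic_sum _) (le_trans IH)// lerDl invr_ge0.
Qed.

Lemma harmonic_sum_le_ln K : (0 < K)%N -> harmonic_sum K <= 1 + ln K%:R.
Proof.
elim: K => // -[|K] IH _.
  by rewrite /harmonic_sum big_ord_recr big_ord0 /= add0r invr1 ln1 addr0.
rewrite /harmonic_sum big_ord_recr /= -/(harmonic_sum _).
apply: (@le_trans _ _ (1 + ln K.+1%:R + K.+2%:R^-1)); first by rewrite lerD2r IH.
rewrite -addrA lerD2l -lerBrDl.
have k2 : 0 < K.+2%:R :> R by rewrite ltr0n.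
have k1 : 0 < K.+1%:R :> R by rewrite ltr0n.
rewrite -lerN2 opprB -ln_div ?posrE//.
have -> : K.+1%:R / K.+2%:R = 1 + - (K.+2%:R)^-1 :> R.
  by move: k2; rewrite -(natr1 K.+1) => k2; rewrite -{1}[K.+1%:R](addrK 1) mulrBl mulfV ?gt_eqF// mul1r.
apply: le_ln1Dx; rewrite ltrNr opprK invf_lt1//.
by rewrite ltr1n.
Qed.

(* The potential [cos_height U] increases by at least |U (cos b) - U (cos a)|
   from a to b, so that a sum of such terms telescopes. *)
Definition cos_height U t : R :=
  if t <= 0 then U (cos t) else
  if t <= pi then 2 * U 1 - U (cos t) else 2 * U 1 - 2 * U (- 1) + U (cos t).

Lemma cos_height_incr U a b : (forall x y, x <= y -> U x <= U y) ->
  - pi <= a -> a <= b -> b <= 2 * pi ->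
  `|U (cos b) - U (cos a)| <= cos_height U b - cos_height U a.
Proof.
move=> Um pa ab bp; have p0 := pi_gt0 R.
have U1 t : U (cos t) <= U 1 by apply: Um; exact: cos_le1.
have UN1 t : U (- 1) <= U (cos t) by apply: Um; exact: cos_geN1.
have dec x y : 0 <= x -> x <= y -> y <= pi -> U (cos y) <= U (cos x).
  move=> x0 xy yp; apply: Um; move: xy; rewrite le_eqVlt => /predU1P[->//|xy].
  by apply/ltW; rewrite ltr_cos ?in_itv /= ?x0 ?yp ?(ltW xy)//;
    apply/andP; split; lra.
have inc x y : - pi <= x -> x <= y -> y <= 0 -> U (cos x) <= U (cos y).
  by move=> x0 xy y0; rewrite -[cos x]cosN -[cos y]cosN; apply: dec; lra.
have inc2 x y : pi <= x -> x <= y -> y <= 2 * pi -> U (cos x) <= U (cos y).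
  move=> x0 xy y0.
  have c z : cos z = cos (2 * pi - z).
    by rewrite -[RHS]cosN opprB -(cosD2pi (_ - _)) mulr_natl subrK.
  by rewrite (c x) (c y); apply: dec; lra.
have := U1 a; have := U1 b; have := UN1 a; have := UN1 b.
rewrite /cos_height ler_norml; case: (leP b 0) => b0.
  rewrite (le_trans ab b0) => _ _ _ _; have := inc a b pa ab b0.
  by move=> *; apply/andP; split; lra.
have [a0|a0] := leP a 0; have [bp1|bp1] := leP b pi.
- by move=> *; apply/andP; split; lra.
- by move=> *; apply/andP; split; lra.
- rewrite (le_trans ab bp1) => _ _ _ _; have := dec a b (ltW a0) ab bp1.
  by move=> *; apply/andP; split; lra.
have [ap|ap] := leP a pi; first by move=> *; apply/andP; split; lra.
move=> _ _ _ _; have := inc2 a b (ltW ap) ab bp.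
by move=> *; apply/andP; split; lra.
Qed.

(** Cosine is monotone on each of the three half-turns of [-pi, 2 pi], and on each of them U varies
    by at most 1. *)
Lemma sum_cos_variation U t m : (forall x y, x <= y -> U x <= U y) ->
  (forall x, 0 <= U x <= 1) -> (0 < m)%N -> - pi <= t -> t + m.-1%:R * (pi / m%:R) <= 2 * pi ->
  \sum_(k < m.-1) `|U (cos (t + k.+1%:R * (pi / m%:R))) -
     U (cos (t + k%:R * (pi / m%:R)))| <= 3.
Proof.
move=> Um U01 m0 tl tu; have p0 := pi_gt0 R.
have mm : 0 < m%:R :> R by rewrite ltr0n.
have d0 : 0 <= pi / m%:R :> R by rewrite divr_ge0 ?ltW.
pose h k := cos_height U (t + k%:R * (pi / m%:R)).
have hub k : (k <= m.-1)%N -> t + k%:R * (pi / m%:R) <= 2 * pi.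
  by move=> km; apply: le_trans tu; rewrite lerD2l ler_wpM2r// ler_nat.
apply: (@le_trans _ _ (\sum_(k < m.-1) (h k.+1 - h k))).
  apply: ler_sum => k _; apply: cos_height_incr => //.
  - by apply: (le_trans tl); rewrite lerDl mulr_ge0.
  - by rewrite lerD2l ler_wpM2r// ler_nat.
  - exact: hub.
rewrite -(big_mkord xpredT (fun k => h k.+1 - h k)) telescope_sumr//.
have U1 := U01 1; have UN := U01 (- 1).
have H x : U (- 1) <= U (cos x) <= U 1.
  by rewrite !Um ?cos_le1 ?cos_geN1.
move: UN U1 (H (t + m.-1%:R * (pi / m%:R))) (H (t + 0%:R * (pi / m%:R))).
rewrite /h /cos_height => /andP[? _] /andP[_ ?] /andP[? ?] /andP[? ?].
by do !case: ifP => _; lra.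
Qed.

Lemma lagrange_interp_sub_cst m U c x : (0 < m)%N ->
  lagrange_interp m (fun y => U y - c) x = lagrange_interp m U x - c.
Proof.
move=> m0; have := @lagrange_interp_poly R m c%:P x.
rewrite hornerC size_polyC (leq_trans (leq_b1 _) m0) => /(_ isT) h.
rewrite -[X in _ = _ - X]h.
rewrite /lagrange_interp -sumrB; apply: eq_bigr => j _.
by rewrite /= hornerC mulrBl.
Qed.

Lemma lagrange_interp_sub_affine m U c0 c1 y0 x : (1 < m)%N ->
  lagrange_interp m (fun y => U y - c0 - c1 * (y - y0)) x =
  lagrange_interp m U x - c0 - c1 * (x - y0).
Proof.
move=> m1; have m0 := ltnW m1; pose q : {poly R} := c0%:P + c1 *: ('X - y0%:P).
have qE y : q.[y] = c0 + c1 * (y - y0).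
  by rewrite hornerD hornerC hornerZ hornerXsubC.
have sq : (size q <= m)%N.
  rewrite (leq_trans (size_polyD _ _))// geq_max size_polyC.
  rewrite (leq_trans (leq_b1 _) m0)/= (leq_trans (size_scale_leq _ _))//.
  by rewrite size_XsubC.
have := lagrange_interp_poly x sq; rewrite qE => h.
transitivity (lagrange_interp m U x - (c0 + c1 * (x - y0))); last by ring.
rewrite -h /lagrange_interp -sumrB; apply: eq_bigr => j _.
by rewrite /= qE; ring.
Qed.

Section one_window.
Variables (m : nat) (v : R).
Hypotheses (m1 : (1 < m)%N) (v0 : 0 <= v) (vm : v <= pi / m%:R).

Lemma window_osc_bound (a : nat -> R) w V K : 0 <= w ->
  `|a 0%N| <= w -> (forall k, `|a k.+1 - a k| <= w) ->
  \sum_(k < m.-1) `|a k.+1 - a k| <= V ->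
  `|\sum_(k < m) (-1) ^+ k * kernel_window m v k * a k| <=
  w * (1 + harmonic_sum K) + V / K.+1%:R.
Proof.
move=> w0 a0 aw aV.
have g0 := kernel_window_ge0 m1 v0 vm.
have gd := kernel_window_decr m1 v0 vm.
apply: (le_trans (alt_sum_bound1 _ _ g0 gd)).
rewrite mulrDr mulr1 -addrA; apply: lerD.
  by rewrite -[leRHS]mul1r ler_pM// kernel_window_head.
apply: (@le_trans _ _ (\sum_(k < m.-1)
    ((if (k < K)%N then w / k.+1%:R else 0) + `|a k.+1 - a k| / K.+1%:R))).
  apply: ler_sum => k _; have gi := kernel_window_inv m1 v0 vm k.
  case: ltnP => kK.
    rewrite -[leLHS]addr0; apply: lerD; last by rewrite divr_ge0.
    by rewrite mulrC ler_pM.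
  rewrite add0r mulrC ler_wpM2l//; apply: (le_trans gi).
  by rewrite lef_pV2 ?posrE// ler_nat.
rewrite big_split /= -mulr_suml; apply: lerD; last by rewrite ler_wpM2r// invr_ge0.
rewrite -big_mkcond /= /harmonic_sum mulr_sumr.
rewrite -(big_mkord (fun k => (k < K)%N) (fun k => w / k.+1%:R)).
rewrite -(big_mkord xpredT (fun k => w / k.+1%:R)).
have p k : 0 <= w / k.+1%:R by rewrite divr_ge0.
have [mK|Km] := leqP m.-1 K.
  rewrite big_mkcond (@big_cat_nat _ _ _ m.-1 0 K)//= -[leLHS]addr0; apply: lerD.
    by apply: ler_sum => k _; case: ifP.
  exact: sumr_ge0.
rewrite (@big_cat_nat _ _ _ K 0 m.-1)//= ?(ltnW Km)//.
rewrite [X in _ + X]big1_seq ?addr0.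
  by rewrite big_mkcond; apply: ler_sum => k _; case: ifP.
by move=> k /andP[kK]; rewrite mem_index_iota leqNgt kK.
Qed.

Lemma window_smooth_bound (a : nat -> R) w : 0 <= w ->
  `|a 0%N| <= w -> `|a 1%N| <= w ->
  (forall k, `|a k.+2 - 2 * a k.+1 + a k| <= w) ->
  `|\sum_(k < m) (-1) ^+ k * kernel_window m v k * a k| <=
  w * (3 + harmonic_sum m).
Proof.
move=> w0 a0 a1 a2.
have g0 := kernel_window_ge0 m1 v0 vm.
have gd := kernel_window_decr m1 v0 vm.
have gm i : (m <= i)%N -> kernel_window m v i = 0.
  by move=> mi; rewrite /kernel_window ltnNge mi.
have gc := kernel_window_convex m1 v0 vm.
have gh := kernel_window_head v m1.
apply: (le_trans (alt_sum_bound2 _ g0 gd gm gc)).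
have -> : w * (3 + harmonic_sum m) = 1 * w + 1 * (w + w) + w * harmonic_sum m by ring.
apply: lerD; first apply: lerD.
- by rewrite ler_pM.
- rewrite ler_pM//; first exact: (le_trans (gd 0%N)).
  by apply: (le_trans (ler_normB _ _)); rewrite lerD.
apply: (@le_trans _ _ (\sum_(k < m.-2) w / k.+1%:R)).
  apply: ler_sum => k _; rewrite mulrC ler_pM//.
  exact: (le_trans (gd _) (kernel_window_inv m1 v0 vm k)).
rewrite -mulr_sumr ler_wpM2l// -/(harmonic_sum _) le_harmonic_sum//.
by rewrite -subn2 leq_subr.
Qed.

End one_window.

(* K splits the window: the K nearest nodes contribute w times the sum of the
   weights 1/k, the others the total variation of U times the weight 1/K. *)
Lemma lagrange_interp_osc m U x w K : (1 < m)%N -> -1 <= x <= 1 -> 0 <= w ->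
  (forall y z, -1 <= y <= 1 -> -1 <= z <= 1 -> `|y - z| <= pi / m%:R ->
     `|U y - U z| <= w) ->
  (exists U1 U2, [/\ forall y, U y = U1 y - U2 y,
      forall y z, y <= z -> U1 y <= U1 z, forall y z, y <= z -> U2 y <= U2 z,
      forall y, 0 <= U1 y <= 1 & forall y, 0 <= U2 y <= 1]) ->
  `|lagrange_interp m U x - U x| <= 2 * (w * (1 + harmonic_sum K) + 6 / K.+1%:R).
Proof.
move=> m1 x1 w0 Uw [U1 [U2 [UE U1m U2m U1b U2b]]].
have m0 := ltnW m1; have p0 := pi_gt0 R.
have mm : 0 < m%:R :> R by rewrite ltr0n.
have d0 : 0 <= pi / m%:R :> R by rewrite divr_ge0 ?ltW.
have xc : cos (acos x) = x by rewrite acosK// in_itv.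
set t := acos x in xc.
have tb : 0 <= t <= pi by rewrite acos_ge0// acos_lepi.
have cb z : -1 <= cos z <= 1 by rewrite cos_geN1 cos_le1.
rewrite -lagrange_interp_sub_cst// -xc.
have [v /andP[v0 vm] ->] := cheb_interp_windows m0 tb.
have key s u0 : 0 <= u0 -> u0 <= pi / m%:R -> - pi <= s ->
    s + m.-1%:R * (pi / m%:R) <= 2 * pi -> `|cos s - cos t| <= pi / m%:R ->
  `|\sum_(k < m) (-1) ^+ k * kernel_window m u0 k *
     (U (cos (s + k%:R * (pi / m%:R))) - U (cos t))| <=
    w * (1 + harmonic_sum K) + 6 / K.+1%:R.
  move=> u00 u0m spi s2pi st.
  apply: (@window_osc_bound m u0 m1 u00 u0m
     (fun k => U (cos (s + k%:R * (pi / m%:R))) - U (cos t))) => //.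
  - by rewrite mul0r addr0; apply: Uw.
  - move=> k; rewrite opprB addrA subrK; apply: Uw => //.
    apply: (le_trans (cos_lipschitz _ _)).
    rewrite (_ : _ - _ = pi / m%:R) ?ger0_norm//.
    by rewrite -(natr1 k); ring.
  - have -> : 6 = 3 + 3 :> R by ring.
    apply: (le_trans _ (lerD (sum_cos_variation U1m U1b m0 spi s2pi)
                             (sum_cos_variation U2m U2b m0 spi s2pi))).
    rewrite -big_split; apply: ler_sum => k _ /=.
    move: (cos (s + k.+1%:R * _)) (cos (s + k%:R * _)) => p q; rewrite opprB addrA subrK !UE.
    rewrite (_ : U1 p - U2 p - (U1 q - U2 q) = (U1 p - U1 q) - (U2 p - U2 q)).
      exact: ler_normB.
    by ring.
have mE : m.-1%:R * (pi / m%:R) = pi - pi / m%:R :> R.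
  by rewrite -subn1 natrB// mulrBl mul1r [_ * (_ / _)]mulrC divfK ?gt_eqF.
move/andP: tb => [t0 tpi].
rewrite mulr_natl mulr2n; apply: (le_trans (ler_normD _ _)); apply: lerD.
  apply: key => //; rewrite ?mE; try lra.
  by apply: (le_trans (cos_lipschitz _ _)); rewrite addrK ger0_norm.
apply: key; rewrite ?mE; try lra.
rewrite -(cosN t); apply: (le_trans (cos_lipschitz _ _)).
by rewrite opprK subrK ger0_norm; lra.
Qed.


(** Subtracting the Taylor polynomial of F at x, which interpolation reproduces, makes the values at
    the nearest nodes O(d^2), where d = pi/m. Second differences are O(d^2) too: nodes equally
    spaced in angle are not equally spaced on the line, but the defect yp + ym - 2 z = - 2 z (1 -
    cos d) is itself of that order. *)
Lemma lagrange_interp_smooth m F D C x : (1 < m)%N -> -1 <= x <= 1 -> 0 <= C ->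
  (forall y, -1 <= y <= 1 -> `|D y| <= C) ->
  (forall y z, -1 <= y <= 1 -> -1 <= z <= 1 ->
     `|F z - F y - D y * (z - y)| <= C * (z - y) ^+ 2) ->
  `|lagrange_interp m F x - F x| <=
    8 * C * (pi / m%:R) ^+ 2 * (3 + harmonic_sum m).
Proof.
move=> m1 x1 C0 DC FC; have m0 := ltnW m1; have p0 := pi_gt0 R.
have mm : 0 < m%:R :> R by rewrite ltr0n.
have d0 : 0 <= pi / m%:R :> R by rewrite divr_ge0 ?ltW.
have xc : cos (acos x) = x by rewrite acosK// in_itv.
set t := acos x in xc.
have tb : 0 <= t <= pi by rewrite acos_ge0// acos_lepi.
have cb z : -1 <= cos z <= 1 by rewrite cos_geN1 cos_le1.
pose G y := F y - F x - D x * (y - x).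
have <- : lagrange_interp m G x = lagrange_interp m F x - F x.
  by rewrite lagrange_interp_sub_affine// subrr mulr0 subr0.
rewrite -{1}xc.
have [v /andP[v0 vm] ->] := cheb_interp_windows m0 tb.
set d := pi / m%:R in d0 v0 vm *.
have key s u0 : 0 <= u0 -> u0 <= d -> `|cos s - x| <= d ->
  `|\sum_(k < m) (-1) ^+ k * kernel_window m u0 k *
     G (cos (s + k%:R * d))| <= 4 * C * d ^+ 2 * (3 + harmonic_sum m).
  move=> u00 u0m st.
  have w0 : 0 <= 4 * C * d ^+ 2 by rewrite mulr_ge0 ?sqr_ge0 ?mulr_ge0.
  have Gb e z : -1 <= z <= 1 -> `|z - x| <= e -> `|G z| <= C * e ^+ 2.
    move=> z1 ze; apply: (le_trans (FC _ _ x1 z1)).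
    have e0 : 0 <= e by exact: le_trans ze.
    by rewrite ler_wpM2l// -[leLHS]real_normK ?num_real// ler_sqr ?nnegrE.
  apply: (@window_smooth_bound m u0 m1 u00 u0m (fun k => G (cos (s + k%:R * d)))) => //.
  - rewrite mul0r addr0; apply: (le_trans (Gb d _ _ _)) => //.
    rewrite -mulrA ler_peMl ?mulr_ge0 ?sqr_ge0//; lra.
  - apply: (le_trans (Gb (2 * d) _ _ _)) => //; last by rewrite exprMn; lra.
    rewrite mul1r (_ : _ - _ = (cos (s + d) - cos s) + (cos s - x)); last by ring.
    rewrite (le_trans (ler_normD _ _))// mulr_natl mulr2n lerD//.
    by rewrite (le_trans (cos_lipschitz _ _))// addrAC subrr add0r ger0_norm.
  move=> k; set z := cos (s + k.+1%:R * d).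
  set yp := cos (s + k.+2%:R * d); set ym := cos (s + k%:R * d).
  have zp : yp + ym = 2 * z * cos d.
    have -> : yp = cos ((s + k.+1%:R * d) + d) by congr cos; rewrite -(natr1 k.+1); ring.
    have -> : ym = cos ((s + k.+1%:R * d) - d) by congr cos; rewrite -(natr1 k); ring.
    by rewrite cosB cosD /z; ring.
  have -> : G yp - 2 * G z + G ym = (F yp - F z - D z * (yp - z))
     + (F ym - F z - D z * (ym - z)) + (D z - D x) * (yp + ym - 2 * z).
    by rewrite /G; ring.
  have -> : 4 * C * d ^+ 2 = C * d ^+ 2 + C * d ^+ 2 + (2 * C) * d ^+ 2 by ring.
  have sq a b : `|a - b| <= d -> (a - b) ^+ 2 <= d ^+ 2.
    by move=> h; rewrite -[leLHS]real_normK ?num_real// ler_sqr ?nnegrE.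
  apply: (le_trans (ler_normD _ _)); apply: lerD.
    apply: (le_trans (ler_normD _ _)); apply: lerD.
      apply: (le_trans (FC _ _ (cb _) (cb _))); rewrite ler_wpM2l// sq//.
      rewrite (le_trans (cos_lipschitz _ _))//.
      by rewrite -(natr1 k.+1) (_ : _ - _ = d) ?ger0_norm//; ring.
    apply: (le_trans (FC _ _ (cb _) (cb _))); rewrite ler_wpM2l// sq//.
    rewrite (le_trans (cos_lipschitz _ _))//.
    by rewrite -(natr1 k) (_ : _ - _ = - d) ?normrN ?ger0_norm//; ring.
  rewrite normrM ler_pM//.
    rewrite (le_trans (ler_normB _ _))// mulr_natl mulr2n lerD ?DC//; exact: cb.
  rewrite zp (_ : _ - _ = - (2 * z * (1 - cos d))); last by ring.
  have c1 : 0 <= 1 - cos d by rewrite subr_ge0 cos_le1.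
  rewrite normrN normrM (ger0_norm c1) normrM ger0_norm//.
  have := one_sub_cos_le d; have : `|z| <= 1 by exact: cos_max.
  by move: `|z| (1 - cos d) c1 (normr_ge0 z) => Z E; nra.
have -> : 8 * C * d ^+ 2 * (3 + harmonic_sum m) = 4 * C * d ^+ 2 * (3 + harmonic_sum m) +
   4 * C * d ^+ 2 * (3 + harmonic_sum m) by ring.
apply: (le_trans (ler_normD _ _)); apply: lerD.
  by apply: key => //; rewrite -xc (le_trans (cos_lipschitz _ _))// addrK ger0_norm.
apply: key; [lra|lra|rewrite -xc -(cosN t) (le_trans (cos_lipschitz _ _))//].
by rewrite opprK subrK ger0_norm; lra.
Qed.

End interpolation_bounds.

(** * The empirical process *)

Section exp_bounds.
Variable R : realType.
Implicit Types (x a p l : R).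

Lemma expR_le_quadratic x a : 0 <= a -> x <= a ->
  expR x <= 1 + x + expR a * x ^+ 2 / 2.
Proof.
move=> a0 xa; have c1 : 1 <= expR a by have := expR_ge1Dx a; lra.
pose f (y : R) : R := 1 + y + expR a / 2 * y ^+ 2 - expR y.
pose df (y : R) : R := 1 + expR a * y - expR y.
have D (y : R) : is_derive y (1 : R) f (df y).
  rewrite /f; apply: is_derive_eq; rewrite /df /GRing.scale /=. by field.
have C b c : {within `[b, c], continuous f}.
  apply: continuous_subspaceT => y; apply: differentiable_continuous.
  by apply/derivable1_diffP; case: (D y).
have f0 : f 0 = 0 by rewrite /f expR0; ring.
suff : 0 <= f x by rewrite /f; lra.
have [x0|x0] := leP 0 x.
  have [c] := MVT_segment x0 (fun y _ => D y) (C 0 x).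
  rewrite in_itv /= f0 !subr0 => /andP[c0 cx] ->; rewrite mulr_ge0//.
  rewrite /df; have h1 : expR c <= expR a by rewrite ler_expR (le_trans cx).
  have h2 : expR c * expR (- c) = 1 by rewrite expRxMexpNx_1.
  have h3 := expR_ge1Dx (- c); have h4 := expR_gt0 c.
  by move: (expR c) (expR (- c)) (expR a) h1 h2 h3 h4 => u v w; nra.
have [c] := MVT_segment (ltW x0) (fun y _ => D y) (C x 0).
rewrite in_itv /= f0 !sub0r => /andP[cx c0] h.
suff : df c <= 0 by move: h; nra.
by rewrite /df; have h3 := expR_ge1Dx c; nra.
Qed.

Definition bernoulli_mgf p l : R :=
  p * expR (l * (1 - p)) + (1 - p) * expR (- (l * p)).

Lemma bernoulli_mgf_ge1 p l : 0 <= p <= 1 -> 1 <= bernoulli_mgf p l.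
Proof.
move=> /andP[p0 p1]; rewrite /bernoulli_mgf.
have := expR_ge1Dx (l * (1 - p)); have := expR_ge1Dx (- (l * p)).
move: (expR _) (expR _) => u v; nra.
Qed.

(** The factor [expR a] stays explicit: for small l the bound is nearly the Laplace transform of a
    Gaussian of variance v, as the sharp constant requires. *)
Lemma bernoulli_mgf_le p l v a : 0 <= p <= 1 -> p * (1 - p) <= v -> `|l| <= a ->
  bernoulli_mgf p l <= expR (expR a * l ^+ 2 * v / 2).
Proof.
move=> /andP[p0 p1] pv la.
apply: le_trans (expR_ge1Dx _).
have a0 : 0 <= a by exact: le_trans la.
have la1 : l * (1 - p) <= a.
  apply: (le_trans _ la); apply: (le_trans (ler_norm _)).
  by rewrite normrM ler_piMr// ger0_norm; lra.
have la2 : - (l * p) <= a.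
  apply: (le_trans _ la); apply: (le_trans (ler_norm _)).
  by rewrite normrN normrM ler_piMr// ger0_norm; lra.
have := expR_le_quadratic a0 la1; have := expR_le_quadratic a0 la2.
rewrite /bernoulli_mgf; have := expR_gt0 a.
move: (expR a) (expR (- (l * p))) (expR (l * (1 - p))) => c u w c0 h1 h2.
apply: (@le_trans _ _ (1 + c * l ^+ 2 * (p * (1 - p)) / 2)).
  have : p * w <= p * (1 + l * (1 - p) + c * (l * (1 - p)) ^+ 2 / 2). by rewrite ler_wpM2l.
  have : (1 - p) * u <= (1 - p) * (1 + - (l * p) + c * (- (l * p)) ^+ 2 / 2).
    by rewrite ler_wpM2l// subr_ge0.
  lra.
rewrite lerD2l ler_wpM2r ?invr_ge0// ler_wpM2l//.
by rewrite mulr_ge0 ?sqr_ge0// ltW.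
Qed.

End exp_bounds.

(** * Maximal inequality for counts *)

Section maximal_inequality.
Context (R : realType) (d : measure_display) (T : measurableType d)
  (P : probability T R) (phi : nat -> {RV P >-> R}).
Hypothesis phi_indep : mutually_independent P (fun i : nat => sigma_gen [set i] phi).

Definition hits (A : set R) (n : nat) (w : T) : R := \sum_(i < n) \1_A (phi i w).

Section one_set.
Variables (A : set R) (p : R).
Hypotheses (mA : measurable A) (pA : forall i, P (phi i @^-1` A) = p%:E).

Let cyl (b : nat -> bool) (n : nat) : set T :=
  \bigcap_(i in [set i | (i < n)%N]) phi i @^-1` (if b i then A else ~` A).

Let mphi i B : measurable B -> measurable (phi i @^-1` B).
Proof. by move=> mB; exact: measurable_funPTI. Qed.

Let p01 : 0 <= p <= 1.
Proof.
by rewrite -!lee_fin -(pA 0) measure_ge0 probability_le1//; exact: mphi.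
Qed.

Let pAC i b : P (phi i @^-1` (if b then A else ~` A)) = (if b then p else 1 - p)%:E.
Proof.
case: b => //; rewrite preimage_setC probability_setC; last exact: mphi.
by rewrite pA.
Qed.

Let P_cyl b n : P (cyl b n) = (\prod_(i < n) (if b i then p else 1 - p))%:E.
Proof.
have := phi_indep (J := [fset i | i in iota 0 n]%fset)
  (A := fun i => phi i @^-1` (if b i then A else ~` A)).
have -> : [set` [fset i | i in iota 0 n]%fset] = [set i | (i < n)%N].
  by apply/seteqP; split=> i /=; rewrite !inE mem_iota.
rewrite -/(cyl b n) => ->.
  transitivity (\prod_(i <- iota 0 n) P (phi i @^-1` (if b i then A else ~` A)))%E.
    apply: perm_big; apply: uniq_perm; rewrite ?fset_uniq ?iota_uniq// => i.
    by rewrite !inE.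
  under eq_bigr do rewrite pAC.
  by rewrite -prodEFin -{1}[n]subn0 -/(index_iota 0 n) big_mkord.
move=> i _; apply: sub_sigma_algebra; exists i; exists (if b i then A else ~` A).
by split => //; case: (b i) => //; exact: measurableC.
Qed.

Let mcyl b n : measurable (cyl b n).
Proof.
apply: bigcap_measurableType => i _.
by apply: mphi; case: (b i) => //; exact: measurableC.
Qed.

Let mhits n : measurable_fun setT (hits A n).
Proof.
apply: measurable_sum => i; apply: measurableT_comp => //.
Qed.

Let exc l t k N : set T :=
  \bigcup_(n in [set n | (k <= n <= N)%N]) [set w | t <= l * (hits A n w - n%:R * p)].

Let mexc l t k N : measurable (exc l t k N).
Proof.
apply: bigcup_measurable => n _; rewrite -[X in measurable X]setTI.
apply: measurable_fun_le => //; apply: measurable_funM => //; exact: measurable_funB.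
Qed.

Let hits_cyl b n w : cyl b n w -> hits A n w = \sum_(i < n) (b i)%:R.
Proof.
move=> bw; apply: eq_bigr => i _; have := bw i (ltn_ord i).
by rewrite /= indicE; case: (b i) => h; congr (nat_of_bool _)%:R; [exact/mem_set|exact/memNset].
Qed.

Let upd (b : nat -> bool) (k : nat) (x : bool) (i : nat) : bool := if i == k then x else b i.

Let cyl_upd b k x : cyl (upd b k x) k.+1 =
  cyl b k `&` phi k @^-1` (if x then A else ~` A).
Proof.
apply/seteqP; split=> w.
  move=> h; split; last by have := h k (ltnSn k); rewrite /upd eqxx.
  by move=> i /= ik; have := h i (ltnW ik : (i < k.+1)%N); rewrite /upd ltn_eqF.
case=> h1 h2 i /=; rewrite ltnS leq_eqVlt => /predU1P[->|ik].
  by rewrite /upd eqxx.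
by rewrite /upd ltn_eqF//; exact: h1.
Qed.

(* Induction on j, splitting the cylinder on the next coordinate: the bound is
   a discrete exponential supermartingale. *)
Let P_cyl_exc l t b k j :
  (P (cyl b k `&` exc l t k (k + j)) <=
   ((\prod_(i < k) (if b i then p else 1 - p)) *
    expR (l * (\sum_(i < k) (b i)%:R - k%:R * p) - t) * bernoulli_mgf p l ^+ j)%:E)%E.
Proof.
have M1 := bernoulli_mgf_ge1 l p01.
have /andP[p0 p1] := p01.
have pr0 (b' : nat -> bool) k' : 0 <= \prod_(i < k') (if b' i then p else 1 - p).
  by apply: prodr_ge0 => i _; case: (b' i) => //; rewrite subr_ge0.
elim: j b k => [|j IH] b k.
  have [ht|ht] := leP t (l * (\sum_(i < k) (b i)%:R - k%:R * p)).
    apply: (@le_trans _ _ (P (cyl b k))).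
      by apply: le_measure; rewrite ?inE; [exact: measurableI|exact: mcyl|exact: subIsetl].
    rewrite P_cyl lee_fin expr0 mulr1 ler_peMr//.
    by rewrite -[leLHS]expR0 ler_expR subr_ge0.
  rewrite (_ : _ `&` _ = set0) ?measure0 ?lee_fin ?expr0 ?mulr1 ?mulr_ge0 ?expR_ge0//.
  apply/seteqP; split=> // w [cw [n /=]]; rewrite addn0 -eqn_leq => /eqP <-.
  by rewrite (hits_cyl cw) leNgt ht.
have [ht|ht] := leP t (l * (\sum_(i < k) (b i)%:R - k%:R * p)).
  apply: (@le_trans _ _ (P (cyl b k))).
    by apply: le_measure; rewrite ?inE; [exact: measurableI|exact: mcyl|exact: subIsetl].
  rewrite P_cyl lee_fin -mulrA ler_peMr// mulr_ege1//.
    by rewrite -[leLHS]expR0 ler_expR subr_ge0.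
  exact: exprn_ege1.
(* The level t is not reached at time k, hence it is reached from k+1 on; the two values of the next
   coordinate yield the two terms of [bernoulli_mgf]. *)
pose E x := cyl (upd b k x) k.+1 `&` exc l t k.+1 (k.+1 + j).
have mE x : measurable (E x) by exact: measurableI.
apply: (@le_trans _ _ (P (E true `|` E false))).
  apply: le_measure; rewrite ?inE; [exact: measurableI|exact: measurableU|].
  move=> w [cw [n /= /andP[kn nj] hn]].
  have kn' : (k < n)%N.
    rewrite ltn_neqAle kn andbT; apply/eqP => kn'.
    by move: hn; rewrite -kn' (hits_cyl cw) leNgt ht.
  have ew : exc l t k.+1 (k.+1 + j) w by exists n => //=; rewrite kn' addSnnS.
  have [Aw|Aw] := pselect (A (phi k w)); [left|right]; split => //;
    by rewrite cyl_upd; split.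
apply: (le_trans (measureU2 _ _ _)) => //.
have e (b' : nat -> bool) x : \prod_(i < k) (if upd b' k x i then p else 1 - p) =
    \prod_(i < k) (if b' i then p else 1 - p).
  by apply: eq_bigr => i _; rewrite /upd ltn_eqF.
have e' (b' : nat -> bool) x : \sum_(i < k) (upd b' k x i)%:R = \sum_(i < k) (b' i)%:R :> R.
  by apply: eq_bigr => i _; rewrite /upd ltn_eqF.
apply: (le_trans (leeD (IH _ _) (IH _ _))).
rewrite -EFinD lee_fin !big_ord_recr /= !e !e' /upd eqxx.
set q := \prod_(i < k) _; set s := \sum_(i < k) _.
have -> : l * (s + true%:R - k.+1%:R * p) - t = (l * (s - k%:R * p) - t) + l * (1 - p).
  by rewrite -(natr1 k) /=; ring.
have -> : l * (s + false%:R - k.+1%:R * p) - t = (l * (s - k%:R * p) - t) + - (l * p).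
  by rewrite -(natr1 k) /=; ring.
rewrite !expRD exprS /bernoulli_mgf.
by rewrite le_eqVlt; apply/orP; left; apply/eqP; ring.
Qed.

Lemma hits_maximal_one_sided l t N :
  (P (\bigcup_(n in [set n | (n <= N)%N])
      [set w | (t <= l * (hits A n w - n%:R * p))%R]) <=
   (expR (- t) * bernoulli_mgf p l ^+ N)%:E)%E.
Proof.
have := P_cyl_exc l t (fun=> true) 0 N; rewrite !big_ord0 !mul0r subrr mulr0 sub0r mul1r.
apply: le_trans; rewrite add0n.
rewrite (_ : cyl _ _ = setT) ?setTI//.
by apply/seteqP; split => // w _ i.
Qed.

(** The exponent contains a real bound q of N because the ends of geometric blocks need not be
    integers. *)
Lemma hits_maximal l t v N (q : R) : 0 <= l -> p * (1 - p) <= v -> N%:R <= q ->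
  (P (\bigcup_(n in [set n | (n <= N)%N])
      [set w | (t <= `|hits A n w - n%:R * p|)%R]) <=
   (2 * expR (- (l * t) + expR l * l ^+ 2 * v * q / 2))%:E)%E.
Proof.
move=> l0 pv Nq.
pose E s := \bigcup_(n in [set n | (n <= N)%N])
  [set w | l * t <= s * (hits A n w - n%:R * p)].
have mE s : measurable (E s).
  apply: bigcup_measurable => n _; rewrite -[X in measurable X]setTI.
  apply: measurable_fun_le => //; apply: measurable_funM => //; exact: measurable_funB.
have /andP[p0 p1] := p01.
have v0 : 0 <= v by apply: le_trans pv; rewrite mulr_ge0// subr_ge0.
have bd s : `|s| = l -> (P (E s) <=
   (expR (- (l * t) + expR l * l ^+ 2 * v * q / 2))%:E)%E.
  move=> sl; apply: (le_trans (hits_maximal_one_sided s (l * t) N)).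
  rewrite lee_fin expRD ler_wpM2l ?expR_ge0//.
  have := bernoulli_mgf_le p01 pv (_ : `|s| <= l); rewrite sl => /(_ (lexx _)) h.
  have h1 := bernoulli_mgf_ge1 s p01.
  apply: (@le_trans _ _ (expR (expR l * s ^+ 2 * v / 2) ^+ N)).
    by apply: lerXn2r => //; rewrite nnegrE ?expR_ge0//; lra.
  rewrite -expRM_natl ler_expR -(real_normK (num_real s)) sl mulrC.
  have c0 : 0 <= expR l * l ^+ 2 * v / 2.
    by rewrite !mulr_ge0 ?expR_ge0 ?sqr_ge0.
  by have := ler_wpM2l c0 Nq; lra.
apply: (@le_trans _ _ (P (E l `|` E (- l)))).
  apply: le_measure; rewrite ?inE.
  - apply: bigcup_measurable => n _; rewrite -[X in measurable X]setTI.
    apply: measurable_fun_le => //; apply: measurableT_comp => //.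
    exact: measurable_funB.
  - exact: measurableU.
  move=> w [n nN /= h]; move: h.
  have [s0|s0] := leP 0 (hits A n w - n%:R * p).
    rewrite ger0_norm// => h; left; exists n => //=; exact: ler_wpM2l.
  rewrite ltr0_norm// => h; right; exists n => //=.
  by rewrite mulNr -mulrN; exact: ler_wpM2l.
apply: (le_trans (measureU2 _ _ _)) => //.
rewrite mulr_natl mulr2n EFinD leeD ?bd ?normrN ?ger0_norm//.
Qed.

End one_set.
End maximal_inequality.

(** * Borel-Cantelli lemma with a Riemann series *)

Section borel_cantelli.
Variable R : realType.

Lemma ln_succ_ge (k : nat) : (k.+2%:R : R)^-1 <= ln k.+2%:R - ln k.+1%:R.
Proof.
have k2 : 0 < k.+2%:R :> R by rewrite ltr0n.
have k1 : 0 < k.+1%:R :> R by rewrite ltr0n.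
rewrite -lerN2 opprB -ln_div ?posrE//.
have -> : k.+1%:R / k.+2%:R = 1 + - (k.+2%:R)^-1 :> R.
  by move: k2; rewrite -(natr1 k.+1) => k2; rewrite -{1}[k.+1%:R](addrK 1) mulrBl mulfV ?gt_eqF// mul1r.
apply: le_ln1Dx; rewrite ltrNr opprK invf_lt1//.
by rewrite ltr1n.
Qed.

(** Comparison with the integral of x^-(1+a), as an induction whose invariant retains the term -
    (m+1)^-a / a; the inductive step is [ln_succ_ge]. *)
Lemma sum_riemann_le (a : R) n : 0 < a ->
  \sum_(k < n) expR (- ((1 + a) * ln k.+1%:R)) <= 1 + a^-1.
Proof.
move=> a0; suff H m : \sum_(k < m.+1) expR (- ((1 + a) * ln k.+1%:R)) <=
    1 + a^-1 * (1 - expR (- (a * ln m.+1%:R))).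
  case: n => [|n]; first by rewrite big_ord0 addr_ge0// invr_ge0 ltW.
  apply: (le_trans (H n)); rewrite lerD2l -[leRHS]mulr1 ler_wpM2l//.
  by rewrite invr_ge0 ltW.
elim: m => [|m IH].
  by rewrite big_ord1 ln1 !mulr0 oppr0 expR0 subrr mulr0 addr0.
rewrite big_ord_recr /=; apply: (le_trans (lerD IH (lexx _))).
rewrite -addrA lerD2l -lerBrDl -mulrBr -ler_pdivrMl ?invr_gt0// invrK.
set e1 := expR (- (a * ln m.+2%:R)); set e2 := expR (- (a * ln m.+1%:R)).
have -> : 1 - e1 - (1 - e2) = e2 - e1 by ring.
have -> : expR (- ((1 + a) * ln m.+2%:R)) = e1 / m.+2%:R.
  by rewrite mulrDl mul1r opprD expRD expRN lnK ?posrE// mulrC.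
have -> : e2 = e1 * expR (a * (ln m.+2%:R - ln m.+1%:R)).
  by rewrite /e1 -expRD; congr expR; ring.
rewrite -[X in _ <= _ - X]mulr1 -mulrBr mulrCA ler_wpM2l ?expR_ge0//.
rewrite lerBrDl (le_trans _ (expR_ge1Dx _))// lerD2l ler_wpM2l ?(ltW a0)//.
exact: ln_succ_ge.
Qed.

Context (d : measure_display) (T : measurableType d) (P : probability T R).

Lemma borel_cantelli_riemann (E : (set T)^nat) (a c : R) (k0 : nat) :
  0 < a -> 0 <= c -> (forall k, measurable (E k)) ->
  (forall k, (k0 <= k)%N ->
    (P (E k) <= (c * expR (- ((1 + a) * ln k.+1%:R)))%:E)%E) ->
  {ae P, forall w, exists K, forall k, (K <= k)%N -> ~ E k w}.
Proof.
move=> a0 c0 mE PE.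
pose E' k := if (k0 <= k)%N then E k else set0.
have mE' k : measurable (E' k) by rewrite /E'; case: ifP.
have PE' k : (P (E' k) <= (c * expR (- ((1 + a) * ln k.+1%:R)))%:E)%E.
  rewrite /E'; case: ifP => [/PE//|_].
  by rewrite measure0 lee_fin mulr_ge0// expR_ge0.
exists (lim_sup_set E'); split.
- apply: bigcapT_measurable => n.
  by apply: bigcup_measurable => k _.
- apply: lim_sup_set_cvg0 => //.
  apply: (@le_lt_trans _ _ (c * (1 + a^-1))%:E); last exact: ltry.
  apply: lime_le; first exact: is_cvg_nneseries.
  apply: nearW => n; rewrite big_mkord.
  apply: (@le_trans _ _ (\sum_(k < n) (c * expR (- ((1 + a) * ln k.+1%:R)))%:E)%E).
    by apply: lee_sum => k _; exact: PE'.
  rewrite sumEFin lee_fin -mulr_sumr ler_wpM2l//.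
  exact: sum_riemann_le.
- move=> w /= H n _; apply: contrapT => h; apply: H.
  exists (maxn n k0) => k; rewrite geq_max => /andP[nk kk Ek]; apply: h.
  by exists k => //; rewrite /E' kk.
Qed.

End borel_cantelli.

(** * Chaining on nested grids *)

Section chaining.
Variable R : realType.

(** The mesh is divided by 8 at each level while the allowed increment is only halved: the Chernoff
    exponent, of order increment squared over mesh, doubles with l and absorbs the 8^l cells of a
    union bound. *)
Definition grid8 (l i : nat) : R := -1 + 2 * i%:R / 8 ^+ l.

Let idx (x : R) l := Num.truncn ((x + 1) / 2 * 8 ^+ l).

Let e8 l : 0 < 8 ^+ l :> R. Proof. exact: exprn_gt0. Qed.

Let idx_itv x l : -1 <= x -> grid8 l (idx x l) <= x < grid8 l (idx x l).+1.
Proof.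
move=> x1.
have : 0 <= (x + 1) / 2 * 8 ^+ l by rewrite !mulr_ge0 ?invr_ge0//; lra.
move=> /truncn_itv; rewrite -/(idx x l) => /andP[h1 h2].
rewrite /grid8; apply/andP; split.
  by rewrite addrC -lerBrDr opprK ler_pdivrMr//; lra.
by rewrite addrC -ltrBlDr opprK ltr_pdivlMr//; lra.
Qed.

Let grid8_le l i j : (grid8 l i <= grid8 l j) = (i <= j)%N.
Proof. by rewrite /grid8 lerD2l ler_pM2r ?invr_gt0// ler_pM2l// ler_nat. Qed.

Let grid8_lt l i j : (grid8 l i < grid8 l j) = (i < j)%N.
Proof. by rewrite /grid8 ltrD2l ltr_pM2r ?invr_gt0// ltr_pM2l// ltr_nat. Qed.

Lemma grid8_refine l i : grid8 l.+1 (8 * i) = grid8 l i.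
Proof. by rewrite /grid8 natrM exprS; field; rewrite gt_eqF. Qed.

Let grid8_top l : grid8 l (8 ^ l) = 1.
Proof. by rewrite /grid8 natrX mulfK ?gt_eqF//; ring. Qed.

Let idx_le x l : -1 <= x <= 1 -> (idx x l <= 8 ^ l)%N.
Proof.
move=> /andP[x0 x1]; have /andP[h _] := idx_itv l x0.
by rewrite -(grid8_le l) grid8_top (le_trans h).
Qed.

Variables (G : R -> R) (a b : R) (L : nat).
Hypotheses (a0 : 0 <= a) (b0 : 0 <= b).
Hypothesis Ga : forall l i, (l <= L)%N -> (i < 8 ^ l)%N ->
  `|G (grid8 l i.+1) - G (grid8 l i)| <= a / 2 ^+ l.
Hypothesis Gb : forall i x, (i < 8 ^ L)%N -> grid8 L i <= x <= grid8 L i.+1 ->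
  `|G x - G (grid8 L i)| <= b.

Let steps l i r : (l <= L)%N -> (i + r <= 8 ^ l)%N ->
  `|G (grid8 l (i + r)) - G (grid8 l i)| <= r%:R * (a / 2 ^+ l).
Proof.
move=> lL; elim: r => [|r IH] ir; first by rewrite addn0 subrr normr0 mul0r.
have -> : G (grid8 l (i + r.+1)) - G (grid8 l i) =
   (G (grid8 l (i + r).+1) - G (grid8 l (i + r))) +
   (G (grid8 l (i + r)) - G (grid8 l i)) by rewrite addnS; ring.
rewrite -natr1 mulrDl mul1r addrC (le_trans (ler_normD _ _))// lerD//.
  by apply: IH; lia.
by apply: Ga => //; lia.
Qed.

(** Refining the grid once crosses at most 7 of the new cells, at a cost of 7 a / 2^(l+1); the bound
    is the sum of this geometric series. *)
Let levels x j r : -1 <= x <= 1 -> (j + r <= L)%N ->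
  `|G (grid8 (j + r) (idx x (j + r))) - G (grid8 j (idx x j))| <=
  7 * a * (2 ^- j - 2 ^- (j + r)).
Proof.
move=> xb; have /andP[x0 x1] := xb.
elim: r => [|r IH] jr; first by rewrite addn0 !subrr normr0 mulr0.
set l := (j + r)%N in IH *; rewrite addnS -/l.
have /andP[h1 h2] := idx_itv l x0; have /andP[h3 h4] := idx_itv l.+1 x0.
have i1 : (8 * idx x l <= idx x l.+1)%N.
  by rewrite -ltnS -(grid8_lt l.+1) grid8_refine (le_lt_trans h1).
have i2 : (idx x l.+1 < 8 * (idx x l).+1)%N.
  by rewrite -(grid8_lt l.+1) grid8_refine (le_lt_trans h3).
have i3 := idx_le l.+1 xb.
have st := @steps l.+1 (8 * idx x l)%N (idx x l.+1 - 8 * idx x l)%N.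
rewrite subnKC// grid8_refine in st.
have -> : G (grid8 l.+1 (idx x l.+1)) - G (grid8 j (idx x j)) =
  (G (grid8 l.+1 (idx x l.+1)) - G (grid8 l (idx x l))) +
  (G (grid8 l (idx x l)) - G (grid8 j (idx x j))) by ring.
have -> : 7 * a * (2 ^- j - 2 ^- l.+1) = 7 * (a / 2 ^+ l.+1) + 7 * a * (2 ^- j - 2 ^- l).
  have -> : 2 ^- l = 2 * 2 ^- l.+1 :> R.
    by rewrite exprS invfM mulVKf.
  by ring.
have lL : (l < L)%N by rewrite /l -addnS.
rewrite (le_trans (ler_normD _ _))// lerD//; last by apply: IH; exact: ltnW.
apply: (le_trans (st _ _)) => //.
rewrite ler_wpM2r ?divr_ge0 ?exprn_ge0// (ler_nat _ _ 7).
by move: i2; move: (idx x l.+1) (idx x l) => p q; clear; lia.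
Qed.

Let near_grid x : -1 <= x <= 1 -> `|G x - G (grid8 L (idx x L))| <= b.
Proof.
move=> xb; have /andP[x0 x1] := xb; have /andP[h1 h2] := idx_itv L x0.
have := idx_le L xb; rewrite leq_eqVlt => /predU1P[e|lt].
  have -> : grid8 L (idx x L) = x; last by rewrite subrr normr0.
  by apply/eqP; rewrite eq_le h1 /= e grid8_top.
by apply: Gb => //; rewrite h1 ltW.
Qed.

(** 15 = 7 + 1 + 7: from x to its grid point of level j, across at most one cell, and back down to
    y. Each of the two ends adds b. *)
Lemma chaining_bound j x y : (j <= L)%N -> -1 <= x <= 1 -> -1 <= y <= 1 ->
  `|x - y| <= 2 / 8 ^+ j -> `|G x - G y| <= 15 * (a / 2 ^+ j) + 2 * b.
Proof.
wlog xy : x y / x <= y.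
  move=> H jL xb yb; have [xy|/ltW xy] := leP x y; first exact: H.
  by rewrite distrC [X in _ -> X <= _]distrC; exact: H.
move=> jL xb yb xyj; have /andP[x0 x1] := xb; have /andP[y0 y1] := yb.
have /andP[h1 h2] := idx_itv j x0; have /andP[h3 h4] := idx_itv j y0.
have i1 : (idx x j <= idx y j)%N by rewrite -ltnS -(grid8_lt j); lra.
have i2 : (idx y j <= (idx x j).+1)%N.
  rewrite -ltnS -(grid8_lt j) (le_lt_trans h3)//.
  have -> : grid8 j (idx x j).+2 = grid8 j (idx x j).+1 + 2 / 8 ^+ j.
    by rewrite /grid8 -(natr1 (idx x j).+1); ring.
  by move: xyj; rewrite ler0_norm ?subr_le0//; lra.
have st := @steps j (idx x j) (idx y j - idx x j)%N jL.
rewrite subnKC// in st; have {}st := st (idx_le j yb).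
have st' : `|G (grid8 j (idx y j)) - G (grid8 j (idx x j))| <= a / 2 ^+ j.
  apply: (le_trans st); rewrite ler_piMl ?divr_ge0 ?exprn_ge0//.
  by rewrite (ler_nat _ _ 1) leq_subLR addn1.
have lv z : -1 <= z <= 1 -> `|G (grid8 L (idx z L)) - G (grid8 j (idx z j))| <= 7 * (a / 2 ^+ j).
  move=> zb; have := @levels z j (L - j)%N zb; rewrite subnKC// => /(_ (leqnn _)) h.
  apply: (le_trans h); rewrite -mulrA ler_wpM2l// ler_wpM2l// gerBl.
  by rewrite invr_ge0 exprn_ge0.
have := lv x xb; have := lv y yb; have := near_grid xb; have := near_grid yb.
rewrite !ler_norml in st' *.
move: st' => /andP[? ?] /andP[? ?] /andP[? ?] /andP[? ?] /andP[? ?].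
by apply/andP; split; lra.
Qed.

End chaining.

(** * Modulus of continuity of the empirical process *)

Section empirical_process.
Context (R : realType) (d : measure_display) (T : measurableType d)
  (P : probability T R) (phi : nat -> {RV P >-> R}) (F : R -> R) (C : R).
Hypothesis phi_indep : mutually_independent P (fun i : nat => sigma_gen [set i] phi).
Hypothesis phi_cdf : forall i x, cdf (phi i) x = (F x)%:E.
Hypothesis C1 : 1 <= C.
Hypothesis F_lip : forall x y, -1 <= x -> x <= y -> y <= 1 -> F y - F x <= C * (y - x).

Definition centered_count (n : nat) (w : T) (x : R) : R :=
  hits phi `]-oo, x] n w - n%:R * F x.

Let phiNy i x : P (phi i @^-1` `]-oo, x]) = (F x)%:E.
Proof. by rewrite -(phi_cdf i). Qed.

Let mphi i B : measurable B -> measurable (phi i @^-1` B).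
Proof. by move=> mB; exact: measurable_funPTI. Qed.

Lemma cdf_ndecr x y : x <= y -> F x <= F y.
Proof.
move=> xy; rewrite -lee_fin -!(phiNy 0); apply: le_measure; rewrite ?inE; try exact: mphi.
by move=> w /=; rewrite !in_itv /= => /le_trans; apply.
Qed.

Lemma cdf_01 x : 0 <= F x <= 1.
Proof. by rewrite -!lee_fin -(phiNy 0) measure_ge0 probability_le1//; exact: mphi. Qed.

Lemma hits_itv x y n w : x <= y ->
  hits phi `]x, y] n w = hits phi `]-oo, y] n w - hits phi `]-oo, x] n w.
Proof.
move=> xy; rewrite /hits -sumrB; apply: eq_bigr => i _.
rewrite !indicE !mem_setE !in_itv /=; have [xp|px] := ltP x (phi i w).
  by rewrite subr0.
by rewrite (le_trans px xy) subrr.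
Qed.

Lemma prob_itv x y i : x <= y -> P (phi i @^-1` `]x, y]) = (F y - F x)%:E.
Proof.
move=> xy; rewrite EFinB -!(phiNy i).
have -> : phi i @^-1` `]x, y] = phi i @^-1` `]-oo, y] `\` phi i @^-1` `]-oo, x].
  apply/seteqP; split=> w /=; rewrite !in_itv /=.
    by move=> /andP[a b]; split => //; apply/negP; rewrite -ltNge.
  by move=> [a /negP]; rewrite -ltNge => ->.
rewrite measureD; [|exact: mphi|exact: mphi|by rewrite -ge0_fin_numE// fin_num_measure//; exact: mphi].
congr (_ - P _)%E; apply/setIidPr => w /=; rewrite !in_itv /= => /le_trans; exact.
Qed.

Let e4 : expR 1 <= 4 :> R.
Proof.
have h := expR_ge1Dx (- 2^-1 : R); have h1 := expRxMexpNx_1 (2^-1 : R).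
have h2 := expR_gt0 (2^-1 : R).
have -> : 1 = 2^-1 + 2^-1 :> R by field.
by rewrite expRD; move: h h1 h2; move: (expR _) (expR _) => u v; nra.
Qed.

Let e2 : 2 <= expR 1 :> R.
Proof. by have := expR_ge1Dx (1 : R); lra. Qed.

(** With this constant C and e cancel from the Chernoff exponent, which becomes 6 2^l [LL k] at
    every level l. *)
Let A : R := Num.sqrt (24 * expR 1 * C).
Let AE : A ^+ 2 = 24 * expR 1 * C.
Proof. by rewrite sqr_sqrtr// !mulr_ge0 ?expR_ge0//; have := C1; lra. Qed.
Let A0 : 0 <= A. Proof. exact: sqrtr_ge0. Qed.

(** Times are grouped in blocks from 2^k to [q k]. Since ln 2 >= 1/2, [LL k] is at most the iterated
    logarithm of every n in the block. *)
Let LL (k : nat) : R := ln (k%:R / 2).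
Let q (k : nat) : R := 2 ^+ k.+1.
Let tt k l : R := A / 2 ^+ l * Num.sqrt (q k * LL k).

Let pow_lin m : (7 <= m)%N -> (15 * m + 12 <= 2 ^ m)%N.
Proof.
elim: m => // m IH; rewrite leq_eqVlt => /predU1P[<-//|].
rewrite ltnS => m7; move: (m7) (IH m7); rewrite expnS; move: (2 ^ m)%N => u; lia.
Qed.

Let LL_ge1 k : (40 <= k)%N -> 1 <= LL k.
Proof.
move=> k40; rewrite -[leLHS]expRK ler_ln ?posrE ?expR_gt0//.
  apply: (le_trans e4); rewrite ler_pdivlMr// -natrM ler_nat; lia.
by rewrite divr_gt0// ltr0n; lia.
Qed.

Let LL_small k : (40 <= k)%N -> 6 * LL k <= 2 ^+ (k.+1 %/ 5).
Proof.
move=> k40; set m := (k.+1 %/ 5)%N.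
have m7 : (7 <= m)%N by rewrite /m leq_divRL//; lia.
apply: (@le_trans _ _ (15 * m + 12)%:R); last by rewrite -natrX ler_nat pow_lin.
have h : LL k <= k%:R / 2.
  by apply/ltW/ln_sublinear; rewrite divr_gt0// ltr0n; lia.
have km : (k <= 5 * m + 4)%N.
  by have := ltn_ceil k.+1 (isT : (0 < 5)%N); rewrite -/m; lia.
have : k%:R <= (5 * m + 4)%:R :> R by rewrite ler_nat.
have -> : (15 * m + 12)%:R = 3 * (5 * m + 4)%:R :> R.
  by rewrite -natrM; congr (_%:R); lia.
lra.
Qed.

(** Keeps the Chernoff parameter at most 1. Levels stop at (k+1)/5, so that 2^(4 l) leaves a factor
    2^((k+1)/5) of [q k] to absorb the logarithm. *)
Let chernoff_range k l : (40 <= k)%N -> (l <= k.+1 %/ 5)%N ->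
  6 * LL k * (2 ^+ l * 2 ^+ l * (2 ^+ l * 2 ^+ l)) <= q k.
Proof.
move=> k40 lk; have L1 := LL_ge1 k40.
have := LL_small k40; have := leq_divM k.+1 5; move: lk; set m := (k.+1 %/ 5)%N.
move=> lk mk h.
have -> : 2 ^+ l * 2 ^+ l * (2 ^+ l * 2 ^+ l) = 2 ^+ (4 * l) :> R.
  by rewrite -!exprD; congr (_ ^+ _); ring.
apply: (@le_trans _ _ (2 ^+ m * 2 ^+ (4 * m))).
  by apply: ler_pM => //; [lra|rewrite ler_weXn2l ?leq_pmul2l//; lra].
rewrite -exprD /q ler_weXn2l//; first by lra.
by rewrite -mulSn mulnC.
Qed.

Let bad k l i : set T :=
  \bigcup_(n in [set n | (n <= 2 ^ k.+1)%N])
    [set w | tt k l <= `|hits phi `](grid8 R l i), (grid8 R l i.+1)] n w -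
       n%:R * (F (grid8 R l i.+1) - F (grid8 R l i))| ].

Let grid_step l i : grid8 R l i.+1 = grid8 R l i + 2 / 8 ^+ l.
Proof. by rewrite /grid8 -(natr1 i); ring. Qed.

Let grid_ge l i : -1 <= grid8 R l i.
Proof. by rewrite lerDl !mulr_ge0 ?invr_ge0 ?exprn_ge0. Qed.

Let grid_le l i : (i <= 8 ^ l)%N -> grid8 R l i <= 1.
Proof.
move=> il; rewrite -lerBrDl opprK ler_pdivrMr ?exprn_gt0//.
by rewrite (_ : 1 + 1 = 2)// ler_pM2l// -natrX ler_nat.
Qed.

Let mbad k l i : measurable (bad k l i).
Proof.
apply: bigcup_measurable => n _; rewrite -[X in measurable X]setTI.
apply: measurable_fun_le => //; apply: measurableT_comp => //.
apply: measurable_funB => //; apply: measurable_sum => j.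
exact: measurableT_comp.
Qed.

Let P_bad k l i : (40 <= k)%N -> (l <= k.+1 %/ 5)%N -> (i < 8 ^ l)%N ->
  (P (bad k l i) <= (2 * expR (- (6 * 2 ^+ l * LL k)))%:E)%E.
Proof.
move=> k40 lk il; have L1 := LL_ge1 k40.
have l8 : 0 < 8 ^+ l :> R by rewrite exprn_gt0.
have l2 : 0 < 2 ^+ l :> R by rewrite exprn_gt0.
have q0 : 0 < q k by rewrite exprn_gt0.
have eC : 0 < expR 1 * C by rewrite mulr_gt0 ?expR_gt0//; have := C1; lra.
have C0 : 0 < C by have := C1; lra.
have st := grid_step l i.
have p_le : F (grid8 R l i.+1) - F (grid8 R l i) <= 2 * C / 8 ^+ l.
  apply: (le_trans (F_lip _ _ _)).
  - exact: grid_ge.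
  - by rewrite st lerDl divr_ge0// ltW.
  - exact: grid_le.
  - by rewrite st addrAC subrr add0r; lra.
have p_ge : 0 <= F (grid8 R l i.+1) - F (grid8 R l i).
  by rewrite subr_ge0 cdf_ndecr// st lerDl divr_ge0// ltW.
have qLL : Num.sqrt (q k * LL k) ^+ 2 = q k * LL k.
  by rewrite sqr_sqrtr// mulr_ge0 ?(ltW q0)//; lra.
have t0 : 0 <= tt k l by rewrite /tt mulr_ge0 ?sqrtr_ge0// divr_ge0// ltW.
have tE : tt k l ^+ 2 = A ^+ 2 / (2 ^+ l) ^+ 2 * (q k * LL k).
  by rewrite /tt exprMn qLL exprMn exprVn.
(* Minimizer of the exponent once [expR lam] is replaced by e and the variance by its bound 2 C /
   8^l. *)
pose lam := tt k l * 8 ^+ l / (2 * expR 1 * C * q k).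
have lam0 : 0 <= lam.
  by rewrite /lam divr_ge0// ?mulr_ge0 ?expR_ge0 ?(ltW C0) ?(ltW q0) ?(ltW l8).
have l842 : 8 ^+ l = 2 ^+ l * 2 ^+ l * 2 ^+ l :> R.
  by rewrite -!exprMn; congr (_ ^+ _); ring.
have lam1 : lam <= 1.
  rewrite /lam ler_pdivrMr ?mul1r; last by rewrite !mulr_gt0 ?expR_gt0.
  rewrite -ler_sqr ?nnegrE; last 2 first.
  - by rewrite mulr_ge0// ltW.
  - by rewrite !mulr_ge0 ?expR_ge0// ltW.
  rewrite exprMn tE AE.
  have hq := chernoff_range k40 lk.
  have -> : 24 * expR 1 * C / 2 ^+ l ^+ 2 * (q k * LL k) * 8 ^+ l ^+ 2 =
     4 * (expR 1 * C) * q k * (6 * LL k * (2 ^+ l * 2 ^+ l * (2 ^+ l * 2 ^+ l))).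
    by rewrite l842; field; rewrite gt_eqF.
  have -> : (2 * expR 1 * C * q k) ^+ 2 =
     4 * (expR 1 * C) * q k * (expR 1 * C * q k) by ring.
  have w0 : 0 <= 4 * (expR 1 * C) * q k by rewrite mulr_ge0 ?(ltW q0)// mulr_ge0// ltW.
  rewrite (ler_wpM2l w0)// (le_trans hq)// ler_peMl ?(ltW q0)//.
  by have := e2; have := C1; nra.
have := @hits_maximal _ _ _ P phi phi_indep
  `](grid8 R l i), (grid8 R l i.+1)] (F (grid8 R l i.+1) - F (grid8 R l i))
  (measurable_itv _) (fun j => prob_itv j _) lam (tt k l)
  (2 * C / 8 ^+ l) (2 ^ k.+1) (q k) lam0.
have gl : grid8 R l i <= grid8 R l i.+1 by rewrite st lerDl divr_ge0// ltW.
move=> /(_ gl) H; apply: (le_trans (H _ _)).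
- apply: le_trans p_le; rewrite ler_piMr// gerBl//.
- by rewrite natrX.
rewrite lee_fin ler_wpM2l// ler_expR.
apply: (@le_trans _ _ (- (lam * tt k l) + expR 1 * lam ^+ 2 * (2 * C / 8 ^+ l) * q k / 2)).
  rewrite lerD2l ler_wpM2r ?invr_ge0// ler_wpM2r ?(ltW q0)//.
  rewrite ler_wpM2r ?divr_ge0 ?mulr_ge0 ?(ltW C0) ?(ltW l8)//.
  by rewrite ler_wpM2r ?sqr_ge0// ler_expR.
have -> : - (lam * tt k l) + expR 1 * lam ^+ 2 * (2 * C / 8 ^+ l) * q k / 2 =
   - (tt k l ^+ 2 * 8 ^+ l / (4 * expR 1 * C * q k)).
  by rewrite /lam; field; rewrite !gt_eqF ?expR_gt0.
rewrite tE AE l842 lerN2 le_eqVlt; apply/orP; left; apply/eqP.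
by field; rewrite !gt_eqF ?expR_gt0.
Qed.


Let EE k : set T := \big[setU/set0]_(l < (k.+1 %/ 5).+1)
   \big[setU/set0]_(i < 8 ^ l) bad k l i.

Let mEE k : measurable (EE k).
Proof. by apply: bigsetU_measurable => l _; apply: bigsetU_measurable. Qed.

Let pow2_ge (l : nat) : l%:R + 1 <= 2 ^+ l :> R.
Proof.
elim: l => [|l IH]; first by rewrite expr0 add0r.
by rewrite exprS -natr1; have := ler0n R l; lra.
Qed.

Let geom_le n : \sum_(l < n) (2 ^- l : R) <= 2.
Proof.
suff H : \sum_(l < n) (2 ^- l : R) <= 2 - 2 * 2 ^- n.
  by apply: (le_trans H); rewrite gerBl mulr_ge0 ?invr_ge0 ?exprn_ge0.
elim: n => [|n IH]; first by rewrite big_ord0 expr0 invr1 mulr1 subrr.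
rewrite big_ord_recr /= (le_trans (lerD IH (lexx _)))//.
by rewrite exprS invfM mulVKf// le_eqVlt; apply/orP; left; apply/eqP; ring.
Qed.

(** The 8^l cells of level l are paid for by 2^l >= l + 1: the exponent exceeds 2 [LL k] by at least
    4 l, and 8 e^-4 <= 1/2. *)
Let P_EE k : (40 <= k)%N -> (P (EE k) <= (4 * expR (- (2 * LL k)))%:E)%E.
Proof.
move=> k40; have L1 := LL_ge1 k40.
have mb l : measurable (\big[setU/set0]_(i < 8 ^ l) bad k l i).
  exact: bigsetU_measurable.
apply: (le_trans (@Boole_inequality _ _ _ P
  (fun l : nat => \big[setU/set0]_(i < 8 ^ l) bad k l i) _ (fun l _ => mb l))).
apply: (@le_trans _ _ (\sum_(l < (k.+1 %/ 5).+1)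
    (2 * 2 ^- l * expR (- (2 * LL k)))%:E)%E).
  apply: lee_sum => l _.
  apply: (le_trans (@Boole_inequality _ _ _ P (bad k l) _ (fun i _ => mbad k l i))).
  apply: (@le_trans _ _ (\sum_(i < 8 ^ l) (2 * expR (- (6 * 2 ^+ l * LL k)))%:E)%E).
    by apply: lee_sum => i _; apply: P_bad => //; rewrite -ltnS.
  rewrite sumEFin lee_fin sumr_const card_ord -[leLHS]mulr_natr -!mulrA ler_wpM2l// natrX.
  apply: (@le_trans _ _ (expR (- (2 * LL k)) * expR (- 4) ^+ l * 8 ^+ l)).
    rewrite ler_wpM2r ?exprn_ge0// -expRM_natl -expRD ler_expR.
    have h := pow2_ge l; have l0 := ler0n R l.
    have : (l%:R + 1) * LL k <= 2 ^+ l * LL k by rewrite ler_wpM2r//; lra.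
    have : l%:R <= l%:R * LL k by rewrite ler_peMr.
    by lra.
  rewrite -mulrA mulrC ler_wpM2r ?expR_ge0// -exprMn -exprVn.
  apply: lerXn2r; rewrite ?nnegrE ?mulr_ge0 ?expR_ge0 ?invr_ge0//.
  have -> : -4 = 4%:R * (-1) :> R by ring.
  rewrite expRM_natl.
  have h1 := expRxMexpNx_1 (1 : R); have h2 := e2; have h3 := expR_gt0 (-1 : R).
  have h4 : expR (-1) <= 2^-1 :> R.
    by move: h1 h2 h3; move: (expR 1) (expR (-1)) => u v; nra.
  apply: (@le_trans _ _ (2^-1 ^+ 4 * 8)); last by rewrite le_eqVlt; apply/orP; left; apply/eqP; field.
  by rewrite ler_wpM2r// lerXn2r// nnegrE ?expR_ge0// invr_ge0.
rewrite sumEFin lee_fin -mulr_suml -mulr_sumr ler_wpM2r ?expR_ge0//.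
by have := geom_le (k.+1 %/ 5).+1; lra.
Qed.

Let ln2_ge : 2^-1 <= ln 2 :> R.
Proof.
rewrite -[leLHS]expRK ler_ln ?posrE ?expR_gt0//.
have h := expR_ge1Dx (- 2^-1 : R); have h1 := expRxMexpNx_1 (2^-1 : R).
have h2 := expR_gt0 (2^-1 : R).
by move: h h1 h2; move: (expR _) (expR _) => u v; nra.
Qed.

Lemma EE_eventually : {ae P, forall w, exists K, forall k, (K <= k)%N -> ~ EE k w}.
Proof.
apply: (@borel_cantelli_riemann R d T P EE 1 (4 * expR (2 * ln 4)) 40) => //.
move=> k k40; apply: (le_trans (P_EE k40)).
rewrite lee_fin -mulrA ler_wpM2l// -expRD ler_expR.
have k0 : 0 < k%:R / 2 :> R by rewrite divr_gt0// ltr0n; lia.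
have l1 : k.+1%:R / 4 <= k%:R / 2 :> R.
  have : 1 <= k%:R :> R by rewrite ler1n; lia.
  by rewrite -(natr1 k); lra.
have : ln (k.+1%:R / 4) <= LL k by rewrite ler_ln ?posrE// divr_gt0.
by rewrite ln_div ?posrE//; lra.
Qed.

Let hits_ge0 B n w : 0 <= hits phi B n w.
Proof. by apply: sumr_ge0 => i _; rewrite indicE. Qed.

Let hits_le B B' n w : B `<=` B' -> hits phi B n w <= hits phi B' n w.
Proof.
move=> BB; apply: ler_sum => i _; rewrite !indicE ler_nat.
have [/set_mem h|//] := boolP (phi i w \in B).
by rewrite (mem_set (BB _ h)).
Qed.

(** The expected count in a finest cell, of order q k / 8^L with L = (k+1)/5, must not exceed the
    order of sqrt (q k) / 2^j: this is what limits j to (k+1)/10. The factor 6^2 absorbs the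
    rounding of L. *)
Let resolution k j : (j <= k.+1 %/ 10)%N ->
  q k * (2 ^+ j) ^+ 2 <= 6 ^+ 2 * (8 ^+ (k.+1 %/ 5)) ^+ 2.
Proof.
set L := (k.+1 %/ 5)%N => jk.
have e : (k.+1 + j * 2 <= 5 + 3 * L * 2)%N by rewrite /L; lia.
have -> : 8 ^+ L = 2 ^+ (3 * L) :> R by rewrite exprM; congr (_ ^+ _); ring.
rewrite /q -!exprM; apply: (@le_trans _ _ (2 ^+ 5 * 2 ^+ (3 * L * 2))); last first.
  by rewrite ler_wpM2r ?exprn_ge0// -!natrX ler_nat.
by rewrite -!exprD ler_weXn2l//; lra.
Qed.

(** Inside a finest cell the count and n F are both monotone, so each varies by at most its
    variation over the whole cell. The constants are 17 = 15 + 2 and 24 = 2 x 12. *)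
Let modulus_at k n w j x y : (40 <= k)%N -> ~ EE k w ->
  (2 ^ k <= n < 2 ^ k.+1)%N -> (j <= k.+1 %/ 10)%N ->
  -1 <= x <= 1 -> -1 <= y <= 1 -> `|x - y| <= 2 / 8 ^+ j ->
  `|centered_count n w x - centered_count n w y| <=
    (17 * A + 24 * C) / 2 ^+ j * Num.sqrt (q k * LL k).
Proof.
move=> k40 nE /andP[kn nk] jk xb yb xy; have L1 := LL_ge1 k40.
set L := (k.+1 %/ 5)%N.
have jL : (j <= L)%N by apply: (leq_trans jk); exact: leq_div2l.
have C0 : 0 < C by have := C1; lra.
have q0 : 0 < q k by rewrite exprn_gt0.
have nq : n%:R <= q k by rewrite /q -natrX ler_nat ltnW.
set S := Num.sqrt (q k * LL k).
have S0 : 0 <= S by exact: sqrtr_ge0.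
have qL0 : 0 <= q k * LL k by rewrite mulr_ge0 ?(ltW q0)//; lra.
have cell l i : (l <= L)%N -> (i < 8 ^ l)%N ->
    `|hits phi `](grid8 R l i), (grid8 R l i.+1)] n w -
       n%:R * (F (grid8 R l i.+1) - F (grid8 R l i))| <= A * S / 2 ^+ l.
  move=> lL il; rewrite leNgt; apply/negP => h; apply: nE.
  rewrite /EE -(bigcup_mkord _ (fun l => \big[setU/set0]_(i < 8 ^ l) bad k l i)).
  exists l; first by rewrite /= ltnS.
  rewrite -(bigcup_mkord _ (fun i => bad k l i)); exists i => //.
  exists n; first by rewrite /= ltnW.
  by rewrite /= (le_trans _ (ltW h))// /tt -/S mulrAC.
have gst l i : grid8 R l i <= grid8 R l i.+1.
  by rewrite grid_step lerDl divr_ge0// exprn_ge0.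
have := @chaining_bound R (centered_count n w) (A * S)
  (A * S / 2 ^+ L + q k * (2 * C / 8 ^+ L)) L.
have b0 : 0 <= A * S / 2 ^+ L + q k * (2 * C / 8 ^+ L).
  by rewrite addr_ge0 ?divr_ge0 ?mulr_ge0 ?invr_ge0 ?exprn_ge0 ?(ltW q0) ?(ltW C0).
have Ga l i : (l <= L)%N -> (i < 8 ^ l)%N ->
  `|centered_count n w (grid8 R l i.+1) - centered_count n w (grid8 R l i)| <= A * S / 2 ^+ l.
  move=> lL il; apply: le_trans (cell l i lL il).
  rewrite hits_itv// /centered_count le_eqVlt; apply/orP; left; apply/eqP.
  by congr (`|_|); ring.
have Gb i z : (i < 8 ^ L)%N -> grid8 R L i <= z <= grid8 R L i.+1 ->
  `|centered_count n w z - centered_count n w (grid8 R L i)| <=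
   A * S / 2 ^+ L + q k * (2 * C / 8 ^+ L).
  move=> iL /andP[z1 z2]; have := cell L i (leqnn _) iL.
  have e1 := hits_itv n w z1.
  have e2' : hits phi `](grid8 R L i), z] n w <= hits phi `](grid8 R L i), (grid8 R L i.+1)] n w.
    by apply: hits_le => u /=; rewrite !in_itv /= => /andP[-> /le_trans]; exact.
  have e3 := hits_ge0 `](grid8 R L i), z] n w.
  have f1 := cdf_ndecr z1; have f2 := cdf_ndecr z2.
  have f3 : F (grid8 R L i.+1) - F (grid8 R L i) <= 2 * C / 8 ^+ L.
    apply: (le_trans (F_lip _ _ _)); rewrite ?grid_ge ?grid_le//.
    by rewrite grid_step addrAC subrr add0r; lra.
  have n0 := ler0n R n.
  have g1 : n%:R * (F z - F (grid8 R L i)) <= n%:R * (F (grid8 R L i.+1) - F (grid8 R L i)).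
    by rewrite ler_wpM2l// lerD2r.
  have g2 : 0 <= n%:R * (F z - F (grid8 R L i)) by rewrite mulr_ge0// subr_ge0.
  have g3 : n%:R * (F (grid8 R L i.+1) - F (grid8 R L i)) <= q k * (2 * C / 8 ^+ L).
    by rewrite ler_pM// subr_ge0 cdf_ndecr.
  rewrite /centered_count !ler_norml => /andP[h1 h2].
  move: e1 e2' e3 g1 g2 g3 h1 h2.
  move: (hits _ _ _ _) (hits _ _ _ _) (hits _ _ _ _) (hits _ _ _ _) => *.
  by apply/andP; split; lra.
move=> /(_ (mulr_ge0 A0 S0) b0 Ga Gb j x y jL xb yb xy) H.
apply: (le_trans H).
have j2 : 0 < 2 ^+ j :> R by rewrite exprn_gt0.
have t1 : A * S / 2 ^+ L <= A * S / 2 ^+ j.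
  rewrite ler_wpM2l ?mulr_ge0// lef_pV2 ?posrE ?exprn_gt0// ler_weXn2l//; lra.
have t2 : q k / 8 ^+ L <= 6 * (S / 2 ^+ j).
  rewrite -ler_sqr ?nnegrE; last 2 first.
  - by rewrite divr_ge0 ?exprn_ge0// ltW.
  - by rewrite mulr_ge0// divr_ge0// ltW.
  rewrite !exprMn sqr_sqrtr// !exprVn.
  have := resolution jk; rewrite -/L.
  have : 0 < (8 ^+ L) ^+ 2 :> R by rewrite !exprn_gt0.
  have : 0 < (2 ^+ j) ^+ 2 :> R by rewrite !exprn_gt0.
  move: ((8 ^+ L) ^+ 2) ((2 ^+ j) ^+ 2) => U V V0 U0 h.
  rewrite ler_pdivrMr//.
  have -> : 6 ^+ 2 * (q k * LL k / V) * U = 6 ^+ 2 * U * (q k * LL k) / V by ring.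
  rewrite ler_pdivlMr//.
  have : q k * (q k * V) <= q k * (6 ^+ 2 * U) by rewrite ler_wpM2l// ltW.
  have : q k * (6 ^+ 2 * U) <= q k * (6 ^+ 2 * U) * LL k.
    by rewrite ler_peMr// !mulr_ge0// ltW.
  lra.
have t3 : q k * (2 * C / 8 ^+ L) <= 12 * C * (S / 2 ^+ j).
  by have := ler_wpM2l (ltW C0) t2; lra.
have -> : (17 * A + 24 * C) / 2 ^+ j * S = 17 * (A * S / 2 ^+ j) + 2 * (12 * C * (S / 2 ^+ j)) by ring.
by lra.
Qed.

Definition empirical_dev n w x : R := n%:R^-1 * hits phi `]-oo, x] n w - F x.

Lemma empirical_modulus : exists2 K0 : R, 0 < K0 &
  {ae P, forall w, exists K, forall k, (K <= k)%N -> forall n j x y,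
   (2 ^ k <= n < 2 ^ k.+1)%N -> (j <= k.+1 %/ 10)%N ->
   -1 <= x <= 1 -> -1 <= y <= 1 -> `|x - y| <= 2 / 8 ^+ j ->
   `|empirical_dev n w x - empirical_dev n w y| <=
     K0 / 2 ^+ j * Num.sqrt (ln (ln n%:R) / n%:R)}.
Proof.
exists (2 * (17 * A + 24 * C)).
  by have := A0; have := C1; lra.
apply: filterS EE_eventually => w [K HK]; exists (maxn K 40) => k.
rewrite geq_max => /andP[Kk k40] n j x y nk jk xb yb xy.
have := modulus_at k40 (HK k Kk) nk jk xb yb xy.
have [kn nk'] := andP nk.
have n0 : 0 < n%:R :> R by rewrite ltr0n (leq_trans _ kn)// expn_gt0.
have -> : empirical_dev n w x - empirical_dev n w y =
    n%:R^-1 * (centered_count n w x - centered_count n w y).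
  by rewrite /empirical_dev /centered_count; field; rewrite gt_eqF.
move=> h; rewrite normrM ger0_norm ?invr_ge0 ?ler0n//.
rewrite ler_pdivrMl// [leRHS]mulrC; apply: (le_trans h).
set c := 17 * A + 24 * C.
have c0 : 0 <= c by have := A0; have := C1; rewrite /c; lra.
have j2 : 0 < 2 ^+ j :> R by rewrite exprn_gt0.
have -> : 2 * c / 2 ^+ j * Num.sqrt (ln (ln n%:R) / n%:R) * n%:R =
  c / 2 ^+ j * (2 * (Num.sqrt (ln (ln n%:R) / n%:R) * n%:R)) by ring.
rewrite ler_wpM2l ?divr_ge0 ?(ltW j2)//.
have L1 := LL_ge1 k40.
have k0 : 0 < k%:R / 2 :> R by rewrite divr_gt0// ltr0n (leq_trans _ k40).
have lnn : k%:R / 2 <= ln n%:R :> R.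
  apply: (@le_trans _ _ (ln (2 ^+ k))).
    by rewrite lnXn// -[ln 2 *+ k]mulr_natl ler_wpM2l// ln2_ge.
  by rewrite ler_ln ?posrE ?exprn_gt0// -natrX ler_nat.
have LLn : LL k <= ln (ln n%:R).
  by rewrite ler_ln ?posrE// (lt_le_trans k0).
have l0 : 0 <= ln (ln n%:R) :> R by lra.
rewrite -ler_sqr ?nnegrE ?mulr_ge0 ?sqrtr_ge0 ?(ltW n0)//.
rewrite !exprMn !sqr_sqrtr; last 2 first.
- by rewrite divr_ge0 ?(ltW n0).
- by rewrite mulr_ge0 ?exprn_ge0//; lra.
have -> : 2 ^+ 2 * (ln (ln n%:R) / n%:R * n%:R ^+ 2) = 4 * n%:R * ln (ln n%:R) :> R.
  by field; rewrite gt_eqF.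
apply: ler_pM => //; first exact: exprn_ge0.
  by lra.
rewrite /q exprS; have : 2 ^+ k <= n%:R :> R by rewrite -natrX ler_nat.
by lra.
Qed.

End empirical_process.

(** * The iterated logarithm law with constant 1 *)

Section chung_smirnov_law.
Context (R : realType) (d : measure_display) (T : measurableType d)
  (P : probability T R) (phi : nat -> {RV P >-> R}) (F : R -> R) (C : R).
Hypothesis phi_indep : mutually_independent P (fun i : nat => sigma_gen [set i] phi).
Hypothesis phi_cdf : forall i x, cdf (phi i) x = (F x)%:E.
Hypothesis C1 : 1 <= C.
Hypothesis F_lip : forall x y, -1 <= x -> x <= y -> y <= 1 -> F y - F x <= C * (y - x).

Section pointwise.
Variables (x c : R).
Hypothesis c1 : 1 < c.

Let lc0 : 0 < ln c. Proof. exact: ln_gt0. Qed.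
Let c0 : 0 < c. Proof. exact: lt_trans c1. Qed.
(** Blocks of ratio c close to 1 keep the constant sharp. In the square of the final bound a factor
    c pays for the length of a block; of a second factor c, one square root offsets [expR lam] and
    the other makes the series of probabilities converge. *)
Let LL (k : nat) : R := ln (k%:R * ln c).
Let q (k : nat) : R := c ^+ k.+1.
Let tt k : R := Num.sqrt (c * (q k * LL k / 2)).
Let sc : R := Num.sqrt c.
Let sc1 : 1 < sc. Proof. by rewrite -[ltLHS]sqrtr1 ltr_sqrt. Qed.
Let sc2 : sc * sc = c. Proof. by rewrite -expr2 sqr_sqrtr// ltW. Qed.
Let q0 k : 0 < q k. Proof. exact: exprn_gt0. Qed.

Let E k : set T := \bigcup_(n in [set n | (n <= Num.truncn (q k))%N])
  [set w | tt k <= `|hits phi `]-oo, x] n w - n%:R * F x| ].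

Let mE k : measurable (E k).
Proof.
apply: bigcup_measurable => n _; rewrite -[X in measurable X]setTI.
apply: measurable_fun_le => //; apply: measurableT_comp => //.
apply: measurable_funB => //; apply: measurable_sum => j.
exact: measurableT_comp.
Qed.

Let P_E k : 1 <= k%:R * ln c -> 64 <= k%:R * ln c ^+ 3 ->
  (P (E k) <= (2 * expR (- (sc * LL k)))%:E)%E.
Proof.
move=> k1 k64.
have L0 : 0 <= LL k by exact: ln_ge0.
have qge : (k%:R * ln c) ^+ 2 / 2 <= q k.
  have -> : q k = expR (k.+1%:R * ln c) by rewrite expRM_natl lnK.
  have h := @expR_ge1Dxn R (k.+1%:R * ln c) 1 (mulr_ge0 (ler0n _ _) (ltW lc0)).
  have h2 : (k%:R * ln c) ^+ 2 <= (k.+1%:R * ln c) ^+ 2.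
    by rewrite lerXn2r ?nnegrE ?mulr_ge0 ?(ltW lc0)// ler_wpM2r ?(ltW lc0)// ler_nat.
  by move: h; rewrite (_ : 2`!%:R = 2)//; lra.
(* Equivalent to 8 LL k / q k <= (ln c / 2)^2; the left side will be the square of [lam], so this
   says [expR lam <= sc]. *)
have Lq : LL k <= ln c ^+ 2 * q k / 32.
  apply: (@le_trans _ _ (k%:R * ln c)); first by apply/ltW/ln_sublinear; lra.
  apply: (@le_trans _ _ (ln c ^+ 2 * ((k%:R * ln c) ^+ 2 / 2) / 32)).
    have : 64 * (k%:R * ln c) <= k%:R * ln c ^+ 3 * (k%:R * ln c).
      by rewrite ler_wpM2r//; lra.
    by rewrite exprS; lra.
  by rewrite ler_wpM2r ?invr_ge0// ler_wpM2l// exprn_ge0// ltW.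
have arg0 : 0 <= c * (q k * LL k / 2).
  by rewrite !mulr_ge0 ?invr_ge0 ?(ltW c0) ?(ltW (q0 k)).
have t2 : tt k ^+ 2 = c * (q k * LL k / 2) by rewrite sqr_sqrtr.
have t0 : 0 <= tt k by exact: sqrtr_ge0.
(* Minimizer of - lam t + sc lam^2 q / 8, the variance being bounded by 1/4. *)
pose lam := 4 * tt k / (sc * q k).
have s0 : 0 < sc by exact: lt_trans sc1.
have lam0 : 0 <= lam by rewrite /lam divr_ge0 ?mulr_ge0 ?(ltW s0) ?(ltW (q0 k)).
have lam1 : expR lam <= sc.
  rewrite -[leRHS](@lnK R)// ?posrE// ler_expR.
  have -> : ln sc = ln c / 2.
    by rewrite -sc2 lnM ?posrE//; lra.
  rewrite -ler_sqr ?nnegrE//; last by rewrite divr_ge0 ?(ltW lc0).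
  have -> : lam ^+ 2 = 8 * LL k / q k.
    rewrite /lam !exprMn exprVn exprMn t2 -(sc2) expr2.
    by field; rewrite !gt_eqF.
  rewrite ler_pdivrMr// exprMn exprVn; move: Lq; lra.
have pF j : P (phi j @^-1` `]-oo, x]) = (F x)%:E by rewrite -(phi_cdf j).
have := @hits_maximal _ _ _ P phi phi_indep `]-oo, x] (F x)
  (measurable_itv _) pF lam (tt k) 4^-1 (Num.truncn (q k)) (q k) lam0.
move=> H; apply: (le_trans (H _ _)).
- have : 0 <= (F x - 2^-1) ^+ 2 by exact: sqr_ge0.
  by rewrite sqrrB; lra.
- by rewrite truncn_le ltW.
rewrite lee_fin ler_wpM2l// ler_expR.
apply: (@le_trans _ _ (- (lam * tt k) + sc * lam ^+ 2 * 4^-1 * q k / 2)).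
  rewrite lerD2l ler_wpM2r ?invr_ge0// ler_wpM2r ?(ltW (q0 k))//.
  by rewrite ler_wpM2r ?invr_ge0// ler_wpM2r ?sqr_ge0.
have -> : - (lam * tt k) + sc * lam ^+ 2 * 4^-1 * q k / 2 = - (2 * tt k ^+ 2 / (sc * q k)).
  by rewrite /lam; field; rewrite !gt_eqF.
rewrite t2 -sc2 lerN2 le_eqVlt; apply/orP; left; apply/eqP.
by field; rewrite !gt_eqF.
Qed.

Let E_eventually : {ae P, forall w, exists K, forall k, (K <= k)%N -> ~ E k w}.
Proof.
have scp : 0 < sc - 1 by rewrite subr_gt0.
pose k0 := maxn 1 (maxn (Num.truncn (ln c)^-1).+1 (Num.truncn (64 / ln c ^+ 3)).+1).
apply: (@borel_cantelli_riemann R d T P E (sc - 1)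
  (2 * expR (sc * (ln 2 - ln (ln c)))) k0) => //.
move=> k; rewrite !geq_max => /and3P[k1 k2 k3].
have h1 : 1 <= k%:R * ln c.
  rewrite -ler_pdivrMr// div1r; apply: (le_trans (ltW (truncnS_gt _))).
  by rewrite ler_nat.
have h2 : 64 <= k%:R * ln c ^+ 3.
  rewrite -ler_pdivrMr ?exprn_gt0//; apply: (le_trans (ltW (truncnS_gt _))).
  by rewrite ler_nat.
apply: (le_trans (P_E h1 h2)).
rewrite lee_fin -mulrA ler_wpM2l// -expRD ler_expR addrCA subrr addr0.
rewrite -mulrBr -mulrN ler_wpM2l//; first by rewrite ltW// (lt_trans _ sc1).
have kp : 0 < k%:R :> R by rewrite ltr0n.
rewrite /LL lnM ?posrE//.
have l1 : k.+1%:R / 2 <= k%:R :> R.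
  have : 1 <= k%:R :> R by rewrite ler1n.
  by rewrite -(natr1 k); lra.
have : ln (k.+1%:R / 2) <= ln k%:R :> R.
  by rewrite ler_ln ?posrE ?divr_gt0.
by rewrite ln_div ?posrE//; lra.
Qed.

Lemma empirical_pointwise : {ae P, forall w, exists N0, forall n, (N0 <= n)%N ->
  `|empirical_dev phi F n w x| <= c * Num.sqrt (ln (ln n%:R) / (2 * n%:R))}.
Proof.
apply: filterS E_eventually => w [K HK].
pose K1 := maxn 1 (maxn K (Num.truncn (ln c)^-1).+1).
exists (Num.truncn (c ^+ K1)).+1 => n Kn.
have cn : c ^+ K1 <= n%:R.
  by apply: (le_trans (ltW (truncnS_gt _))); rewrite ler_nat.
have n0 : 0 < n%:R :> R by apply: lt_le_trans cn; exact: exprn_gt0.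
have Kl : K1%:R * ln c <= ln n%:R.
  by rewrite mulr_natl -lnXn// ler_ln ?posrE ?exprn_gt0.
have l0 : 0 <= ln n%:R / ln c.
  by rewrite divr_ge0 ?(ltW lc0)//; apply: le_trans Kl; rewrite mulr_ge0 ?(ltW lc0).
have /andP[k1 k2] := truncn_itv l0; set k := Num.truncn _ in k1 k2.
have Kk : (K1 <= k)%N by rewrite truncn_ge_nat// ler_pdivlMr.
move: (Kk); rewrite !geq_max => /and3P[kk1 kk2 kk3].
have kl : k%:R * ln c <= ln n%:R by rewrite -ler_pdivlMr.
have ku : ln n%:R < k.+1%:R * ln c by rewrite -ltr_pdivrMr.
have h1 : 1 <= k%:R * ln c.
  rewrite -ler_pdivrMr// div1r; apply: (le_trans (ltW (truncnS_gt _))).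
  by rewrite ler_nat.
have ckn : q k <= c * n%:R.
  rewrite /q exprS ler_wpM2l ?(ltW c0)//.
  by rewrite -ler_ln ?posrE ?exprn_gt0// lnXn// -[ln c *+ k]mulr_natl.
have nq : n%:R <= q k.
  by rewrite -ler_ln ?posrE// lnXn// -[ln c *+ _]mulr_natl ltW.
have L0 : 0 <= LL k by exact: ln_ge0.
have kc0 : 0 < k%:R * ln c by exact: lt_le_trans h1.
have LLn : LL k <= ln (ln n%:R) by rewrite ler_ln ?posrE//; exact: lt_le_trans kl.
have hlt : `|hits phi `]-oo, x] n w - n%:R * F x| < tt k.
  have nk : (n <= Num.truncn (q k))%N by rewrite truncn_ge_nat ?(ltW (q0 k)).
  rewrite ltNge; apply/negP => h; exact: (HK k kk2 (ex_intro2 _ _ n nk h)).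
have -> : empirical_dev phi F n w x = n%:R^-1 * (hits phi `]-oo, x] n w - n%:R * F x).
  by rewrite /empirical_dev; field; rewrite gt_eqF.
rewrite normrM ger0_norm ?invr_ge0 ?ler0n// ler_pdivrMl//.
apply: (le_trans (ltW hlt)).
have sl0 : 0 <= ln (ln n%:R) :> R by exact: le_trans LLn.
rewrite -ler_sqr ?nnegrE ?sqrtr_ge0//; last first.
  by rewrite mulr_ge0 ?(ltW n0)// mulr_ge0 ?(ltW c0)// sqrtr_ge0.
rewrite sqr_sqrtr; last by rewrite !mulr_ge0 ?invr_ge0 ?(ltW c0) ?(ltW (q0 k)).
rewrite exprMn [(c * _) ^+ 2]exprMn sqr_sqrtr; last by rewrite divr_ge0// mulr_ge0// ltW.
have -> : n%:R ^+ 2 * (c ^+ 2 * (ln (ln n%:R) / (2 * n%:R))) =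
  c * (c * n%:R * ln (ln n%:R) / 2) by field; rewrite gt_eqF.
rewrite ler_wpM2l ?(ltW c0)// ler_wpM2r ?invr_ge0// ler_pM ?(ltW (q0 k))//.
Qed.

End pointwise.

Lemma grid8_near (x : R) l : -1 <= x <= 1 -> exists i : nat,
  [/\ (i <= 8 ^ l)%N, -1 <= grid8 R l i <= 1 & `|x - grid8 R l i| <= 2 / 8 ^+ l].
Proof.
move=> /andP[x0 x1]; have e8 : 0 < 8 ^+ l :> R by exact: exprn_gt0.
have h0 : 0 <= (x + 1) / 2 * 8 ^+ l by rewrite !mulr_ge0 ?invr_ge0 ?(ltW e8)//; lra.
have /andP[h1 h2] := truncn_itv h0; move: h1 h2; set i := Num.truncn _ => h1 h2.
have g : grid8 R l i <= x by rewrite /grid8 -lerBrDl opprK ler_pdivrMr//; lra.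
have g2 : x < grid8 R l i + 2 / 8 ^+ l.
  have -> : grid8 R l i + 2 / 8 ^+ l = -1 + 2 * i.+1%:R / 8 ^+ l.
    by rewrite /grid8 -(natr1 i); ring.
  by rewrite -ltrBlDl opprK ltr_pdivlMr//; lra.
have g3 : -1 <= grid8 R l i by rewrite lerDl divr_ge0 ?(ltW e8)// mulr_ge0.
exists i; split; last by rewrite ger0_norm; lra.
  rewrite -(ler_nat R) natrX; apply: (le_trans h1).
  by rewrite ler_piMl ?(ltW e8)//; lra.
by rewrite g3 (le_trans g).
Qed.

Lemma empirical_modulus_eventually : exists2 K0 : R, 0 < K0 &
  {ae P, forall w, exists N0, forall n, (N0 <= n)%N -> forall j x y,
   (j <= (trunc_log 2 n).+1 %/ 10)%N ->
   -1 <= x <= 1 -> -1 <= y <= 1 -> `|x - y| <= 2 / 8 ^+ j ->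
   `|empirical_dev phi F n w x - empirical_dev phi F n w y| <=
     K0 / 2 ^+ j * Num.sqrt (ln (ln n%:R) / n%:R)}.
Proof.
have [K0 K00 H] := empirical_modulus phi_indep phi_cdf C1 F_lip.
exists K0 => //; apply: filterS H => w [K HK].
exists (2 ^ K)%N => n Kn j x y jn xb yb xy.
have n0 : (0 < n)%N by apply: leq_trans Kn; rewrite expn_gt0.
apply: (HK (trunc_log 2 n)) => //; last by apply: trunc_log_bounds.
by rewrite -(trunc_expnK K (isT : 1 < 2)%N) leq_trunc_log.
Qed.

(** The modulus has the same rate with the factor K0 / 2^j, arbitrarily small for fixed j. A finite
    grid independent of n therefore suffices, with constant (1 + c)/2 at its points and (c - 1)/2
    between them. *)
Theorem empirical_lil (c : R) : 1 < c ->
  {ae P, forall w, exists N0, forall n, (N0 <= n)%N -> forall x, -1 <= x <= 1 ->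
  `|empirical_dev phi F n w x| <= c * Num.sqrt (ln (ln n%:R) / (2 * n%:R))}.
Proof.
move=> c1; have [K0 K00 HM] := empirical_modulus_eventually.
pose j := (Num.truncn (4 * K0 / (c - 1))).+1.
have cp : 0 < c - 1 by rewrite subr_gt0.
have jK : 2 * K0 / 2 ^+ j <= (c - 1) / 2.
  have j2 : (j%:R : R) <= 2 ^+ j by rewrite -natrX ler_nat ltnW// ltn_expl.
  have jj : 4 * K0 / (c - 1) < j%:R by exact: truncnS_gt.
  rewrite ler_pdivrMr ?exprn_gt0//; move: jj; rewrite ltr_pdivrMr//.
  move: (2 ^+ j) j2 => u ju h.
  have : j%:R * (c - 1) <= u * (c - 1) by rewrite ler_wpM2r// ltW.
  by lra.
have c2 : 1 < (1 + c) / 2 by lra.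
have HG := ae_foralln (fun i => empirical_pointwise (grid8 R j i) c2).
move: HM HG; apply: filterS2 => w [N1 H1] HG.
have /choice [N2 H2] := HG.
exists (maxn (maxn N1 (2 ^ (10 * j))) (\max_(i < (8 ^ j).+1) N2 i)) => n.
rewrite !geq_max => /andP[/andP[n1 nj] n2] x xb.
have [i [i8 gb xg]] := grid8_near j xb.
have nN2 : (N2 i <= n)%N.
  by apply: leq_trans n2; exact: (@leq_bigmax _ (fun i : 'I_(8 ^ j).+1 => N2 i) (Ordinal (i8 : (i < (8 ^ j).+1)%N))).
have h1 := H2 i n nN2.
have jl : (j <= (trunc_log 2 n).+1 %/ 10)%N.
  rewrite leq_divRL// mulnC; apply: leqW.
  by rewrite -(trunc_expnK (10 * j) (isT : 1 < 2)%N) leq_trunc_log.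
have h2 := H1 n n1 j x _ jl xb gb xg.
have := ler_normD (empirical_dev phi F n w x - empirical_dev phi F n w (grid8 R j i))
   (empirical_dev phi F n w (grid8 R j i)).
rewrite subrK => h3.
set S := Num.sqrt (ln (ln n%:R) / (2 * n%:R)) in h1 *.
have S0 : 0 <= S by exact: sqrtr_ge0.
have hS : Num.sqrt (ln (ln n%:R) / n%:R) <= 2 * S.
  have [l0|l0] := leP (ln (ln n%:R) : R) 0.
    rewrite ler0_sqrtr ?mulr_ge0//.
    by rewrite mulr_le0_ge0// invr_ge0.
  have n0 : 0 < n%:R :> R by rewrite ltr0n (leq_trans _ nj)// expn_gt0.
  rewrite -ler_sqr ?nnegrE ?sqrtr_ge0 ?mulr_ge0//.
  rewrite exprMn !sqr_sqrtr ?divr_ge0 ?mulr_ge0 ?(ltW l0)//.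
  rewrite invfM; have : 0 <= ln (ln n%:R) / n%:R :> R by rewrite divr_ge0// ltW.
  by lra.
have h4 : K0 / 2 ^+ j * Num.sqrt (ln (ln n%:R) / n%:R) <= (c - 1) / 2 * S.
  apply: (@le_trans _ _ (K0 / 2 ^+ j * (2 * S))).
    by rewrite ler_wpM2l// divr_ge0 ?exprn_ge0// ltW.
  by have := ler_wpM2r S0 jK; lra.
by lra.
Qed.

End chung_smirnov_law.

(** * Ergodic limits of the noise *)

Section gaussian_mgf.
Context (R : realType) (d : measure_display) (T : measurableType d)
  (P : probability T R).
Implicit Types (X Y : T -> R) (v l : R).

(* Centred Gaussian law of variance v, possibly 0, through its Laplace transform. *)
Definition gaussian_mgf X v := measurable_fun setT X /\
  forall l, (\int[P]_w (expR (l * X w))%:E = (expR (l ^+ 2 * v / 2))%:E)%E.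

Section moments.
Variables (X : T -> R) (v : R).
Hypothesis XG : gaussian_mgf X v.

Let mX : measurable_fun setT X. Proof. by case: XG. Qed.

Let mexp l : measurable_fun setT (fun w => expR (l * X w)).
Proof. by apply: measurableT_comp => //; exact: measurable_funM. Qed.

Let iexp l : P.-integrable setT (fun w => (expR (l * X w))%:E).
Proof.
apply/integrableP; split; first exact/measurable_EFinP.
under eq_integral do rewrite gee0_abs ?lee_fin ?expR_ge0//.
by case: XG => _ ->; rewrite ltry.
Qed.

Let pow_exp_le k (x : R) : `|x| ^+ k <= k`!%:R * (expR x + expR (- x)).
Proof.
have h : `|x| ^+ k <= k`!%:R * expR `|x|.
  case: k => [|k]; first by rewrite expr0 mul1r -[leLHS]expR0 ler_expR.
  have h := @expR_ge1Dxn R `|x| k (normr_ge0 x).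
  have f0 : 0 < (k.+1)`!%:R :> R by rewrite ltr0n fact_gt0.
  by rewrite -ler_pdivrMl// [leLHS]mulrC; lra.
apply: (le_trans h); rewrite ler_wpM2l//.
have := expR_gt0 x; have := expR_gt0 (- x).
by have [x0|x0] := leP 0 x; [rewrite ger0_norm//|rewrite ltr0_norm//]; lra.
Qed.

(** The bound is uniform over a bounded range of l, as differentiation under the integral sign
    demands. *)
Let pow_exp_dom k (l L x : R) : `|l| <= L ->
  `|x ^+ k * expR (l * x)| <= k`!%:R * (2 * (expR ((L + 1) * x) + expR (- (L + 1) * x))).
Proof.
move=> lL; rewrite normrM normrX (ger0_norm (expR_ge0 _)).
have L0 : 0 <= L by exact: le_trans lL.
have e1 : expR (l * x) <= expR (L * `|x|).
  rewrite ler_expR (le_trans (ler_norm _))// normrM ler_wpM2r//.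
apply: (le_trans (ler_pM _ _ (pow_exp_le k x) e1)); rewrite ?exprn_ge0 ?expR_ge0//.
rewrite -mulrA ler_wpM2l// mulNr.
have -> : (L + 1) * x = L * x + x by ring.
have -> : - (L * x + x) = - (L * x) + - x by ring.
rewrite !expRD.
have p1 := expR_gt0 x; have p2 := expR_gt0 (- x).
have p3 := expR_gt0 (L * x); have p4 := expR_gt0 (- (L * x)).
have [x0|x0] := leP 0 x.
  rewrite ger0_norm//.
  have : expR (- x) <= expR x by rewrite ler_expR; lra.
  move: (expR x) (expR (- x)) (expR (L * x)) (expR (- (L * x))) p1 p2 p3 p4.
  by move=> a b c e *; nra.
rewrite ltr0_norm// mulrN.
have : expR x <= expR (- x) by rewrite ler_expR; lra.
move: (expR x) (expR (- x)) (expR (L * x)) (expR (- (L * x))) p1 p2 p3 p4.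
by move=> a b c e *; nra.
Qed.

Let G k (L : R) w := k`!%:R * (2 * (expR ((L + 1) * X w) + expR (- (L + 1) * X w))).

Let iG k L : P.-integrable setT (EFin \o G k L).
Proof.
rewrite (_ : _ \o _ = (fun w => (k`!%:R * 2)%:E * ((expR ((L + 1) * X w))%:E + (expR (- (L + 1) * X w))%:E))%E).
  by apply: integrableZl => //; apply: integrableD.
by apply/funext => w; rewrite /= /G mulrA EFinM EFinD.
Qed.

Let mpow k l : measurable_fun setT (fun w => X w ^+ k * expR (l * X w)).
Proof. by apply: measurable_funM => //; exact: measurable_funX. Qed.

Let ipow k l : P.-integrable setT (EFin \o (fun w => X w ^+ k * expR (l * X w))).
Proof.
apply: (le_integrable _ _ _ (iG k `|l|)) => //; first exact/measurable_EFinP.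
move=> w _ /=; rewrite lee_fin; apply: (le_trans (pow_exp_dom k (X w) (lexx `|l|))).
exact: ler_norm.
Qed.

Lemma gaussian_pow_integrable k : P.-integrable setT (fun w => (X w ^+ k)%:E).
Proof.
have := ipow k 0; apply: eq_integrable => // w _ /=.
by rewrite mul0r expR0 mulr1.
Qed.

Let F k l := (\int[P]_w (X w ^+ k * expR (l * X w)))%R.

Let F_derive k a : (F k)^`()%classic a = F k.+1 a.
Proof.
rewrite /F; pose f (l : R) w := X w ^+ k * expR (l * X w).
have der l w : is_derive l (1 : R) (f ^~ w) (X w ^+ k.+1 * expR (l * X w)).
  rewrite /f; apply: is_derive_eq; rewrite /GRing.scale /= exprS; ring.
have dE l w : partial1of2 f l w = X w ^+ k.+1 * expR (l * X w).
  by rewrite partial1of2E derive_val.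
have -> : (fun l => (\int[P]_w (X w ^+ k * expR (l * X w)))%R) =
   (fun l => (\int[P]_(w in setT) f l w)%R) by [].
rewrite (@differentiation_under_integral R d T P f setT measurableT a (a - 1) (a + 1) _ _ _
   (G k.+1 (`|a| + 1))).
- by apply: eq_Rintegral => w _; rewrite dE.
- by rewrite /= in_itv /=; apply/andP; split; lra.
- by move=> l _; exact: ipow.
- by move=> l w _ _; case: (der l w).
- move=> w; rewrite /G mulr_ge0// mulr_ge0// addr_ge0// expR_ge0.
- exact: iG.
- move=> l w; rewrite /= in_itv /= => /andP[l1 l2] _; rewrite dE.
  apply: pow_exp_dom; rewrite -[l](subrK a) addrC (le_trans (ler_normD _ _))// lerD2l.
  by rewrite ler_norml; apply/andP; split; lra.
Qed.

Let F0 l : F 0 l = expR (l ^+ 2 * v / 2).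
Proof.
case: XG => _ XE; rewrite /F /Rintegral.
by under eq_integral do rewrite expr0 mul1r; rewrite XE.
Qed.

(** Every F k is a polynomial times exp (l^2 v / 2), and a derivative turns the polynomial p into p'
    + l v p (Hermite recursion). The moments are the values at l = 0. *)
Let step k (p dp : R -> R) : (forall l, F k l = p l * expR (l ^+ 2 * v / 2)) ->
  (forall l : R, is_derive l (1 : R) p (dp l)) ->
  forall l, F k.+1 l = (dp l + l * v * p l) * expR (l ^+ 2 * v / 2).
Proof.
move=> Fp dpE l; rewrite -F_derive.
have -> : F k = (fun l => p l * expR (l ^+ 2 * v / 2)) by apply/funext.
have := dpE l => dpl.
rewrite derive1E; apply: derive_val.
by apply: is_derive_eq; rewrite /GRing.scale /=; field.
Qed.

Let F1 l : F 1 l = l * v * expR (l ^+ 2 * v / 2).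
Proof.
have H l' : F 0 l' = cst 1 l' * expR (l' ^+ 2 * v / 2) by rewrite F0 mul1r.
by rewrite (step H (fun l' => is_derive_cst _ _ _)) /= add0r mulr1.
Qed.

Let F2 l : F 2 l = (v + l ^+ 2 * v ^+ 2) * expR (l ^+ 2 * v / 2).
Proof.
have D (l' : R) : is_derive l' (1 : R) (fun l => l * v) v.
  by apply: is_derive_eq; rewrite /GRing.scale /=; ring.
by rewrite (step F1 D); congr (_ * _); ring.
Qed.

Let F3 l : F 3 l = (3 * l * v ^+ 2 + l ^+ 3 * v ^+ 3) * expR (l ^+ 2 * v / 2).
Proof.
have D (l' : R) : is_derive l' (1 : R) (fun l => v + l ^+ 2 * v ^+ 2) (2 * l' * v ^+ 2).
  by apply: is_derive_eq; rewrite /GRing.scale /=; ring.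
by rewrite (step F2 D); congr (_ * _); ring.
Qed.

Let F4 l : F 4 l = (3 * v ^+ 2 + 6 * l ^+ 2 * v ^+ 3 + l ^+ 4 * v ^+ 4) * expR (l ^+ 2 * v / 2).
Proof.
have D (l' : R) : is_derive l' (1 : R) (fun l => 3 * l * v ^+ 2 + l ^+ 3 * v ^+ 3)
    (3 * v ^+ 2 + 3 * l' ^+ 2 * v ^+ 3).
  by apply: is_derive_eq; rewrite /GRing.scale /=; ring.
by rewrite (step F3 D); congr (_ * _); ring.
Qed.

Let FE k : (\int[P]_w (X w ^+ k)%:E = (F k 0)%:E)%E.
Proof.
rewrite /F /Rintegral fineK; last exact: integrable_fin_num (ipow k 0).
by apply: eq_integral => w _; rewrite mul0r expR0 mulr1.
Qed.

Lemma gaussian_moment1 : (\int[P]_w (X w)%:E = 0)%E.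
Proof. by have := FE 1; rewrite F1 !mul0r. Qed.

Lemma gaussian_moment2 : (\int[P]_w (X w ^+ 2)%:E = v%:E)%E.
Proof. by rewrite FE F2 expr0n /= !mul0r addr0 expR0 mulr1. Qed.

Lemma gaussian_moment4 : (\int[P]_w (X w ^+ 4)%:E = (3 * v ^+ 2)%:E)%E.
Proof. by rewrite FE F4 !expr0n /= mulr0 !mul0r !addr0 expR0 mulr1. Qed.

End moments.

End gaussian_mgf.

(** * Normal laws and independence *)

Section normal_integral.
Context (R : realType).
Local Notation mu := (@lebesgue_measure R).

(** The Radon-Nikodym derivative of the change of variables is almost everywhere the normal density,
    both having the same integral over every measurable set. *)
Lemma ge0_integral_normal_prob (m s : R) (f : R -> \bar R) :
  (forall x, 0 <= f x)%E -> measurable_fun setT f ->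
  (\int[normal_prob m s]_x f x = \int[mu]_x (f x * (normal_pdf m s x)%:E))%E.
Proof.
move=> f0 mf.
have dom := normal_prob_dominates m s.
rewrite -(Radon_Nikodym_SigmaFinite.change_of_variables dom)//=.
apply: ge0_ae_eq_integral => //.
- apply: emeasurable_funM => //.
  exact: measurable_int (Radon_Nikodym_SigmaFinite.f_integrable dom).
- apply: emeasurable_funM => //; apply/measurable_EFinP; exact: measurable_normal_pdf.
- by move=> x _; rewrite mule_ge0// Radon_Nikodym_SigmaFinite.f_ge0.
- by move=> x _; rewrite mule_ge0// lee_fin normal_pdf_ge0.
apply: ae_eqe_mul2l; apply: integral_ae_eq => //.
- exact: Radon_Nikodym_SigmaFinite.f_integrable.
- by apply/measurable_EFinP; exact: measurable_normal_pdf.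
- by move=> A _ mA; rewrite -Radon_Nikodym_SigmaFinite.f_integral.
Qed.

Lemma normal_prob_mgf (s l : R) : s != 0 ->
  (\int[normal_prob 0 s]_x (expR (l * x))%:E = (expR (l ^+ 2 * s ^+ 2 / 2))%:E)%E.
Proof.
move=> s0; rewrite ge0_integral_normal_prob; last 2 first.
- by move=> x; rewrite lee_fin expR_ge0.
- by apply/measurable_EFinP; apply: measurableT_comp => //; exact: measurable_funM.
(* Completing the square moves the mean to l s^2. *)
transitivity (\int[mu]_x ((expR (l ^+ 2 * s ^+ 2 / 2))%:E * (normal_pdf (l * s ^+ 2) s x)%:E))%E.
  apply: eq_integral => x _; rewrite -!EFinM; congr EFin.
  rewrite !normal_pdfE// /normal_fun mulrCA [RHS]mulrCA; congr (_ * _).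
  rewrite -!expRD; congr expR.
  by rewrite subr0 -mulr_natr; field.
rewrite ge0_integralZl ?integral_normal_pdf ?mule1//.
  by apply/measurable_EFinP; exact: measurable_normal_pdf.
by move=> x _; rewrite lee_fin normal_pdf_ge0.
Qed.

Context (d : measure_display) (T : measurableType d) (P : probability T R).

Lemma gaussian_law_mgf (X : T -> R) (v : R) : measurable_fun setT X -> 0 <= v ->
  has_gaussian_law P X 0 v -> gaussian_mgf P X v.
Proof.
move=> mX v0 XG; split=> // l.
have mf : measurable_fun setT (fun x : R => (expR (l * x))%:E).
  by apply/measurable_EFinP; apply: measurableT_comp => //; exact: measurable_funM.
have f0 x : (0 <= (expR (l * x))%:E)%E by rewrite lee_fin expR_ge0.
have mX' : measurable_fun setT (X : T -> measurableTypeR R) by [].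
rewrite -(@ge0_integral_pushforward _ _ T (measurableTypeR R) R X mX' P setT
  (fun x => (expR (l * x))%:E))//.
have [v00|v1] := eqVneq v 0.
  transitivity (\int[\d_ ((0 : R)%R : measurableTypeR R)]_x (expR (l * x))%:E)%E.
    apply: eq_measure_integral => A mA _.
    by have := XG A mA; rewrite /gaussian_law v00 eqxx.
  by rewrite integral_dirac// diracE in_setT mul1e v00 !mulr0 mul0r.
transitivity (\int[normal_prob 0 (Num.sqrt v)]_x (expR (l * x))%:E)%E.
  apply: eq_measure_integral => A mA _.
  by have := XG A mA; rewrite /gaussian_law (negbTE v1).
rewrite normal_prob_mgf ?sqr_sqrtr//.
by rewrite sqrtr_eq0 -ltNge lt_neqAle eq_sym v1.
Qed.

End normal_integral.

Section independence.
Context (R : realType) (d : measure_display) (T : measurableType d)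
  (P : probability T R).

Definition indep_fun (X Y : T -> R) := forall A B : set R,
  measurable A -> measurable B ->
  P (X @^-1` A `&` Y @^-1` B) = (P (X @^-1` A) * P (Y @^-1` B))%E.

(** The joint law agrees with the product of the marginals on rectangles, hence everywhere;
    Tonelli's theorem then separates the integrals. *)
Lemma ge0_integral_indep (X Y : {mfun T >-> R}) (f g : R -> R) :
  indep_fun X Y -> measurable_fun setT f -> measurable_fun setT g ->
  (forall x, 0 <= f x) -> (forall x, 0 <= g x) ->
  (\int[P]_w (f (X w) * g (Y w))%:E =
   (\int[P]_w (f (X w))%:E) * (\int[P]_w (g (Y w))%:E))%E.
Proof.
move=> XY mf mg f0 g0.
pose XYp := fun w => (X w, Y w).
have mXY : measurable_fun setT XYp by exact: measurable_fun_pair.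
pose m1 := distribution P X; pose m2 := distribution P Y.
pose h (z : R * R) := (f z.1 * g z.2)%:E.
have mh : measurable_fun setT h.
  apply/measurable_EFinP; apply: measurable_funM.
    by apply: measurableT_comp => //; exact: measurable_fst.
  by apply: measurableT_comp => //; exact: measurable_snd.
have h0 z : (0 <= h z)%E by rewrite lee_fin mulr_ge0.
transitivity (\int[pushforward P XYp]_z h z)%E.
  by rewrite ge0_integral_pushforward.
transitivity (\int[m1 \x m2]_z h z)%E.
  apply/esym; apply: eq_measure_integral => A mA _.
  apply: (@product_measure_unique _ _ _ _ _ m1 m2 _) => //.
rewrite fubini_tonelli1//.
have mfE : measurable_fun setT (EFin \o f) by exact/measurable_EFinP.
have mgE : measurable_fun setT (EFin \o g) by exact/measurable_EFinP.
have fE : (\int[m1]_x (EFin \o f) x = \int[P]_w (f (X w))%:E)%E.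
  by rewrite ge0_integral_pushforward// => x _; rewrite lee_fin.
have gE : (\int[m2]_x (EFin \o g) x = \int[P]_w (g (Y w))%:E)%E.
  by rewrite ge0_integral_pushforward// => x _; rewrite lee_fin.
rewrite -fE -gE -ge0_integralZr//; last 2 first.
- by move=> x _; rewrite lee_fin.
- by apply: integral_ge0 => x _; rewrite lee_fin.
apply: eq_integral => x _; rewrite /fubini_F /h /=.
under eq_integral do rewrite EFinM.
by rewrite ge0_integralZl// ?lee_fin// => y _; rewrite lee_fin.
Qed.

Lemma gaussian_mgf_scale (X : T -> R) v a : gaussian_mgf P X v ->
  gaussian_mgf P (fun w => a * X w) (a ^+ 2 * v).
Proof.
move=> [mX XE]; split; first exact: measurable_funM.
move=> l; under eq_integral do rewrite mulrA; rewrite XE exprMn.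
by congr (expR _)%:E; ring.
Qed.

Lemma gaussian_mgf0 : gaussian_mgf P (fun=> 0) 0.
Proof.
split=> // l; under eq_integral do rewrite mulr0 expR0.
rewrite integral_cst// mul1e mulr0 mul0r expR0.
exact: probability_setT.
Qed.

Lemma gaussian_mgf_add (X Y : T -> R) v u : indep_fun X Y ->
  gaussian_mgf P X v -> gaussian_mgf P Y u ->
  gaussian_mgf P (fun w => X w + Y w) (v + u).
Proof.
move=> XY [mX XE] [mY YE]; split; first exact: measurable_funD.
move=> l.
pose X' : {mfun T >-> R} := mfun_Sub (mem_set mX).
pose Y' : {mfun T >-> R} := mfun_Sub (mem_set mY).
have me : measurable_fun setT (fun x : R => expR (l * x)).
  by apply: measurableT_comp => //; exact: measurable_funM.
have := @ge0_integral_indep X' Y' (fun x => expR (l * x)) (fun x => expR (l * x))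
  XY me me (fun x => expR_ge0 _) (fun x => expR_ge0 _).
rewrite /= XE YE -EFinM -expRD => e.
transitivity (\int[P]_w (expR (l * X w) * expR (l * Y w))%:E)%E.
  by apply: eq_integral => w _; rewrite mulrDr expRD.
by rewrite e; congr (expR _)%:E; ring.
Qed.

End independence.

(** * Generated sigma-algebras and independence of the past *)

Section generated_measurability.
Context (R : realType) (T : pointedType) (G : set (set T)).

Lemma sigma_lincomb n (c : nat -> R) (X : nat -> T -> R) :
  (forall k (A : set R), (k < n)%N -> measurable A -> <<s G >> (X k @^-1` A)) ->
  forall A : set R, measurable A ->
    <<s G >> ((fun w => \sum_(k < n) c k * X k w) @^-1` A).
Proof.
move=> mX; pose T' := g_sigma_algebraType G.
have : measurable_fun (setT : set T') (fun w : T' => \sum_(k < n) c k * X k w).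
  apply: measurable_sum => k; apply: measurable_funM => //.
  by move=> _ A mA; rewrite setTI; apply: mX.
by move=> + A mA => /(_ measurableT _ mA); rewrite setTI.
Qed.

End generated_measurability.

Section grouping.
Context (R : realType) (d : measure_display) (T : measurableType d)
  (P : probability T R).

(** Two finite measures of C, the probability of its intersection with E and P C times P E, agree on
    a pi-system containing the whole space, hence on the sigma-algebra it generates. *)
Lemma indep_generated (G : set (set T)) (E : set T) : G `<=` measurable ->
  G setT -> setI_closed G -> measurable E ->
  (forall C, G C -> P (C `&` E) = (P C * P E)%E) ->
  forall C, <<s G >> C -> P (C `&` E) = (P C * P E)%E.
Proof.
move=> Gm GT GI mE GE C sC.
pose r : {nonneg R} := NngNum (fine_ge0 (measure_ge0 P E)).
have nuE A : mscale r P A = (P A * P E)%E.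
  by rewrite /mscale /= fineK ?fin_num_measure// muleC.
suff : mrestr P mE C = mscale r P C by rewrite nuE.
apply: (@g_sigma_algebra_measure_unique _ R T G Gm (fun=> setT) (fun=> GT)) => //.
- by apply: bigcup_const; exists 0%N.
- by move=> A GA; apply: etrans (GE A GA) _; exact/esym/nuE.
- by move=> k; rewrite /= /mrestr setTI; exact: le_lt_trans (probability_le1 P mE) (ltry _).
Qed.

Context (D : nat -> T -> R).
Hypothesis mD : forall k, measurable_fun setT (D k).
Hypothesis D_indep : mutually_independent P
  (fun k : nat => sigma_gen [set: unit] (fun _ w => D k w)).

Let mpre k A : measurable A -> measurable (D k @^-1` A).
Proof. by move=> mA; rewrite -[X in measurable X]setTI; exact: mD. Qed.

Let cap n (A : nat -> set R) : set T := \bigcap_(i in [set i | (i < n)%N]) D i @^-1` (A i).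

Let P_cap n A : (forall k, measurable (A k)) ->
  P (cap n A) = (\prod_(i < n) P (D i @^-1` (A i)))%E.
Proof.
move=> mA; have := D_indep (J := [fset i | i in iota 0 n]%fset)
  (A := fun i => D i @^-1` (A i)).
have -> : [set` [fset i | i in iota 0 n]%fset] = [set i | (i < n)%N].
  by apply/seteqP; split=> i /=; rewrite !inE mem_iota.
rewrite -/(cap n A) => ->.
  transitivity (\prod_(i <- iota 0 n) P (D i @^-1` (A i)))%E.
    apply: perm_big; apply: uniq_perm; rewrite ?fset_uniq ?iota_uniq// => i.
    by rewrite !inE.
  by rewrite -{1}[n]subn0 -/(index_iota 0 n) big_mkord.
by move=> i _; apply: sub_sigma_algebra; exists tt; exists (A i).
Qed.

Let G n : set (set T) := [set C | exists A, (forall k, measurable (A k)) /\ C = cap n A].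

(** The events [cap n A] form a pi-system that makes the first n variables measurable, and on it
    independence of the next variable is a product formula. *)
Let indep_past n (c : nat -> R) :
  indep_fun P (fun w => \sum_(k < n) c k * D k w) (D n).
Proof.
move=> A B mA mB.
apply: (@indep_generated (G n)).
- move=> _ [A' [mA' ->]]; apply: bigcap_measurableType => i _; exact: mpre.
- exists (fun=> setT); split => //.
  by apply/seteqP; split => // w _ i.
- move=> _ _ [A1 [mA1 ->]] [A2 [mA2 ->]]; exists (fun k => A1 k `&` A2 k); split.
    by move=> k; exact: measurableI.
  by apply/seteqP; split => w; [move=> [h1 h2] i ni; split; [exact: h1|exact: h2]
    |move=> h; split => i ni; have [] := h i ni].
- exact: mpre.
- move=> _ [A' [mA' ->]].
  pose A'' k := if k == n then B else A' k.
  have -> : cap n A' `&` D n @^-1` B = cap n.+1 A''.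
    apply/seteqP; split=> w.
      case=> h1 h2 i /=; rewrite ltnS leq_eqVlt => /predU1P[->|ik].
        by rewrite /A'' eqxx.
      by rewrite /A'' ltn_eqF//; exact: h1.
    move=> h; split; last by have := h n (ltnSn n); rewrite /A'' eqxx.
    by move=> i /= ik; have := h i (ltnW ik : (i < n.+1)%N); rewrite /A'' ltn_eqF.
  rewrite !P_cap//; last by move=> k; rewrite /A''; case: ifP.
  rewrite big_ord_recr /= /A'' eqxx; congr (_ * _)%E.
  by apply: eq_bigr => i _; rewrite ltn_eqF.
- apply: sigma_lincomb => // k A' kn mA'; apply: sub_sigma_algebra.
  exists (fun i => if i == k then A' else setT); split.
    by move=> i; case: ifP.
  apply/seteqP; split => w.
    by move=> h i _ /=; case: eqP => // ->.
  by move=> /(_ k kn) /=; rewrite eqxx.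
Qed.

Lemma gaussian_mgf_lincomb (v : R) n (c : nat -> R) : (forall k, gaussian_mgf P (D k) v) ->
  gaussian_mgf P (fun w => \sum_(k < n) c k * D k w) (\sum_(k < n) c k ^+ 2 * v).
Proof.
move=> DG; elim: n => [|n IH].
  rewrite big_ord0; under eq_fun do rewrite big_ord0.
  exact: gaussian_mgf0.
rewrite big_ord_recr; under eq_fun do rewrite big_ord_recr /=.
apply: gaussian_mgf_add => //; last exact: gaussian_mgf_scale.
move=> A B mA mB.
have mc : measurable_fun setT (fun x : R => c n * x) by exact: measurable_funM.
have := indep_past n c mA (_ : measurable ((fun x => c n * x) @^-1` B)).
apply; rewrite -[X in measurable X]setTI; exact: mc.
Qed.

End grouping.

(** * Jointly Gaussian sequences *)

Section gaussian_family.
Context (R : realType) (d : measure_display) (T : measurableType d)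
  (P : probability T R).

(** Centred and jointly Gaussian with covariance r, encoded by linear combinations alone, so that
    laws of vectors never occur. *)
Definition gaussian_family (X : nat -> T -> R) (r : nat -> nat -> R) :=
  forall n (c : nat -> R), gaussian_mgf P (fun w => \sum_(k < n) c k * X k w)
    (\sum_(k < n) \sum_(j < n) c k * c j * r k j).

Lemma integral_sum_EFin (I : finType) (f : I -> T -> R) (e : I -> R) :
  (forall k, P.-integrable setT (EFin \o f k)) ->
  (forall k, (\int[P]_w (f k w)%:E = (e k)%:E)%E) ->
  (\int[P]_w (\sum_k f k w)%R%:E = (\sum_k e k)%R%:E)%E.
Proof.
move=> fi fe; under eq_integral do rewrite -sumEFin.
rewrite integral_sum// -sumEFin.
by apply: eq_bigr => k _; rewrite fe.
Qed.

Lemma integrable_mul (f g : T -> R) : measurable_fun setT f -> measurable_fun setT g ->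
  P.-integrable setT (fun w => (f w ^+ 2)%:E) ->
  P.-integrable setT (fun w => (g w ^+ 2)%:E) ->
  P.-integrable setT (EFin \o (fun w => f w * g w)).
Proof.
move=> mf mg f2 g2.
apply: (@le_integrable _ _ _ P _ measurableT _ (fun w => (f w ^+ 2)%:E + (g w ^+ 2)%:E)%E).
- by apply/measurable_EFinP; exact: measurable_funM.
- move=> w _ /=; rewrite lee_fin [leRHS]ger0_norm ?addr_ge0 ?sqr_ge0//.
  rewrite normrM -(real_normK (num_real (f w))) -(real_normK (num_real (g w))).
  by have := normr_ge0 (f w); have := normr_ge0 (g w); nra.
- exact: integrableD.
Qed.

Section fractional.
Variables (H : R) (X : R -> {RV P >-> R}).
Hypothesis fX : fractional_brownian_motion H X.

Definition fbm_cov (s t : R) : R :=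
  2^-1 * (t `^ (2 * H) + s `^ (2 * H) - `|t - s| `^ (2 * H)).

Let combo n (t a : 'I_n -> R) : (forall k, 0 <= t k) -> exists2 v, 0 <= v &
  gaussian_mgf P (fun w => \sum_(k < n) a k * X (t k) w) v.
Proof.
move=> t0; have [v [v0 G]] := fX.1 n t a t0; exists v => //.
apply: gaussian_law_mgf => //.
by apply: measurable_sum => k; apply: measurable_funM.
Qed.

Let one t : 0 <= t -> exists2 v, 0 <= v & gaussian_mgf P (X t) v.
Proof.
move=> t0; have [v v0 G] := @combo 1 (fun=> t) (fun=> 1) (fun=> t0).
exists v => //; move: G; rewrite (_ : (fun w => _) = X t)//.
by apply/funext => w; rewrite big_ord1 mul1r.
Qed.

Let sq_int t : 0 <= t -> P.-integrable setT (fun w => (X t w ^+ 2)%:E).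
Proof. by move=> /one[v v0 G]; exact: gaussian_pow_integrable G 2. Qed.

Let prod_int s t : 0 <= s -> 0 <= t ->
  P.-integrable setT (EFin \o (fun w => X s w * X t w)).
Proof. by move=> s0 t0; apply: integrable_mul => //; exact: sq_int. Qed.

Let mean0 t : 0 <= t -> ('E_P[X t] = 0)%E.
Proof. by move=> /one[v v0 G]; rewrite unlock; exact: gaussian_moment1 G. Qed.

Let prod_mean s t : 0 <= s -> 0 <= t ->
  (\int[P]_w (X s w * X t w)%:E = (fbm_cov s t)%:E)%E.
Proof.
move=> s0 t0; rewrite /fbm_cov -(fX.2 s t s0 t0) covariance.unlock !mean0//.
rewrite unlock; apply: eq_integral => w _ /=.
by rewrite !fctE /= !subr0.
Qed.

(** A Gaussian process comes only with the existence of some variance v; it is identified as the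
    second moment, expanded by means of the covariances. *)
Lemma fbm_gaussian n (t a : 'I_n -> R) : (forall k, 0 <= t k) ->
  gaussian_mgf P (fun w => \sum_(k < n) a k * X (t k) w)
   (\sum_k \sum_j a k * a j * fbm_cov (t k) (t j)).
Proof.
move=> t0; have [v v0 G] := combo a t0.
suff <- : v = \sum_k \sum_j a k * a j * fbm_cov (t k) (t j) by [].
have := gaussian_moment2 G; under eq_integral => w _.
  have -> : (\sum_(k < n) a k * X (t k) w) ^+ 2 =
    \sum_(z : 'I_n * 'I_n) (a z.1 * a z.2) * (X (t z.1) w * X (t z.2) w).
    rewrite expr2 mulr_suml -(pair_bigA _ (fun k j => a k * a j * (X (t k) w * X (t j) w))) /=.
    by apply: eq_bigr => k _; rewrite mulr_sumr; apply: eq_bigr => j _; ring.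
  over.
rewrite (@integral_sum_EFin _ _ (fun z => a z.1 * a z.2 * fbm_cov (t z.1) (t z.2))).
- by rewrite -(pair_bigA _ (fun k j => a k * a j * fbm_cov (t k) (t j))) /= => -[->].
- move=> z; rewrite (_ : _ \o _ = (fun w => (a z.1 * a z.2)%:E * (EFin \o (fun w => (X (t z.1) w * X (t z.2) w)%R)) w)%E).
    by apply: integrableZl => //; exact: prod_int.
  by apply/funext => w /=; rewrite -EFinM.
- by move=> z; rewrite EFinM -prod_mean// -integralZl//; exact: prod_int.
Qed.

Definition fbm_incr_cov (h : R) (k j : nat) : R :=
  fbm_cov (k.+1%:R * h) (j.+1%:R * h) - fbm_cov (k.+1%:R * h) (j%:R * h)
  - fbm_cov (k%:R * h) (j.+1%:R * h) + fbm_cov (k%:R * h) (j%:R * h).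

Lemma fbm_increments h : 0 <= h -> gaussian_family
  (fun k w => X (k.+1%:R * h) w - X (k%:R * h) w) (fbm_incr_cov h).
Proof.
move=> h0 n c.
(* The increments form one combination over twice as many times: right ends with coefficient c, left
   ends with - c. *)
pose t (i : 'I_(n + n)) : R := match fintype.split i with inl k => k.+1%:R * h | inr k => k%:R * h end.
pose a (i : 'I_(n + n)) : R := match fintype.split i with inl k => c k | inr k => - c k end.
have t0 i : 0 <= t i by rewrite /t; case: (fintype.split i) => k; rewrite mulr_ge0.
have tl (k : 'I_n) : t (lshift n k) = k.+1%:R * h by rewrite /t (unsplitK (inl k)).
have tr (k : 'I_n) : t (rshift n k) = k%:R * h by rewrite /t (unsplitK (inr k)).
have al (k : 'I_n) : a (lshift n k) = c k by rewrite /a (unsplitK (inl k)).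
have ar (k : 'I_n) : a (rshift n k) = - c k by rewrite /a (unsplitK (inr k)).
have := fbm_gaussian a t0.
rewrite (_ : (fun w => _) = (fun w => \sum_(k < n) c k * (X (k.+1%:R * h) w - X (k%:R * h) w))).
  rewrite (_ : \sum_k _ = \sum_(k < n) \sum_(j < n) c k * c j * fbm_incr_cov h k j)//.
  rewrite big_split_ord /= -big_split /=; apply: eq_bigr => k _.
  rewrite !big_split_ord /= -!big_split /=; apply: eq_bigr => j _.
  by rewrite !(tl, tr, al, ar) /fbm_incr_cov; ring.
apply/funext => w; rewrite big_split_ord /= -big_split /=; apply: eq_bigr => k _.
by rewrite !(tl, tr, al, ar); ring.
Qed.

End fractional.

Lemma brownian_increments (B : R -> {RV P >-> R}) h : 0 <= h -> brownian_motion B ->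
  gaussian_family (fun k w => B (k.+1%:R * h) w - B (k%:R * h) w)
    (fun k j => h * (k == j)%:R).
Proof.
move=> h0 [_ Bg Bi _] n c.
have -> : \sum_(k < n) \sum_(j < n) c k * c j * (h * (k == j :> nat)%:R) = \sum_(k < n) c k ^+ 2 * h.
  apply: eq_bigr => k _; rewrite (bigD1 k)//= eqxx big1 ?addr0 ?mulr1//.
  by move=> j jk; rewrite eq_sym (negbTE (jk : (j != k :> nat))) !mulr0.
have kk k : k%:R * h <= k.+1%:R * h by rewrite ler_wpM2r// ler_nat.
apply: (@gaussian_mgf_lincomb _ _ _ P (fun k w => B (k.+1%:R * h) w - B (k%:R * h) w)).
- by move=> k; exact: measurable_funB.
- by apply: (Bi (fun k => k%:R * h)) => //; rewrite mul0r.
- move=> k; apply: gaussian_law_mgf => //; first exact: measurable_funB.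
  have := Bg (k%:R * h) (k.+1%:R * h) (mulr_ge0 (ler0n _ _) h0) (kk k).
  by rewrite (_ : k.+1%:R * h - k%:R * h = h)// -(natr1 k); ring.
Qed.

Lemma gaussian_family_add (X Y : nat -> T -> R) r s (x y : R) :
  (forall n (c c' : nat -> R), indep_fun P (fun w => \sum_(k < n) c k * X k w)
     (fun w => \sum_(k < n) c' k * Y k w)) ->
  gaussian_family X r -> gaussian_family Y s ->
  gaussian_family (fun k w => x * X k w + y * Y k w)
    (fun k j => x ^+ 2 * r k j + y ^+ 2 * s k j).
Proof.
move=> XY GX GY n c.
have := gaussian_mgf_add (XY n (fun k => c k * x) (fun k => c k * y))
  (GX n (fun k => c k * x)) (GY n (fun k => c k * y)).
rewrite (_ : (fun w => _) = (fun w => \sum_(k < n) c k * (x * X k w + y * Y k w))).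
  rewrite (_ : _ + _ = \sum_(k < n) \sum_(j < n) c k * c j * (x ^+ 2 * r k j + y ^+ 2 * s k j))//.
  rewrite -big_split /=; apply: eq_bigr => k _; rewrite -big_split /=.
  by apply: eq_bigr => j _; ring.
by apply/funext => w; rewrite -big_split /=; apply: eq_bigr => k _; ring.
Qed.

End gaussian_family.

(** * Averages along polynomial times *)

Section block_fill.
Variable R : realType.
Implicit Types (a s t : nat -> R) (p i n : nat).

Let ratio p i : R := (i.+2%:R / i.+1%:R) ^+ p.

Let ratio_cvg p : ratio p i @[i --> \oo] --> (1 : R).
Proof.
have H : (1 + i.+1%:R^-1 : R) @[i --> \oo] --> (1 : R).
  rewrite -[X in _ --> X]addr0; apply: cvgD; first exact: cvg_cst.
  exact: cvg_harmonic.
rewrite -[X in _ --> X](expr1n _ p).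
apply: (@cvg_comp _ _ _ (fun i => i.+2%:R / i.+1%:R : R) (fun x : R => x ^+ p) _ (nbhs (1 : R)));
  last exact: exprn_continuous.
have -> : (fun i => i.+2%:R / i.+1%:R : R) = (fun i => 1 + i.+1%:R^-1) by
  apply/funext => i; rewrite -(natr1 i.+1) mulrDl mulfV ?mul1r.
exact: H.
Qed.

Let block p n : (0 < p)%N -> (0 < n)%N -> exists i,
  ((i.+1) ^ p <= n < (i.+2) ^ p)%N.
Proof.
move=> p0 n0; pose Q i := ((i.+1) ^ p <= n)%N.
have Q0 : exists i, Q i by exists 0%N; rewrite /Q exp1n.
have Qb i : Q i -> (i <= n)%N.
  move=> h; apply: (leq_trans _ h); apply: (leq_trans (leqnSn i)).
  by rewrite -{1}(expn1 i.+1) leq_pexp2l.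
case: (ex_maxnP Q0 Qb) => i Qi im; exists i; rewrite -/(Q i) Qi /=.
by rewrite ltnNge; apply/negP => /im; rewrite ltnn.
Qed.

Let block_far p n i I : (0 < p)%N -> (I.+1 ^ p <= n)%N -> (n < i.+2 ^ p)%N -> (I <= i)%N.
Proof.
by move=> p0 h1 h2; have := leq_ltn_trans h1 h2; rewrite ltn_exp2r.
Qed.

Let avg a n : R := n%:R^-1 * a n.

Let avg_block a p i n : (forall n, 0 <= a n) -> {homo a : m n / (m <= n)%N >-> m <= n} ->
  (0 < p)%N -> (i.+1 ^ p <= n < i.+2 ^ p)%N ->
  avg a (i.+1 ^ p) / ratio p i <= avg a n <= avg a (i.+2 ^ p) * ratio p i.
Proof.
move=> a0 am p0 /andP[n1 n2].
have i1 : 0 < i.+1%:R ^+ p :> R by rewrite exprn_gt0// ltr0n.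
have i2 : 0 < i.+2%:R ^+ p :> R by rewrite exprn_gt0// ltr0n.
have n0 : 0 < n%:R :> R by rewrite ltr0n (leq_trans _ n1)// expn_gt0.
have h1 : i.+1%:R ^+ p <= n%:R :> R by rewrite -natrX ler_nat.
have h2 : n%:R <= i.+2%:R ^+ p :> R by rewrite -natrX ler_nat ltnW.
rewrite /avg /ratio !natrX exprMn exprVn invf_div; apply/andP; split.
  have -> : (i.+1%:R ^+ p)^-1 * a (i.+1 ^ p)%N * (i.+1%:R ^+ p / i.+2%:R ^+ p) =
    (i.+2%:R ^+ p)^-1 * a (i.+1 ^ p)%N by field; rewrite !gt_eqF.
  by rewrite ler_pM ?invr_ge0 ?(ltW i2)// ?lef_pV2 ?posrE// am.
have -> : (i.+2%:R ^+ p)^-1 * a (i.+2 ^ p)%N * (i.+2%:R ^+ p / i.+1%:R ^+ p) =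
    (i.+1%:R ^+ p)^-1 * a (i.+2 ^ p)%N by field; rewrite !gt_eqF.
by rewrite ler_pM ?invr_ge0 ?(ltW n0)// ?lef_pV2 ?posrE// am// ltnW.
Qed.

(** Between consecutive p-th powers, whose ratio tends to 1, a nondecreasing sequence is squeezed by
    its values at both ends. *)
Lemma cvg_avg_monotone a (l : R) p : (0 < p)%N -> (forall n, 0 <= a n) ->
  {homo a : m n / (m <= n)%N >-> m <= n} ->
  (i.+1 ^ p)%:R^-1 * a (i.+1 ^ p)%N @[i --> \oo] --> l ->
  n%:R^-1 * a n @[n --> \oo] --> l.
Proof.
move=> p0 a0 am al.
have lo : avg a (i.+1 ^ p) / ratio p i @[i --> \oo] --> l.
  by have := cvgM al (cvgV (oner_neq0 _) (ratio_cvg p)); rewrite invr1 mulr1; exact.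
have up : avg a (i.+2 ^ p) * ratio p i @[i --> \oo] --> l.
  have al' : avg a (i.+2 ^ p) @[i --> \oo] --> l.
    by have := al; rewrite -(cvg_shiftS (fun i => avg a (i.+1 ^ p))); exact.
  by have := cvgM al' (ratio_cvg p); rewrite mulr1; exact.
apply/cvgrPdist_lt => e e0.
have /cvgrPdist_lt /(_ e e0) [I1 _ H1] := lo.
have /cvgrPdist_lt /(_ e e0) [I2 _ H2] := up.
exists ((maxn I1 I2).+1 ^ p)%N => // n /= nI.
have n0 : (0 < n)%N by apply: leq_trans nI; rewrite expn_gt0.
have [i ii] := block p0 n0; have [i1 i2] := andP ii.
have := block_far p0 nI i2; rewrite geq_max => /andP[Ii1 Ii2].
have /andP[b1 b2] := avg_block a0 am p0 ii.
have := H1 i Ii1; have := H2 i Ii2 => /=; rewrite !ltr_norml -/(avg a n).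
move=> /andP[? ?] /andP[? ?]; apply/andP; split; lra.
Qed.

(** Between p-th powers the signed sum moves by at most the increment of the sum of t; divided by n,
    this increment tends to 0 because the averages of t converge and the ratio of the ends tends to
    1. *)
Lemma cvg_avg_dominated s t (l : R) p : (0 < p)%N -> (forall k, `|s k| <= t k) ->
  n%:R^-1 * (\sum_(k < n) t k) @[n --> \oo] --> l ->
  (i.+1 ^ p)%:R^-1 * (\sum_(k < i.+1 ^ p) s k) @[i --> \oo] --> (0 : R) ->
  n%:R^-1 * (\sum_(k < n) s k) @[n --> \oo] --> (0 : R).
Proof.
move=> p0 st tl sl.
pose A n := \sum_(k < n) t k.
have t0 k : 0 <= t k by exact: le_trans (st k).
have A0 n : 0 <= A n by exact: sumr_ge0.
have Am : {homo A : m n / (m <= n)%N >-> m <= n}.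
  move=> m n /subnK <-; elim: (n - m)%N => // j IH.
  by rewrite addSn /A big_ord_recr/= -/(A _) (le_trans IH)// lerDl.
have Al : avg A (i.+1 ^ p) @[i --> \oo] --> l.
  apply: (cvg_comp (fun i => i.+1 ^ p)%N (avg A)) tl.
  apply/cvgnyPge => N; exists N => // i /= Ni.
  by rewrite (leq_trans Ni)// (leq_trans (leqnSn i))// -{1}(expn1 i.+1) leq_pexp2l.
have Alr : avg A (i.+1 ^ p) / ratio p i @[i --> \oo] --> l.
  by have := cvgM Al (cvgV (oner_neq0 _) (ratio_cvg p)); rewrite invr1 mulr1; exact.
apply/cvgrPdist_lt => e e0; have e3 : 0 < e / 3 by rewrite divr_gt0.
have /cvgrPdist_lt /(_ _ e3) [I1 _ H1] := sl.
have /cvgrPdist_lt /(_ _ e3) [I2 _ H2] := Alr.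
have /cvgrPdist_lt /(_ _ e3) [I3 _ H3] := tl.
exists (maxn I3 ((maxn I1 I2).+1 ^ p))%N => // n /=; rewrite geq_max => /andP[nI3 nI].
have n0 : (0 < n)%N by apply: leq_trans nI; rewrite expn_gt0.
have [i ii] := block p0 n0; have [i1 i2] := andP ii.
have := block_far p0 nI i2; rewrite geq_max => /andP[Ii1 Ii2].
have /andP[b1 _] := avg_block A0 Am p0 ii.
have := H1 i Ii1; have := H2 i Ii2; have := H3 n nI3 => /=.
rewrite !sub0r !normrN -/(avg A n) => h3 h2 h1.
have nr : 0 < n%:R :> R by rewrite ltr0n.
have ir : 0 < (i.+1 ^ p)%:R :> R by rewrite ltr0n expn_gt0.
have split_sum : `|\sum_(k < n) s k| <= `|\sum_(k < i.+1 ^ p) s k| + (A n - A (i.+1 ^ p)%N).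
  rewrite /A -!(big_mkord xpredT s) -!(big_mkord xpredT t).
  rewrite !(@big_cat_nat _ _ _ (i.+1 ^ p) 0 n)//= (le_trans (ler_normD _ _))//.
  rewrite lerD2l addrAC subrr add0r (le_trans (ler_norm_sum _ _ _))//.
  exact: ler_sum.
rewrite normrM ger0_norm ?invr_ge0//.
apply: (@le_lt_trans _ _ (n%:R^-1 * (`|\sum_(k < i.+1 ^ p) s k| + (A n - A (i.+1 ^ p)%N)))).
  by rewrite ler_wpM2l ?invr_ge0.
have c1 : n%:R^-1 * `|\sum_(k < i.+1 ^ p) s k| <= (i.+1 ^ p)%:R^-1 * `|\sum_(k < i.+1 ^ p) s k|.
  by rewrite ler_wpM2r// lef_pV2 ?posrE// ler_nat.
have c2 : avg A (i.+1 ^ p) / ratio p i <= n%:R^-1 * A (i.+1 ^ p)%N.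
  rewrite /avg /ratio natrX exprMn exprVn invf_div.
  have i3 : 0 < i.+1%:R ^+ p :> R by rewrite exprn_gt0// ltr0n.
  have i4 : 0 < i.+2%:R ^+ p :> R by rewrite exprn_gt0// ltr0n.
  have -> : (i.+1%:R ^+ p)^-1 * A (i.+1 ^ p)%N * (i.+1%:R ^+ p / i.+2%:R ^+ p) =
    (i.+2%:R ^+ p)^-1 * A (i.+1 ^ p)%N by field; rewrite !gt_eqF.
  by rewrite ler_wpM2r// lef_pV2 ?posrE// -natrX ler_nat ltnW.
move: h1; rewrite normrM (@ger0_norm _ _^-1) ?invr_ge0// => h1.
move: h2 h3; rewrite !ltr_norml /avg => /andP[? ?] /andP[? ?].
rewrite /avg in c2; rewrite mulrDr mulrBr; lra.
Qed.

End block_fill.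

Section subsequence.
Context (R : realType) (d : measure_display) (T : measurableType d)
  (P : probability T R).

Lemma subsequence_cvg0 (S : nat -> T -> R) (K b : R) : 0 <= K -> b < 2 ->
  (forall n, measurable_fun setT (S n)) ->
  (forall n, (0 < n)%N -> (\int[P]_w (S n w ^+ 2)%:E <= (K * n%:R `^ b)%:E)%E) ->
  exists2 p, (0 < p)%N & {ae P, forall w,
    (i.+1 ^ p)%:R^-1 * S (i.+1 ^ p)%N w @[i --> \oo] --> (0 : R)}.
Proof.
move=> K0 b2 mS SK.
have b0 : 0 < 2 - b by rewrite subr_gt0.
(* At n = (i+1)^p, Chebyshev's inequality with level 1/(i+1) gives K n^(b-2) (i+1)^2, which is at
   most K (i+1)^-2 as soon as p (2 - b) >= 4. *)
pose p := (Num.truncn (4 / (2 - b))).+1.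
have pb : 4 <= p%:R * (2 - b) by rewrite -ler_pdivrMr// ltW// truncnS_gt.
exists p => //.
pose n i := (i.+1 ^ p)%N.
have n0 i : (0 < n i)%N by rewrite expn_gt0.
pose E i := [set w | i.+1%:R^-1 ^+ 2 <= ((n i)%:R^-1 * S (n i) w) ^+ 2].
have mE i : measurable (E i).
  rewrite -[X in measurable X]setTI; apply: measurable_fun_le => //.
  by apply: measurable_funX; apply: measurable_funM.
have := @borel_cantelli_riemann R d T P E 1 K 0 ltr01 K0 mE _.
have PE i : (P (E i) <= (K * expR (- ((1 + 1) * ln i.+1%:R)))%:E)%E.
  have nr : 0 < (n i)%:R :> R by rewrite ltr0n.
  have ir : 0 < i.+1%:R :> R by rewrite ltr0n.
  have c0 : 0 < (n i)%:R ^+ 2 / i.+1%:R ^+ 2 :> R by rewrite divr_gt0 ?exprn_gt0.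
  have h : (((n i)%:R ^+ 2 / i.+1%:R ^+ 2)%:E * P (E i) <= \int[P]_w (S (n i) w ^+ 2)%:E)%E.
    have -> : P (E i) = (\int[P]_w (\1_(E i) w)%:E)%E by rewrite integral_indic// setIT.
    rewrite -ge0_integralZl//; last by apply/measurable_EFinP; exact: measurable_indic.
    apply: ge0_le_integral => //.
    - by apply: emeasurable_funM => //; apply/measurable_EFinP; exact: measurable_indic.
    - by apply/measurable_EFinP; exact: measurable_funX.
    move=> w _; rewrite indicE -EFinM lee_fin.
    have [/set_mem Ew|_] := boolP (w \in E i); last by rewrite mulr0 sqr_ge0.
    rewrite mulr1; have : i.+1%:R^-1 ^+ 2 <= ((n i)%:R^-1 * S (n i) w) ^+ 2 by exact: Ew.
    rewrite exprMn => /(ler_wpM2l (ltW (exprn_gt0 2 nr))).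
    by rewrite [leRHS]mulrA -[in leRHS]exprMn mulfV ?gt_eqF// expr1n mul1r exprVn.
  have := le_trans h (SK _ (n0 i)).
  have fP : P (E i) \is a fin_num by exact: fin_num_measure.
  rewrite -(fineK fP) -EFinM !lee_fin mulrC -ler_pdivlMr// => h2.
  apply: (le_trans h2); rewrite -mulrA ler_wpM2l//.
  have -> : (n i)%:R `^ b = expR (b * (p%:R * ln i.+1%:R)) :> R.
    by rewrite /powR gt_eqF// natrX lnXn// mulr_natl.
  have -> : (n i)%:R ^+ 2 / i.+1%:R ^+ 2 = expR (2 * (p%:R * ln i.+1%:R) - 2 * ln i.+1%:R) :> R.
    rewrite expRB !(expRM_natl 2) lnK ?posrE// expRM_natl lnK ?posrE//.
    by rewrite natrX.
  rewrite -expRN -expRD ler_expR.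
  have l0 : 0 <= ln i.+1%:R :> R by rewrite ln_ge0// ler1n.
  have := ler_wpM2r l0 pb; lra.
move=> /(_ (fun i _ => PE i)); apply: filterS => w [I HI].
apply/cvgrPdist_lt => e e0.
exists (maxn I (Num.truncn e^-1).+1) => // i /=; rewrite geq_max => /andP[Ii ei].
rewrite sub0r normrN.
have := HI i Ii; rewrite /E /= => /negP; rewrite -ltNge.
rewrite -[X in X < _](real_normK (num_real _)) ltr_sqr ?nnegrE ?invr_ge0//.
move=> h; apply: (lt_le_trans h).
rewrite -[leRHS]invrK lef_pV2 ?posrE ?invr_gt0 ?ltr0n//.
rewrite (le_trans (ltW (truncnS_gt _)))// ler_nat (leq_trans ei)//.
Qed.

End subsequence.

(** * Law of large numbers for Gaussian sequences *)

Section mean.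
Context (R : realType) (d : measure_display) (T : measurableType d)
  (P : probability T R).
Implicit Types (f g : T -> R) (a b e x : R).

Definition has_mean f e :=
  P.-integrable setT (EFin \o f) /\ (\int[P]_w (f w)%:E = e%:E)%E.

Lemma has_mean_lin f g a b x y : has_mean f a -> has_mean g b ->
  has_mean (fun w => x * f w + y * g w) (x * a + y * b).
Proof.
move=> [fi fa] [gi gb].
have xi : P.-integrable setT (fun w => x%:E * (EFin \o f) w)%E by exact: integrableZl.
have yi : P.-integrable setT (fun w => y%:E * (EFin \o g) w)%E by exact: integrableZl.
have E : (fun w => (x * f w + y * g w)%:E) =
  ((fun w => x%:E * (EFin \o f) w) \+ (fun w => y%:E * (EFin \o g) w))%E by [].
split; first by rewrite /comp E; exact: integrableD.
by rewrite E integralD//= !integralZl//= fa gb.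
Qed.

Lemma eq_has_mean f g a b : has_mean f a -> f =1 g -> a = b -> has_mean g b.
Proof. by move=> h /funext <- <-. Qed.

Lemma eq_gaussian_mgf X Y u v :
  gaussian_mgf P X u -> X =1 Y -> u = v -> gaussian_mgf P Y v.
Proof. by move=> h /funext <- <-. Qed.

Lemma has_mean_cst x : has_mean (fun=> x) x.
Proof.
split; first exact: finite_measure_integrable_cst.
by rewrite integral_cst// -[RHS]mule1; congr (_ * _)%E; exact: probability_setT.
Qed.

Lemma has_mean_sum (I : finType) (f : I -> T -> R) (e : I -> R) :
  (forall i, has_mean (f i) (e i)) ->
  has_mean (fun w => \sum_i f i w) (\sum_i e i).
Proof.
move=> fe; split; last by apply: integral_sum_EFin => i; have [] := fe i.
rewrite (_ : _ \o _ = fun w => (\sum_i (EFin \o f i) w)%E); last first.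
  by apply/funext => w /=; rewrite sumEFin.
by apply: integrable_sum => // i _; have [] := fe i.
Qed.

Lemma gaussian_mean_sqr X v : gaussian_mgf P X v -> has_mean (fun w => X w ^+ 2) v.
Proof. by move=> G; split; [exact: gaussian_pow_integrable G 2|exact: gaussian_moment2]. Qed.

Lemma gaussian_mean_pow4 X v : gaussian_mgf P X v ->
  has_mean (fun w => X w ^+ 4) (3 * v ^+ 2).
Proof. by move=> G; split; [exact: gaussian_pow_integrable G 4|exact: gaussian_moment4]. Qed.

End mean.

Section family.
Context (R : realType) (d : measure_display) (T : measurableType d)
  (P : probability T R).
Variables (X : nat -> T -> R) (r : nat -> nat -> R).
Hypothesis GX : gaussian_family P X r.

Let fiber_sum (I : finType) (a : I -> R) (f : I -> nat) n (g : nat -> R) :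
  (forall i, (f i < n)%N) ->
  \sum_(k < n) (\sum_(i | f i == k) a i) * g k = \sum_i a i * g (f i).
Proof.
move=> fn; pose f' i := Ordinal (fn i).
rewrite (partition_big f' xpredT)//=; apply: eq_bigr => k _.
rewrite mulr_suml; apply: eq_big => [i|i /eqP <-//].
by rewrite -val_eqE.
Qed.

(** Indices may repeat in f, whereas a Gaussian family has one coefficient per index: coefficients
    sharing an index are added. *)
Lemma gaussian_family_pick (I : finType) (a : I -> R) (f : I -> nat) :
  gaussian_mgf P (fun w => \sum_i a i * X (f i) w)
    (\sum_i \sum_j a i * a j * r (f i) (f j)).
Proof.
pose n := (\max_i f i).+1.
have fn i : (f i < n)%N by rewrite ltnS; exact: leq_bigmax.
have := GX n (fun k => \sum_(i | f i == k) a i).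
rewrite (_ : (fun w => _) = (fun w => \sum_i a i * X (f i) w)).
  rewrite (_ : \sum_(k < n) _ = \sum_i \sum_j a i * a j * r (f i) (f j))//.
  under eq_bigr => k _.
    under eq_bigr do rewrite -mulrA.
    rewrite -mulr_sumr (fiber_sum a (r k) fn).
    over.
  rewrite (fiber_sum a (fun k => \sum_i a i * r k (f i)) fn).
  apply: eq_bigr => i _; rewrite mulr_sumr.
  by apply: eq_bigr => j _; rewrite mulrA.
by apply/funext => w; rewrite (fiber_sum a (X^~ w) fn).
Qed.

Lemma gaussian_family_shift (x y : R) (a b : nat) :
  gaussian_family P (fun k w => x * X (a + k) w + y * X (b + k) w)
  (fun k j => x ^+ 2 * r (a + k) (a + j) + x * y * r (a + k) (b + j) +
              y * x * r (b + k) (a + j) + y ^+ 2 * r (b + k) (b + j)).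
Proof.
move=> n c.
pose al (z : 'I_n * bool) : R := c z.1 * (if z.2 then x else y).
pose f (z : 'I_n * bool) : nat := ((if z.2 then a else b) + z.1)%N.
have := gaussian_family_pick al f.
rewrite (_ : (fun w => _) =
    (fun w => \sum_(k < n) c k * (x * X (a + k)%N w + y * X (b + k)%N w))).
  rewrite (_ : \sum_i _ = \sum_(k < n) \sum_(j < n) c k * c j *
    (x ^+ 2 * r (a + k)%N (a + j)%N + x * y * r (a + k)%N (b + j)%N +
     y * x * r (b + k)%N (a + j)%N + y ^+ 2 * r (b + k)%N (b + j)%N))//.
  rewrite -(pair_bigA _ (fun k e => \sum_j al (k, e) * al j * r (f (k, e)) (f j))) /=.
  apply: eq_bigr => k _; rewrite big_bool /=.
  rewrite -(pair_bigA _ (fun j e => al (k, true) * al (j, e) * r (f (k, true)) (f (j, e)))) /=.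
  rewrite -(pair_bigA _ (fun j e => al (k, false) * al (j, e) * r (f (k, false)) (f (j, e)))) /=.
  rewrite -big_split /=; apply: eq_bigr => j _; rewrite !big_bool /al /f /=; ring.
apply/funext => w.
rewrite -(pair_bigA _ (fun k e => al (k, e) * X (f (k, e)) w)) /=.
by apply: eq_bigr => k _; rewrite big_bool /al /f /=; ring.
Qed.

Hypothesis rC : forall k j, r k j = r j k.

Let pair k j (x y : R) : gaussian_mgf P (fun w => x * X k w + y * X j w)
  (x ^+ 2 * r k k + 2 * (x * y) * r k j + y ^+ 2 * r j j).
Proof.
apply: (eq_gaussian_mgf (gaussian_family_pick (fun b : bool => if b then x else y)
  (fun b => if b then k else j))); first by move=> w; rewrite big_bool.
by rewrite !big_bool /= (rC j k); ring.
Qed.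

Let single k : gaussian_mgf P (X k) (r k k).
Proof.
by apply: (eq_gaussian_mgf (pair k k 1 0)); [move=> w|]; ring.
Qed.

Lemma gaussian_family_meas k : measurable_fun setT (X k).
Proof. by have [] := single k. Qed.

Let mean_prod k j : has_mean P (fun w => X k w * X j w) (r k j).
Proof.
by apply: (eq_has_mean (has_mean_lin (4^-1) (- 4^-1) (gaussian_mean_sqr (pair k j 1 1))
  (gaussian_mean_sqr (pair k j 1 (-1))))); [move=> w|]; field.
Qed.

(* Polarization: (x + y)^4 + (x - y)^4 = 2 x^4 + 12 x^2 y^2 + 2 y^4. *)
Let mean_sqr_prod k j : has_mean P (fun w => X k w ^+ 2 * X j w ^+ 2)
  (r k k * r j j + 2 * r k j ^+ 2).
Proof.
have h1 := has_mean_lin 1 1 (gaussian_mean_pow4 (pair k j 1 1))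
  (gaussian_mean_pow4 (pair k j 1 (-1))).
have h2 := has_mean_lin 1 1 (gaussian_mean_pow4 (single k)) (gaussian_mean_pow4 (single j)).
by apply: (eq_has_mean (has_mean_lin (12^-1) (- 6^-1) h1 h2)); [move=> w|]; field.
Qed.

Variables (v K b : R).
Hypothesis v_diag : forall k, r k k = v.
Hypothesis r_ge0 : forall k j, 0 <= r k j.
Hypothesis K_ge0 : 0 <= K.
Hypothesis b_lt2 : b < 2.
Hypothesis r_sum : forall n, (0 < n)%N ->
  \sum_(k < n) \sum_(j < n) r k j <= K * n%:R `^ b.

(** From the nonnegative variance 2 v - 2 r k j of X k - X j. *)
Let r_le k j : r k j <= v.
Proof.
have [_ e] := gaussian_mean_sqr (pair k j 1 (-1)).
have : (0 <= \int[P]_w ((1 * X k w + (-1) * X j w) ^+ 2)%:E)%E.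
  by apply: integral_ge0 => w _; rewrite lee_fin sqr_ge0.
by rewrite e lee_fin !v_diag; lra.
Qed.

Let v_ge0 : 0 <= v. Proof. by rewrite -(v_diag 0). Qed.

Let sqr_sum_mean (f : nat -> T -> R) (e : nat -> nat -> R) n :
  (forall k j, has_mean P (fun w => f k w * f j w) (e k j)) ->
  (\int[P]_w ((\sum_(k < n) f k w) ^+ 2)%:E = (\sum_(k < n) \sum_(j < n) e k j)%:E)%E.
Proof.
move=> fe; rewrite (pair_bigA _ (fun k j : 'I_n => e k j)) /=.
have [_ <-] := has_mean_sum (fun z : 'I_n * 'I_n => fe z.1 z.2).
apply: eq_integral => w _; rewrite expr2 mulr_suml.
rewrite -(pair_bigA _ (fun k j : 'I_n => f k w * f j w)) /=.
by congr (_%:E); apply: eq_bigr => k _; rewrite mulr_sumr.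
Qed.

(** The squares have covariance 2 r^2, at most 2 v r because 0 <= r <= v; the bound on the double
    sums of r then controls the variance of the sums. *)
Lemma avg_sqr_cvg : {ae P, forall w,
  n%:R^-1 * (\sum_(k < n) X k w ^+ 2) @[n --> \oo] --> v}.
Proof.
pose S n w := \sum_(k < n) (X k w ^+ 2 - v).
have mS n : measurable_fun setT (S n).
  apply: measurable_sum => k; apply: measurable_funB => //; apply: measurable_funX.
  exact: gaussian_family_meas.
have cov k j : has_mean P (fun w => (X k w ^+ 2 - v) * (X j w ^+ 2 - v)) (2 * r k j ^+ 2).
  have h1 := has_mean_lin 1 1 (gaussian_mean_sqr (single k)) (gaussian_mean_sqr (single j)).
  have h2 := has_mean_lin 1 (- v) (mean_sqr_prod k j) h1.
  apply: (eq_has_mean (has_mean_lin 1 1 h2 (has_mean_cst P (v ^+ 2)))); last first.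
    by rewrite !v_diag; ring.
  by move=> w; ring.
have KS n : (0 < n)%N -> (\int[P]_w (S n w ^+ 2)%:E <= (2 * v * K * n%:R `^ b)%:E)%E.
  move=> n0; rewrite (sqr_sum_mean n cov) lee_fin -[leRHS]mulrA.
  apply: le_trans (ler_wpM2l _ (r_sum n0)); last by rewrite mulr_ge0.
  rewrite mulr_sumr; apply: ler_sum => k _; rewrite mulr_sumr; apply: ler_sum => j _.
  by rewrite -mulrA ler_wpM2l// expr2 ler_wpM2r.
have [p p0] := subsequence_cvg0 (mulr_ge0 (mulr_ge0 (ler0n _ 2) v_ge0) K_ge0) b_lt2 mS KS.
apply: filterS => w Sw.
apply: (cvg_avg_monotone (a := fun n => \sum_(k < n) X k w ^+ 2) p0).
- by move=> n; apply: sumr_ge0 => k _; exact: sqr_ge0.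
- move=> m n /subnK <-; elim: (n - m)%N => // j IH.
  by rewrite addSn big_ord_recr/= (le_trans IH)// lerDl sqr_ge0.
rewrite -[X in _ --> X]add0r.
rewrite (_ : (fun i => _) = (fun i => (i.+1 ^ p)%:R^-1 * S (i.+1 ^ p)%N w + v)).
  by apply: cvgD => //; exact: cvg_cst.
apply/funext => i; rewrite /S big_split /= sumr_const card_ord.
have i0 : (i.+1 ^ p)%:R != 0 :> R by rewrite pnatr_eq0 -lt0n expn_gt0.
by rewrite -[(- v) *+ _]mulr_natr; field.
Qed.

Lemma avg_cvg0 : {ae P, forall w,
  n%:R^-1 * (\sum_(k < n) X k w) @[n --> \oo] --> (0 : R)}.
Proof.
pose S n w := \sum_(k < n) X k w.
have mS n : measurable_fun setT (S n).
  by apply: measurable_sum => k; exact: gaussian_family_meas.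
have KS n : (0 < n)%N -> (\int[P]_w (S n w ^+ 2)%:E <= (K * n%:R `^ b)%:E)%E.
  by move=> n0; rewrite (sqr_sum_mean n mean_prod) lee_fin; exact: r_sum.
have [p p0] := subsequence_cvg0 K_ge0 b_lt2 mS KS.
move: avg_sqr_cvg; apply: filterS2 => w X2 Sw.
(* The dominating terms come from |x| <= (1 + x^2)/2; their averages converge by the case of
   squares. *)
apply: (@cvg_avg_dominated _ (X^~ w) (fun k => 2^-1 * (1 + X k w ^+ 2)) (2^-1 * (1 + v)) p) => //.
  move=> k; have := sqr_ge0 (`|X k w| - 1); rewrite -(real_normK (num_real (X k w))); nra.
rewrite -(cvg_shiftS (fun n => n%:R^-1 * (\sum_(k < n) 2^-1 * (1 + X k w ^+ 2)))).
rewrite (_ : (fun n => _) = (fun n => 2^-1 * (1 + n.+1%:R^-1 * (\sum_(k < n.+1) X k w ^+ 2)))).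
  apply: cvgM; first exact: cvg_cst.
  apply: cvgD; first exact: cvg_cst.
  by have := X2; rewrite -(cvg_shiftS (fun n => n%:R^-1 * (\sum_(k < n) X k w ^+ 2))); exact.
apply/funext => n; rewrite -mulr_sumr big_split /= sumr_const card_ord.
have n0 : n.+1%:R != 0 :> R by rewrite pnatr_eq0.
by field.
Qed.

End family.

(** * Stationary sequences with nonnegative covariances *)

Section stationary.
Context (R : realType) (d : measure_display) (T : measurableType d)
  (P : probability T R).
Variables (X : nat -> T -> R) (r : nat -> nat -> R) (K b : R).
Hypothesis GX : gaussian_family P X r.
Hypothesis rC : forall k j, r k j = r j k.
Hypothesis r_stat : forall k a c, r (a + k)%N (c + k)%N = r a c.
Hypothesis r_ge0 : forall k j, 0 <= r k j.
Hypothesis K_ge0 : 0 <= K.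
Hypothesis b_ge0 : 0 <= b.
Hypothesis b_lt2 : b < 2.
Hypothesis r_sum : forall n, (0 < n)%N ->
  \sum_(k < n) \sum_(j < n) r k j <= K * n%:R `^ b.

Let diag k : r k k = r 0 0.
Proof. by have := r_stat k 0 0; rewrite !add0n. Qed.

Lemma stationary_avg_cvg0 : {ae P, forall w,
  n%:R^-1 * (\sum_(k < n) X k w) @[n --> \oo] --> (0 : R)}.
Proof. exact: (avg_cvg0 GX rC diag r_ge0 K_ge0 b_lt2 r_sum). Qed.

Let sum_shift (g : nat -> R) a c n : (forall k, 0 <= g k) ->
  \sum_(k < n) g (a + k)%N <= \sum_(k < n + (a + c)) g k.
Proof.
move=> g0.
have -> : (n + (a + c) = a + n + c)%N by lia.
rewrite big_split_ord /= big_split_ord /= -addrA.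
apply: (@le_trans _ _ (\sum_(k < n) g (a + k)%N + 0)); first by rewrite addr0.
rewrite addrCA lerD2l addr_ge0//; apply: sumr_ge0 => k _; exact: g0.
Qed.

Let dsum_shift a c n :
  \sum_(k < n) \sum_(j < n) r (a + k)%N (c + j)%N <=
  \sum_(k < n + (a + c)) \sum_(j < n + (a + c)) r k j.
Proof.
apply: le_trans (sum_shift (g := fun k => \sum_(j < n + (a + c)) r k j) a c n _); last first.
  by move=> k; apply: sumr_ge0.
apply: ler_sum => k _; rewrite (addnC a c); exact: sum_shift.
Qed.

Let dsum_le a c m n : (0 < n)%N -> (a <= m)%N -> (c <= m)%N ->
  \sum_(k < n) \sum_(j < n) r (a + k)%N (c + j)%N <= K * (1 + 2 * m)%:R `^ b * n%:R `^ b.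
Proof.
move=> n0 am cm; apply: (le_trans (dsum_shift a c n)).
have n1 : (0 < n + (a + c))%N by lia.
apply: (le_trans (r_sum n1)); rewrite -mulrA ler_wpM2l//.
rewrite -powRM// ge0_ler_powR ?nnegrE// -natrM ler_nat; nia.
Qed.

(** Nonnegative coefficients keep the covariances of the combination nonnegative. They split into
    four shifted copies of r, each with double sums controlled by a longer double sum of r, whence
    the constant 4 K'. *)
Let combo_cvg (x y : R) a c : 0 <= x <= 1 -> 0 <= y <= 1 -> {ae P, forall w,
  n%:R^-1 * (\sum_(k < n) (x * X (a + k)%N w + y * X (c + k)%N w) ^+ 2) @[n --> \oo]
   --> (x ^+ 2 * r 0%N 0%N + 2 * (x * y) * r a c + y ^+ 2 * r 0%N 0%N)}.
Proof.
move=> /andP[x0 x1] /andP[y0 y1].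
pose m := maxn a c; pose K' := K * (1 + 2 * m)%:R `^ b.
have K'0 : 0 <= K' by rewrite mulr_ge0// powR_ge0.
have xy1 (u v : R) : 0 <= u -> u <= 1 -> 0 <= v -> v <= 1 -> 0 <= u * v <= 1.
  by move=> u0 u1 v0 v1; rewrite mulr_ge0// mulr_ile1.
have scale (u v : R) a' c' n : (0 < n)%N -> 0 <= u -> u <= 1 -> 0 <= v -> v <= 1 ->
    (a' <= m)%N -> (c' <= m)%N ->
    \sum_(k < n) \sum_(j < n) u * v * r (a' + k)%N (c' + j)%N <= K' * n%:R `^ b.
  move=> n0 u0 u1 v0 v1 am cm; apply: le_trans (dsum_le n0 am cm).
  apply: ler_sum => k _; apply: ler_sum => j _.
  have /andP[h1 h2] := xy1 u v u0 u1 v0 v1.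
  by rewrite ler_piMl.
apply: (avg_sqr_cvg (gaussian_family_shift GX x y a c) _ _ _ (K := 4 * K') (b := b)) => //.
- by move=> k j; rewrite (rC (a + j)%N) (rC (c + j)%N) (rC (a + j)%N (c + k)%N) (rC (c + j)%N (c + k)%N); ring.
- by move=> k; rewrite !diag (rC (c + k)%N) r_stat; ring.
- by move=> k j; rewrite !addr_ge0 ?mulr_ge0// ?sqr_ge0.
- by rewrite mulr_ge0.
move=> n n0.
have am : (a <= m)%N by rewrite leq_maxl.
have cm : (c <= m)%N by rewrite leq_maxr.
have h1 := scale x x a a n n0 x0 x1 x0 x1 am am.
have h2 := scale x y a c n n0 x0 x1 y0 y1 am cm.
have h3 := scale y x c a n n0 y0 y1 x0 x1 cm am.
have h4 := scale y y c c n n0 y0 y1 y0 y1 cm cm.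
under eq_bigr do rewrite !big_split /=.
rewrite !big_split /= !expr2; lra.
Qed.

(* The products are recovered from the squares of X (a + k), X (c + k) and of
   their sum, whose averages are monotone up to normalization. *)
Lemma stationary_prod_cvg a c : {ae P, forall w,
  n%:R^-1 * (\sum_(k < n) X (a + k)%N w * X (c + k)%N w) @[n --> \oo] --> r a c}.
Proof.
have o1 : (0 : R) <= (1 : R) <= (1 : R) by apply/andP; split.
have o0 : (0 : R) <= (0 : R) <= (1 : R) by apply/andP; split.
move: (combo_cvg a c o1 o1) (combo_cvg a c o1 o0) (combo_cvg a c o0 o1).
apply: filterS3 => w h1 h2 h3.
have l : 2^-1 * (1 ^+ 2 * r 0%N 0%N + 2 * (1 * 1) * r a c + 1 ^+ 2 * r 0%N 0%N -
    (1 ^+ 2 * r 0%N 0%N + 2 * (1 * 0) * r a c + 0 ^+ 2 * r 0%N 0%N) -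
    (0 ^+ 2 * r 0%N 0%N + 2 * (0 * 1) * r a c + 1 ^+ 2 * r 0%N 0%N)) = r a c by field.
have := cvgM (cvg_cst (2^-1 : R)) (cvgB (cvgB h1 h2) h3).
rewrite l => h; rewrite [X in X @ _](_ : _ = (fun=> 2^-1) \*
  ((fun n : nat => n%:R^-1 * (\sum_(k < n) (1 * X (a + k)%N w + 1 * X (c + k)%N w) ^+ 2)) -
   (fun n : nat => n%:R^-1 * (\sum_(k < n) (1 * X (a + k)%N w + 0 * X (c + k)%N w) ^+ 2)) -
   (fun n : nat => n%:R^-1 * (\sum_(k < n) (0 * X (a + k)%N w + 1 * X (c + k)%N w) ^+ 2)))).
  exact: h.
apply/funext => n.
rewrite !fctE /= -!mulrBr -!sumrB mulrCA; congr (_ * _).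
by rewrite mulr_sumr; apply: eq_bigr => k _; field.
Qed.

End stationary.

(** * Covariances of fractional increments *)

Section fbm_increment_covariance.
Variables (R : realType) (H h : R).
Hypothesis H_gt : 2^-1 < H.
Hypothesis h0 : 0 < h.
Let p := 2 * H.
Let p_gt1 : 1 < p. Proof. by have := H_gt; rewrite /p; lra. Qed.

Let p0 : p != 0. Proof. by rewrite gt_eqF// (lt_trans ltr01 p_gt1). Qed.

Lemma fbm_incr_covE k j (x := k%:R - j%:R) : fbm_incr_cov H h k j =
  h `^ p * (2^-1 * (`|x + 1| `^ p + `|x - 1| `^ p - 2 * `|x| `^ p)).
Proof.
have scale (u v y : R) : u - v = y * h -> `|u - v| `^ p = h `^ p * `|y| `^ p.
  by move=> ->; rewrite normrM powRM// (gtr0_norm h0) mulrC.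
rewrite /fbm_incr_cov /fbm_cov -/p.
rewrite (scale (j.+1%:R * h) (k.+1%:R * h) (- x)); last first.
  by rewrite /x -(natr1 k) -(natr1 j); ring.
rewrite (scale (j%:R * h) (k.+1%:R * h) (- (x + 1))); last first.
  by rewrite /x -(natr1 k); ring.
rewrite (scale (j.+1%:R * h) (k%:R * h) (- (x - 1))); last first.
  by rewrite /x -(natr1 j); ring.
rewrite (scale (j%:R * h) (k%:R * h) (- x)); last by rewrite /x; ring.
by rewrite !normrN; field.
Qed.

Lemma fbm_incr_covC k j : fbm_incr_cov H h k j = fbm_incr_cov H h j k.
Proof.
rewrite !fbm_incr_covE -[j%:R - k%:R]opprB.
have -> : - (k%:R - j%:R) + 1 = - (k%:R - j%:R - 1) :> R by ring.
have -> : - (k%:R - j%:R) - 1 = - (k%:R - j%:R + 1) :> R by ring.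
by rewrite !normrN; ring.
Qed.

Lemma fbm_incr_cov_stat k a c :
  fbm_incr_cov H h (a + k) (c + k) = fbm_incr_cov H h a c.
Proof.
rewrite !fbm_incr_covE.
by have -> : (a + k)%:R - (c + k)%:R = a%:R - c%:R :> R by rewrite !natrD; ring.
Qed.

Lemma powR_midpoint (a b : R) : 0 <= a -> 0 <= b ->
  2 * (2^-1 * (a + b)) `^ p <= a `^ p + b `^ p.
Proof.
move=> a0 b0.
have h01 : 0 <= (2^-1 : R) <= 1 by apply/andP; split; lra.
have := @convex_powR R p (ltW p_gt1) (Itv01 (proj1 (andP h01)) (proj2 (andP h01))) a b.
rewrite !inE /= !in_itv /= !andbT => /(_ a0 b0).
rewrite convRE [X in X `^ _ <= _]convRE /= /unstable.onem.
have -> : 1 - 2^-1 = 2^-1 :> R by field.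
by rewrite -mulrDr; lra.
Qed.

(** A second difference of |x|^(2H): |x| is at most the mean of |x+1| and |x-1|, and the power is
    convex on the half-line since 2H > 1. *)
Lemma fbm_incr_cov_ge0 k j : 0 <= fbm_incr_cov H h k j.
Proof.
rewrite fbm_incr_covE; move: (k%:R - j%:R) => x.
rewrite mulr_ge0 ?powR_ge0// mulr_ge0 ?invr_ge0// subr_ge0.
apply: le_trans (powR_midpoint (normr_ge0 _) (normr_ge0 _)).
apply: ler_wpM2l => //; apply: ge0_ler_powR.
- by rewrite (le_trans ler01 (ltW p_gt1)).
- by rewrite nnegrE.
- by rewrite nnegrE mulr_ge0 ?invr_ge0// addr_ge0.
have := ler_normD (x + 1) (x - 1).
have -> : x + 1 + (x - 1) = 2 * x by ring.
by rewrite normrM (ger0_norm (ler0n _ 2)); lra.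
Qed.

(** Both sums telescope and leave the variance of the process at time n h. *)
Lemma fbm_incr_cov_sum n :
  \sum_(k < n) \sum_(j < n) fbm_incr_cov H h k j = h `^ p * n%:R `^ p.
Proof.
pose C (k j : nat) := fbm_cov H (k%:R * h) (j%:R * h).
have kh k : 0 <= k%:R * h by rewrite mulr_ge0// ltW.
have C0 k : C k 0%N = 0.
  rewrite /C /fbm_cov mul0r sub0r normrN -/p powR0// ger0_norm//.
  by ring.
have C0' k : C 0%N k = 0.
  rewrite /C /fbm_cov mul0r subr0 -/p powR0// ger0_norm//.
  by ring.
have tel (g : nat -> R) : \sum_(k < n) (g k.+1 - g k) = g n - g 0%N.
  by rewrite -(big_mkord xpredT (fun k => g k.+1 - g k)) telescope_sumr.
transitivity (\sum_(k < n) (C k.+1 n - C k n)).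
  apply: eq_bigr => k _.
  transitivity (\sum_(j < n) ((C k.+1 j.+1 - C k j.+1) - (C k.+1 j - C k j))).
    by apply: eq_bigr => j _; rewrite /fbm_incr_cov -!/(C _ _); ring.
  by rewrite (tel (fun j => C k.+1 j - C k j)) !C0; ring.
rewrite (tel (C^~ n)) C0' subr0 /C /fbm_cov subrr normr0 -/p powR0//.
by rewrite powRM// ?(ltW h0)//; field.
Qed.

End fbm_increment_covariance.

(** * The mixed noise *)

Section mixed_noise.
Context (R : realType) (d : measure_display) (T : measurableType d)
  (P : probability T R).
Variables (sigma gamma H h : R) (B BH : R -> {RV P >-> R}).
Hypothesis H_gt : 2^-1 < H.
Hypothesis H_lt1 : H < 1.
Hypothesis h0 : 0 < h.
Hypothesis BM : brownian_motion B.
Hypothesis fBM : fractional_brownian_motion H BH.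
Hypothesis B_BH : independent_pair P (sigma_gen [set t : R | 0 <= t] (fun t => B t))
  (sigma_gen [set t : R | 0 <= t] (fun t => BH t)).

Definition noise_cov (k j : nat) : R :=
  sigma ^+ 2 * (h * (k == j)%:R) + gamma ^+ 2 * fbm_incr_cov H h k j.

Definition noise_incr (k : nat) (w : T) : R :=
  sigma * (B (k.+1%:R * h) w - B (k%:R * h) w) +
  gamma * (BH (k.+1%:R * h) w - BH (k%:R * h) w).

Let sigma_gen_incr (X : R -> {RV P >-> R}) n (c : nat -> R) (A : set R) :
  measurable A -> sigma_gen [set t : R | 0 <= t] (fun t => X t)
   ((fun w => \sum_(k < n) c k * (X (k.+1%:R * h) w - X (k%:R * h) w)) @^-1` A).
Proof.
apply: (@sigma_lincomb _ _ _ _ _ (fun k w => X (k.+1%:R * h) w - X (k%:R * h) w)).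
move=> k A' _ mA'.
have := @sigma_lincomb R T [set E | exists i (A : set R),
         [/\ [set t : R | 0 <= t] i, measurable A & E = X i @^-1` A]] 2
  (fun j => if j == 0%N then 1 else -1) (fun j => X ((k + (j == 0%N))%:R * h)).
rewrite (_ : (fun w => \sum_(_ < _) _) = (fun w => X (k.+1%:R * h) w - X (k%:R * h) w)).
  apply=> // j A'' _ mA''; apply: sub_sigma_algebra.
  by exists ((k + (j == 0%N))%:R * h), A''; split => //=; rewrite mulr_ge0// ltW.
by apply/funext => w; rewrite !big_ord_recr big_ord0 /= addn1 addn0; ring.
Qed.

Lemma noise_gaussian : gaussian_family P noise_incr noise_cov.
Proof.
have G1 := brownian_increments (ltW h0) BM.
have G2 := fbm_increments fBM (ltW h0).
apply: (gaussian_family_add sigma gamma _ G1 G2) => n c c' A A' mA mA'.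
by apply: B_BH; [exact: (@sigma_gen_incr B)|exact: (@sigma_gen_incr BH)].
Qed.

Let noise_covC k j : noise_cov k j = noise_cov j k.
Proof. by rewrite /noise_cov fbm_incr_covC// eq_sym. Qed.

Let noise_cov_stat k a c : noise_cov (a + k) (c + k) = noise_cov a c.
Proof. by rewrite /noise_cov fbm_incr_cov_stat// eqn_add2r. Qed.

Let noise_cov_ge0 k j : 0 <= noise_cov k j.
Proof.
by rewrite addr_ge0// mulr_ge0 ?sqr_ge0// ?fbm_incr_cov_ge0// mulr_ge0// ltW.
Qed.

Let K := sigma ^+ 2 * h + gamma ^+ 2 * h `^ (2 * H).

Let K_ge0 : 0 <= K.
Proof. by rewrite addr_ge0// mulr_ge0 ?sqr_ge0 ?powR_ge0// ltW. Qed.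

(** The Brownian part contributes a multiple of n, which is at most n^(2H). *)
Let noise_cov_sum n : (0 < n)%N ->
  \sum_(k < n) \sum_(j < n) noise_cov k j <= K * n%:R `^ (2 * H).
Proof.
move=> n0; under eq_bigr do rewrite big_split /= -!mulr_sumr.
rewrite big_split /= -!mulr_sumr fbm_incr_cov_sum//.
have -> : \sum_(k < n) \sum_(j < n) (k == j :> nat)%:R = n%:R :> R.
  under eq_bigr => k _.
    rewrite (bigD1 k)//= eqxx big1 ?addr0; first by over.
    by move=> j jk; rewrite eq_sym (negbTE (jk : (j != k :> nat))).
  by rewrite sumr_const card_ord.
rewrite /K [leRHS]mulrDl lerD//; last by rewrite mulrA.
rewrite -mulrA ler_wpM2l ?sqr_ge0// ler_wpM2l ?(ltW h0)//.
by rewrite -[leLHS]powRr1// ler_powR ?ler1n//; have := H_gt; lra.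
Qed.

Lemma noise_lln : {ae P, forall w,
  n%:R^-1 * (\sum_(k < n) noise_incr k w) @[n --> \oo] --> (0 : R) /\
  forall a c, n%:R^-1 * (\sum_(k < n) noise_incr (a + k) w * noise_incr (c + k) w)
    @[n --> \oo] --> noise_cov a c}.
Proof.
have b2 : 2 * H < 2 by have := H_lt1; lra.
have b0 : 0 <= 2 * H by have := H_gt; lra.
have h1 := stationary_avg_cvg0 noise_gaussian noise_covC noise_cov_stat noise_cov_ge0
  K_ge0 b2 noise_cov_sum.
have h2 := stationary_prod_cvg noise_gaussian noise_covC noise_cov_stat noise_cov_ge0
  K_ge0 b0 b2 noise_cov_sum.
have : {ae P, forall w, forall a c, n%:R^-1 *
    (\sum_(k < n) noise_incr (a + k) w * noise_incr (c + k) w)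
    @[n --> \oo] --> noise_cov a c}.
  by apply: ae_foralln => a; apply: ae_foralln => c; exact: h2.
by apply: filterS2 h1 => w ? ?; split.
Qed.

End mixed_noise.

(** * Limits of the statistics of one subject *)

Section path_limits.
Variables (R : realType) (h : R).

Lemma eq_cvg_seq (u v : nat -> R) (l l' : R) :
  u @ \oo --> l -> u =1 v -> l = l' -> v @ \oo --> l'.
Proof. by move=> ul /funext <- <-. Qed.

Hypothesis h0 : 0 < h.
Implicit Types (g : nat -> R) (y : R -> R).

Lemma avg_shift_cvg g (l : R) a : n%:R^-1 * (\sum_(k < n) g k) @[n --> \oo] --> l ->
  n%:R^-1 * (\sum_(k < n) g (a + k)%N) @[n --> \oo] --> l.
Proof.
elim: a g => [//|a IH] g gl.
have {}gl : n%:R^-1 * (\sum_(k < n) g k.+1) @[n --> \oo] --> l; last first.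
  by have := IH (fun k => g k.+1) gl; under eq_fun do under eq_bigr do rewrite -addSn.
rewrite -(cvg_shiftS (fun n => n%:R^-1 * (\sum_(k < n) g k.+1))).
have {}gl : n.+2%:R^-1 * (\sum_(k < n.+2) g k) @[n --> \oo] --> l.
  rewrite (cvg_shiftS (fun n => n.+1%:R^-1 * (\sum_(k < n.+1) g k))).
  by rewrite (cvg_shiftS (fun n => n%:R^-1 * (\sum_(k < n) g k))).
have hm : (n.+1%:R^-1 : R) @[n --> \oo] --> (0 : R) by exact: cvg_harmonic.
(* The average of the n+1 shifted terms is (1 + 1/(n+1)) times the average of n+2 terms, minus g 0 /
   (n+1). *)
apply: (eq_cvg_seq (cvgB (cvgM (cvgD (cvg_cst (1 : R)) hm) gl) (cvgM hm (cvg_cst (g 0%N)))));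
  last by rewrite addr0 mul1r mul0r subr0.
move=> n; rewrite !fctE /= [\sum_(k < n.+2) _]big_ord_recl /=.
have -> : n.+2%:R = n.+1%:R + 1 :> R by rewrite natr1.
have n0 : 0 < n.+1%:R :> R by rewrite ltr0n.
move: (n.+1%:R) n0 => x x0; have x1 : x + 1 != 0 by rewrite gt_eqF// addr_gt0.
by field; rewrite x1 gt_eqF.
Qed.

Variables (y : R -> R) (theta : R) (D : nat -> R) (rho : nat -> nat -> R).
Hypothesis incrE : forall k, increment h y k = theta * h + D k.
Hypothesis D0 : n%:R^-1 * (\sum_(k < n) D k) @[n --> \oo] --> (0 : R).
Hypothesis DD : forall a c,
  n%:R^-1 * (\sum_(k < n) D (a + k)%N * D (c + k)%N) @[n --> \oo] --> rho a c.

Let avg_const (x : R) : n%:R^-1 * (\sum_(k < n) x) @[n --> \oo] --> x.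
Proof.
apply: (@cvg_trans _ (x @[n --> \oo])); last exact: cvg_cst.
apply: near_eq_cvg; near=> n; rewrite sumr_const card_ord -[x *+ n]mulr_natl.
by rewrite mulKf// pnatr_eq0 -lt0n; near: n; exact: nbhs_infty_gt.
Unshelve. all: by end_near. Qed.

Lemma incr_prod_cvg a c :
  n%:R^-1 * (\sum_(k < n) increment h y (a + k) * increment h y (c + k))
    @[n --> \oo] --> (theta * h) ^+ 2 + rho a c.
Proof.
pose e := theta * h.
apply: (eq_cvg_seq (cvgD (cvgD (@avg_const (e ^+ 2)) (@DD a c))
  (cvgM (cvg_cst e) (cvgD (@avg_shift_cvg _ _ a D0) (@avg_shift_cvg _ _ c D0)))));
  last by rewrite addr0 mulr0 addr0.
move=> n; rewrite !fctE /= -!mulrDr -!big_split /= mulrCA -mulrDr; congr (_ * _).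
rewrite mulr_sumr -big_split /=; apply: eq_bigr => k _.
by rewrite !incrE /e; ring.
Qed.

Lemma theta_hat_cvg : theta_hat h n y @[n --> \oo] --> theta.
Proof.
apply: (eq_cvg_seq (cvgM (cvg_cst h^-1) (cvgD (@avg_const (theta * h)) D0)));
  last by rewrite addr0 mulrC mulfK ?gt_eqF.
move=> n; rewrite !fctE /= /theta_hat big_mkord -mulrDr -big_split /=.
by rewrite invfM mulrA (mulrC h^-1); congr (_ * _); apply: eq_bigr => k _; rewrite incrE.
Qed.

Lemma xi_cvg : xi h n y @[n --> \oo] --> h ^+ 2 * theta ^+ 2 + rho 0%N 0%N.
Proof.
apply: (eq_cvg_seq (@incr_prod_cvg 0 0)); last by rewrite exprMn mulrC.
by move=> n; rewrite /xi big_mkord.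
Qed.

Lemma eta_cvg : Defs.eta h n y @[n --> \oo] --> h ^+ 2 * theta ^+ 2 + rho 0%N 1%N.
Proof.
apply: (eq_cvg_seq (@incr_prod_cvg 0 1)); last by rewrite exprMn mulrC.
by move=> n; rewrite /Defs.eta big_mkord.
Qed.

Lemma zeta_cvg : zeta h n y @[n --> \oo] -->
  4 * (h ^+ 2 * theta ^+ 2) + (rho 0%N 2%N + rho 0%N 3%N + rho 1%N 2%N + rho 1%N 3%N).
Proof.
apply: (eq_cvg_seq (cvgD (cvgD (cvgD (@incr_prod_cvg 0 2) (@incr_prod_cvg 0 3))
  (@incr_prod_cvg 1 2)) (@incr_prod_cvg 1 3))); last by ring.
move=> n; rewrite !fctE /= /zeta big_mkord -!mulrDr -!big_split /=; congr (_ * _).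
by apply: eq_bigr => k _; rewrite /increment !(addSn, add0n, addnS, addn0); ring.
Qed.

End path_limits.

(** * Consistency for a fixed number of subjects *)

Section estimator_limits.
Variables (R : realType) (sigma gamma H h : R).
Hypothesis gamma0 : 0 < gamma.
Hypothesis H_gt : 2^-1 < H.
Hypothesis h0 : 0 < h.
Variables (Y : nat -> R -> R) (theta : nat -> R) (D : nat -> nat -> R) (N : nat).
Hypothesis N0 : (0 < N)%N.
Hypothesis incrE : forall i k, increment h (Y i) k = theta i * h + D i k.
Hypothesis D0 : forall i, n%:R^-1 * (\sum_(k < n) D i k) @[n --> \oo] --> (0 : R).
Hypothesis DD : forall i a c, n%:R^-1 * (\sum_(k < n) D i (a + k)%N * D i (c + k)%N)
  @[n --> \oo] --> noise_cov sigma gamma H h a c.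

Let p := 2 * H.
Let rho := noise_cov sigma gamma H h.
Let p_gt1 : 1 < p. Proof. by have := H_gt; rewrite /p; lra. Qed.
Let p0 : p != 0. Proof. by rewrite gt_eqF// (lt_trans ltr01 p_gt1). Qed.

Let average_cvg (v : nat -> nat -> R) (l : nat -> R) :
  (forall i, v n i @[n --> \oo] --> l i) ->
  average N (v n) @[n --> \oo] --> average N l.
Proof.
move=> vl; rewrite /average; apply: cvgM; first exact: cvg_cst.
rewrite big_mkord; under eq_fun do rewrite big_mkord.
by apply: cvg_big => [|i _]; [exact: add_continuous|exact: vl].
Qed.

Let average_affine (v : nat -> R) (a b : R) :
  average N (fun i => a * v i + b) = a * average N v + b.
Proof.
rewrite /average big_split /= -mulr_sumr sumr_const_nat subn0 -[b *+ N]mulr_natl.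
have N' : N%:R != 0 :> R by rewrite pnatr_eq0 -lt0n.
by field.
Qed.

Let V := average N (fun i => theta i ^+ 2).

Let V_cvg : V_bar h n N Y @[n --> \oo] --> V.
Proof.
apply: average_cvg => i.
have t := theta_hat_cvg h0 (incrE i) (@D0 i).
by rewrite expr2; under eq_fun do rewrite expr2; exact: cvgM.
Qed.

(** The random drifts enter the limit of a statistic only through c theta_i^2; subtracting c times
    [V_bar] cancels their average and leaves a function of the parameters. *)
Let centered (f : nat -> R) (c : R) (r : R) :
  f n @[n --> \oo] --> average N (fun i => c * theta i ^+ 2 + r) ->
  f n - c * V_bar h n N Y @[n --> \oo] --> r.
Proof.
rewrite average_affine => fl.
by apply: (eq_cvg_seq (cvgB fl (cvgM (cvg_cst c) V_cvg))) => //; rewrite /V; ring.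
Qed.

Let eta_centered : eta_bar h n N Y - h ^+ 2 * V_bar h n N Y @[n --> \oo] --> rho 0%N 1%N.
Proof. by apply: centered; apply: average_cvg => i; exact: eta_cvg (incrE i) (@D0 i) (@DD i). Qed.

Let xi_centered : xi_bar h n N Y - h ^+ 2 * V_bar h n N Y @[n --> \oo] --> rho 0%N 0%N.
Proof. by apply: centered; apply: average_cvg => i; exact: xi_cvg (incrE i) (@D0 i) (@DD i). Qed.

Let zeta_centered : zeta_bar h n N Y - 4 * h ^+ 2 * V_bar h n N Y @[n --> \oo] -->
  (rho 0%N 2%N + rho 0%N 3%N + rho 1%N 2%N + rho 1%N 3%N).
Proof.
apply: centered; apply: average_cvg => i.
have := zeta_cvg (incrE i) (@D0 i) (@DD i).
by rewrite mulrA; exact.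
Qed.

Let rho00 : rho 0%N 0%N = sigma ^+ 2 * h + gamma ^+ 2 * h `^ p.
Proof.
rewrite /rho /noise_cov fbm_incr_covE// eqxx subrr add0r sub0r normrN normr0 normr1.
by rewrite -/p powR0// powR1 mulr1n; field.
Qed.

Let lag (a c l : nat) : (c = l.+1 + a)%N -> rho a c =
  gamma ^+ 2 * h `^ p * (2^-1 * (l%:R `^ p + l.+2%:R `^ p - 2 * l.+1%:R `^ p)).
Proof.
move=> ->; rewrite /rho /noise_cov fbm_incr_covE// -/p.
have -> : (a == l.+1 + a)%N = false by apply/eqP; lia.
rewrite natrD [a%:R - _](_ : _ = - l.+1%:R); last by ring.
have -> : - l.+1%:R + 1 = - l%:R :> R by rewrite -(natr1 l); ring.
have -> : - l.+1%:R - 1 = - l.+2%:R :> R by rewrite -(natr1 l.+1); ring.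
by rewrite !normrN !normr_nat mulr0n; ring.
Qed.

Let g2 : R := 2 `^ (p - 1) - 1.

(** Strict because H > 1/2; it keeps the limits of the denominators in [H_hat] and [gamma2_hat] away
    from 0. *)
Let g2_gt0 : 0 < g2.
Proof.
by rewrite subr_gt0 /powR pnatr_eq0/= expR_gt1 mulr_gt0 ?subr_gt0// ln_gt0// ltr1n.
Qed.

Let two_p : 2 `^ p = 2 * (2 `^ (p - 1)) :> R.
Proof. by rewrite -{2}[2]powRr1// -powRD ?pnatr_eq0 ?implybT// addrC subrK. Qed.

Let rho01 : rho 0%N 1%N = gamma ^+ 2 * h `^ p * g2.
Proof. by rewrite (@lag _ _ 0)// powR0// two_p powR1 /g2; field. Qed.

(** The four terms add up to the covariance of two adjacent increments over 2 h, to which the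
    Brownian part contributes nothing; by self-similarity it is 2^(2H) times the covariance over h,
    a ratio that [H_hat] inverts. *)
Let rho_zeta : rho 0%N 2%N + rho 0%N 3%N + rho 1%N 2%N + rho 1%N 3%N =
  2 `^ p * (gamma ^+ 2 * h `^ p * g2).
Proof.
rewrite (@lag 0 2 1)// (@lag 0 3 2)// (@lag 1 2 0)// (@lag 1 3 1)// powR0// powR1 /g2.
have -> : 4 `^ p = 2 `^ p * 2 `^ p :> R by rewrite -powRM//; congr (_ `^ _); ring.
have -> : 2 `^ (p - 1) = 2^-1 * 2 `^ p :> R by rewrite two_p; field.
by field.
Qed.

Let H_hat_cvg : H_hat h n N Y @[n --> \oo] --> H.
Proof.
have r0 : 0 < rho 0%N 1%N by rewrite rho01 !mulr_gt0// ?exprn_gt0// powR_gt0.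
have q : (zeta_bar h n N Y - 4 * h ^+ 2 * V_bar h n N Y) /
    (eta_bar h n N Y - h ^+ 2 * V_bar h n N Y) @[n --> \oo] --> 2 `^ p.
  apply: (eq_cvg_seq (cvgM zeta_centered (cvgV (lt0r_neq0 r0) eta_centered))) => //.
  by rewrite rho_zeta -rho01 mulfK// gt_eqF.
have l2 : ln 2 != 0 :> R by rewrite gt_eqF// ln_gt0// ltr1n.
have q0 : 0 < 2 `^ p :> R by rewrite powR_gt0.
have lq := cvg_comp _ _ q (continuous_ln q0).
have {lq} : 2^-1 * (ln ((zeta_bar h n N Y - 4 * h ^+ 2 * V_bar h n N Y) /
    (eta_bar h n N Y - h ^+ 2 * V_bar h n N Y)) / ln 2) @[n --> \oo] --> H.
  apply: (eq_cvg_seq (cvgM (cvg_cst (2^-1 : R)) (cvgM lq (cvg_cst (ln 2)^-1)))) => //.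
  by rewrite ln_powR mulfK// mulKf.
(* The ratio has a positive limit, so it is positive from some n on, and there [log2p] is the
   logarithm. *)
apply: cvg_trans; apply: near_eq_cvg.
have := q => /cvgrPdist_lt /(_ _ q0); apply: filterS => n /=.
rewrite ltr_norml => /andP[_]; rewrite ltrBlDr ltrDl => qn.
by rewrite /H_hat /log2p qn.
Qed.

Let powR_exponent_cvg (x : R) (u : nat -> R) (l : R) : 0 < x ->
  u n @[n --> \oo] --> l -> x `^ u n @[n --> \oo] --> x `^ l.
Proof.
move=> x0 ul; rewrite /powR gt_eqF//=.
have c : u n * ln x @[n --> \oo] --> l * ln x by apply: cvgM => //; exact: cvg_cst.
exact: (cvg_comp _ _ c (@continuous_expR R _)).
Qed.

Let h_pow_cvg : h `^ (2 * H_hat h n N Y) @[n --> \oo] --> h `^ p.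
Proof. by apply: powR_exponent_cvg => //; apply: cvgM => //; exact: cvg_cst. Qed.

Let gamma2_hat_cvg : gamma2_hat h n N Y @[n --> \oo] --> gamma ^+ 2.
Proof.
have e : 2 * H_hat h n N Y - 1 @[n --> \oo] --> p - 1.
  by apply: cvgB; [apply: cvgM => //|]; exact: cvg_cst.
have two0 : 0 < 2 :> R by [].
have c : h `^ (2 * H_hat h n N Y) * (2 `^ (2 * H_hat h n N Y - 1) - 1) @[n --> \oo] -->
    h `^ p * g2.
  apply: cvgM => //; apply: cvgB; last exact: cvg_cst.
  exact: powR_exponent_cvg.
have n0 : h `^ p * g2 != 0 by rewrite gt_eqF// mulr_gt0// powR_gt0.
apply: (eq_cvg_seq (cvgM eta_centered (cvgV n0 c))) => //.
by rewrite rho01 -mulrA mulfK.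
Qed.

Let sigma2_hat_cvg : sigma2_hat h n N Y @[n --> \oo] --> sigma ^+ 2.
Proof.
apply: (eq_cvg_seq (cvgM (cvgB xi_centered (cvgM gamma2_hat_cvg h_pow_cvg)) (cvg_cst h^-1))) => //.
by rewrite rho00 addrK mulfK// gt_eqF.
Qed.

Lemma phi_hat_cvg i : phi_hat h n N Y i @[n --> \oo] --> theta i + 2^-1 * sigma ^+ 2.
Proof.
apply: cvgD; first exact: (theta_hat_cvg h0 (incrE i) (@D0 i)).
by apply: cvgM => //; exact: cvg_cst.
Qed.

End estimator_limits.

(** * Taylor bounds from one-sided derivatives *)

Section within_derivative.
Variables (R : realType).
Implicit Types (D : set R) (g : R -> R).

Lemma derivable_on_linear D g x : derivable_on D g -> D x -> forall e : R, 0 < e ->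
  exists2 del, 0 < del & forall y, D y -> `|y - x| < del ->
    `|g y - g x - derivative_on D g x * (y - x)| <= e * `|y - x|.
Proof.
move=> gD Dx e e0.
have /cvgrPdist_le /(_ _ e0) := gD x Dx.
rewrite near_withinE near_withinE => /nbhs_ballP[del /= del0 H].
exists del => // y Dy yx.
have [->|xy] := eqVneq y x; first by rewrite !subrr mulr0 subr0 normr0 mulr0.
have yx0 : y - x != 0 by rewrite subr_eq0.
have := H y; rewrite /ball /= distrC => /(_ yx xy Dy).
rewrite -/(derivative_on D g x) => h.
have -> : g y - g x - derivative_on D g x * (y - x) =
  - ((derivative_on D g x - (g y - g x) / (y - x)) * (y - x)) by field.
by rewrite normrN normrM ler_wpM2r.
Qed.

Lemma derivable_on_continuous D g : derivable_on D g -> {within D, continuous g}.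
Proof.
move=> gD; apply/subspace_continuousP => x Dx; apply/cvgrPdist_lt => e e0.
have [del del0 H] := derivable_on_linear gD Dx ltr01.
set L := derivative_on D g x in H.
have k0 : 0 < 2 + `|L| by rewrite ltr_wpDr.
have m0 : 0 < Num.min del (e / (2 + `|L|)) by rewrite lt_min del0 divr_gt0.
rewrite near_withinE; apply/nbhs_ballP; exists (Num.min del (e / (2 + `|L|))) => // y.
rewrite /ball /= distrC lt_min => /andP[yd ye] Dy.
have [->|xy] := eqVneq y x; first by rewrite subrr normr0.
rewrite distrC; have := H y Dy yd; rewrite mul1r => h.
have -> : g y - g x = (g y - g x - L * (y - x)) + L * (y - x) by ring.
apply: (le_lt_trans (ler_normD _ _)); rewrite normrM.
move: ye; rewrite ltr_pdivlMr// => ye.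
have : 0 < `|y - x| by rewrite normr_gt0 subr_eq0.
by move: h; move: (normr_ge0 L); nra.
Qed.

Lemma derivable_on_is_derive D g x : derivable_on D g -> D^° x ->
  is_derive x 1 g (derivative_on D g x).
Proof.
move=> gD Dx.
have cv : h^-1 *: (g (h *: 1 + x) - g x) @[h --> 0^'] --> derivative_on D g x.
  apply/cvgrPdist_le => e e0.
  have [del del0 H] := derivable_on_linear gD (interior_subset Dx) e0.
  have /nbhs_ballP[r r0 Hr] := Dx.
  rewrite near_withinE; apply/nbhs_ballP; exists (Num.min del r); first by rewrite /= lt_min del0.
  move=> y; rewrite /ball /= sub0r normrN lt_min => /andP[yd yr] y0.
  have E : y *: 1 + x = y + x by rewrite /GRing.scale /= mulr1.
  have := H (y + x); rewrite addrK => /(_ _ yd).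
  rewrite E /GRing.scale /=.
  have -> : derivative_on D g x - y^-1 * (g (y + x) - g x) =
    - (y^-1 * (g (y + x) - g x - derivative_on D g x * y)) by field.
  rewrite normrN normrM normfV ler_pdivrMl ?normr_gt0// [leRHS]mulrC; apply.
  by apply: Hr; rewrite /ball /= opprD addrCA subrr addr0 normrN.
apply: DeriveDef; last exact: (cvg_lim _ cv).
by apply/cvg_ex; exists (derivative_on D g x).
Qed.

Lemma derivable_on_MVT (a b : R) g y z : derivable_on `[a, b] g -> a <= y -> y < z -> z <= b ->
  exists2 x, y < x < z & g z - g y = derivative_on `[a, b] g x * (z - y).
Proof.
move=> gD ay yz zb.
have sub : `[y, z] `<=` `[a, b].
  by move=> u /=; rewrite !in_itv /= => /andP[yu uz]; rewrite (le_trans ay) ?(le_trans uz).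
have [x||x xI ->] := @MVT _ g (derivative_on `[a, b] g) _ _ yz.
- rewrite in_itv /= => /andP[yx xz]; apply: derivable_on_is_derive => //.
  rewrite interior_itv_bnd /= in_itv /=.
  by rewrite (le_lt_trans ay)// (lt_le_trans xz).
- apply: (continuous_subspaceW sub); exact: derivable_on_continuous.
by exists x => //; move: xI; rewrite in_itv.
Qed.

Lemma continuous_on_itv_bounded (a b : R) g : a <= b -> {within `[a, b], continuous g} ->
  exists2 C, 0 <= C & forall x, a <= x <= b -> `|g x| <= C.
Proof.
move=> ab gc; have [c cI Hc] := EVT_max ab gc; have [e eI He] := EVT_min ab gc.
exists (`|g c| + `|g e|) => [|x xI]; first by rewrite addr_ge0.
have := Hc x; have := He x; rewrite in_itv /= => /(_ xI) h1 /(_ xI) h2.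
rewrite ler_norml; have := ler_norm (g c); have := ler_norm (- g e); rewrite normrN.
by have := normr_ge0 (g c); have := normr_ge0 (g e) => *; apply/andP; split; lra.
Qed.

(** Two uses of the mean value theorem: the intermediate point x is within |z - y| of y, so the
    derivative changes by at most C |z - y| from y to x. *)
Lemma C2_on_taylor (a b : R) g : a <= b -> C2_on `[a, b] g ->
  exists2 C, 1 <= C & forall y z, a <= y <= b -> a <= z <= b ->
    [/\ `|derivative_on `[a, b] g y| <= C, `|g z - g y| <= C * `|z - y| &
     `|g z - g y - derivative_on `[a, b] g y * (z - y)| <= C * (z - y) ^+ 2].
Proof.
move=> ab [gD gD1 gc2]; set g1 := derivative_on _ g in gD1 gc2 *.
set g2 := derivative_on _ g1 in gc2.
have [C1 C10 H1] := continuous_on_itv_bounded ab (derivable_on_continuous gD1).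
have [C2 C20 H2] := continuous_on_itv_bounded ab gc2.
have mvt f : derivable_on `[a, b] f -> forall y z, a <= y <= b -> a <= z <= b ->
    exists x, [/\ a <= x <= b, `|x - y| <= `|z - y| &
      f z - f y = derivative_on `[a, b] f x * (z - y)].
  move=> fD y z /andP[ay yb] /andP[az zb].
  have [yz|zy|->] := ltgtP y z.
  - have [x /andP[yx xz] fx] := derivable_on_MVT fD ay yz zb.
    exists x; split => //; first by rewrite (le_trans ay (ltW yx)) (le_trans (ltW xz) zb).
    by rewrite !gtr0_norm ?subr_gt0// ?(lt_trans yx)// lerD2r ltW.
  - have [x /andP[yx xz] fx] := derivable_on_MVT fD az zy yb.
    exists x; split => //; first by rewrite (le_trans az (ltW yx)) (le_trans (ltW xz) yb).
      by rewrite !ltr0_norm ?subr_lt0// lerN2 lerD2r ltW.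
    by rewrite -opprB fx; ring.
  by exists z; split; rewrite ?az// !subrr mulr0.
exists (1 + C1 + C2) => [|y z yI zI]; first by lra.
have [x [xI xy gE]] := mvt _ gD y z yI zI.
have [u [uI _ gE1]] := mvt _ gD1 y x yI xI.
split.
- by apply: le_trans (H1 _ yI) _; lra.
- by rewrite gE normrM ler_wpM2r//; apply: le_trans (H1 _ xI) _; lra.
have -> : g z - g y - g1 y * (z - y) = (g1 x - g1 y) * (z - y) by rewrite gE -/g1; ring.
rewrite gE1 !normrM -(real_normK (num_real (z - y))) expr2 mulrA ler_wpM2r//.
rewrite ler_pM//; apply: le_trans (H2 _ uI) _; lra.
Qed.

End within_derivative.

(** * Convergence rates and limit superior *)

Section scale.
Variable R : realType.
Implicit Types (n j m : nat).

(* The rate condition forces m_N ^ 8 >= N eventually; 32 makes 2 * 8 ^ scale_exp N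
   at most N ^ (1/8), hence at most m_N. *)
Definition scale_exp n := (trunc_log 2 n %/ 32)%N.

Lemma ln_le_scale_exp n : (0 < n)%N -> ln n%:R <= 64 * (scale_exp n).+1%:R :> R.
Proof.
move=> n0; have nr : 0 < n%:R :> R by rewrite ltr0n.
have /andP[_ nL] := trunc_log_bounds (isT : (1 < 2)%N) n0.
have L32 : ((trunc_log 2 n).+1 <= 32 * (scale_exp n).+1)%N.
  by rewrite /scale_exp; move: (trunc_log 2 n) => L; lia.
apply: (@le_trans _ _ (ln ((2 ^ (trunc_log 2 n).+1)%:R))).
  by rewrite ler_ln ?posrE// ?ltr0n ?expn_gt0// ler_nat ltnW.
rewrite natrX lnXn// -[ln 2 *+ _]mulr_natl.
have l2 : ln 2 <= 2 :> R by apply/ltW/ln_sublinear.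
have l0 : 0 <= ln 2 :> R by rewrite ln_ge0// ler1n.
have : (trunc_log 2 n).+1%:R <= 32 * (scale_exp n).+1%:R :> R by rewrite -natrM ler_nat.
have : 0 <= (trunc_log 2 n).+1%:R :> R by [].
move: ((trunc_log 2 n).+1%:R : R) ((scale_exp n).+1%:R : R) => u v; nra.
Qed.

Lemma scale_exp_le n : (scale_exp n <= (trunc_log 2 n).+1 %/ 10)%N.
Proof. by rewrite /scale_exp; move: (trunc_log 2 n) => L; lia. Qed.

Lemma harmonic_scale_exp n : (0 < n)%N ->
  1 + harmonic_sum R (n * n) <= 132 * (scale_exp n).+1%:R.
Proof.
move=> n0; have := @harmonic_sum_le_ln R (n * n); rewrite muln_gt0 n0 => /(_ isT).
rewrite natrM lnM ?posrE ?ltr0n//; have := ln_le_scale_exp n0.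
have : 1 <= (scale_exp n).+1%:R :> R by rewrite ler1n.
by move: ((scale_exp n).+1%:R : R) (ln n%:R : R) (harmonic_sum R _) => *; lra.
Qed.

Lemma sqr_le_expn2 j : (j.+1 ^ 2 <= 4 * 2 ^ j)%N.
Proof.
case: j => [//|[//|j]]; elim: j => [//|j IH].
rewrite (expnS 2); move: (2 ^ _)%N IH => u; nia.
Qed.

Lemma scale_exp_ge J n : (2 ^ (32 * J) <= n)%N -> (J <= scale_exp n)%N.
Proof.
move=> Jn; rewrite leq_divRL// mulnC.
by rewrite -(trunc_expnK (32 * J) (isT : 1 < 2)%N) leq_trunc_log.
Qed.

Lemma expn8_scale_exp n m : (2 ^ 32 <= n)%N -> (n <= m ^ 8)%N ->
  (2 * 8 ^ scale_exp n <= m)%N.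
Proof.
move=> n32 nm; rewrite -(@leq_exp2r _ _ 8)//; apply: leq_trans nm.
have n0 : (0 < n)%N by apply: leq_trans n32; rewrite expn_gt0.
have /andP[Ln _] := trunc_log_bounds (isT : (1 < 2)%N) n0.
apply: leq_trans Ln; rewrite -[X in (_ * X ^ _)%N](_ : 2 ^ 3 = 8)%N//.
rewrite -expnM -expnS -expnM leq_exp2l//.
have := @scale_exp_ge 1 n; rewrite muln1 => /(_ n32).
by clear n32; rewrite /scale_exp; move: (trunc_log 2 n) => L; lia.
Qed.

Lemma loglog_ge1 : \forall n \near \oo, 1 <= ln (ln n%:R) :> R.
Proof.
near=> n; have h : expR (expR 1) <= n%:R :> R by near: n; exact: nbhs_infty_ger.
have n0 : 0 < n%:R :> R by apply: lt_le_trans h; exact: expR_gt0.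
have h1 : expR 1 <= ln n%:R :> R by rewrite -ler_expR lnK ?posrE.
by rewrite -ler_expR lnK ?posrE// (lt_le_trans (expR_gt0 1)).
Unshelve. all: by end_near. Qed.

Lemma cs_rate_sqr n : 1 <= ln (ln n%:R) :> R ->
  cs_rate R n ^+ 2 = 2 * n%:R / ln (ln n%:R).
Proof. by move=> l1; rewrite sqr_sqrtr// divr_ge0// (le_trans ler01). Qed.

Lemma cs_rate_le n : (0 < n)%N -> 1 <= ln (ln n%:R) :> R -> cs_rate R n <= 2 * n%:R.
Proof.
move=> n0 l1; have n1 : 1 <= n%:R :> R by rewrite ler1n.
rewrite -ler_sqr ?nnegrE ?mulr_ge0 ?sqrtr_ge0// cs_rate_sqr//.
rewrite ler_pdivrMr ?(lt_le_trans ltr01 l1)//.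
move: l1 n1; move: (ln (ln n%:R)) => l; move: (n%:R : R) => v l1 v1.
have h1 : 2 * v * 1 <= 2 * v * l by apply: ler_wpM2l => //; lra.
have : 0 <= v * l * (2 * v - 1) by apply: mulr_ge0; [apply: mulr_ge0|]; lra.
by rewrite expr2; lra.
Qed.

Lemma cs_rateM n : (0 < n)%N -> 1 <= ln (ln n%:R) :> R ->
  cs_rate R n * Num.sqrt (ln (ln n%:R) / (2 * n%:R)) = 1.
Proof.
move=> n0 l1; have l0 : 0 < ln (ln n%:R) :> R by exact: lt_le_trans l1.
have nr : 0 < n%:R :> R by rewrite ltr0n.
rewrite -sqrtrM; last by rewrite divr_ge0// ltW.
by rewrite (_ : _ * _ = 1) ?sqrtr1//; field; rewrite !gt_eqF.
Qed.

Variable m : nat -> nat.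
Hypothesis m_oo : m @ \oo --> \oo.
Hypothesis m_rate : cs_rate R N * (ln (m N)%:R / (m N)%:R ^+ 2) @[N --> \oo] --> (0 : R).

Let m_ge k : \forall n \near \oo, (k <= m n)%N.
Proof. exact: (cvgnyPge m).1 m_oo k. Qed.

Let rate_le (e : R) : 0 < e ->
  \forall n \near \oo, cs_rate R n * (ln (m n)%:R / (m n)%:R ^+ 2) <= e.
Proof.
move=> e0; have /cvgrPdist_le /(_ _ e0) := m_rate; apply: filterS => n /=.
by rewrite sub0r normrN; apply: le_trans; exact: ler_norm.
Qed.

Let ln_m_ge1 : \forall n \near \oo, 1 <= ln (m n)%:R :> R.
Proof.
apply: filterS (m_ge (Num.truncn (expR 1 : R)).+1) => n mn.
have h : expR 1 <= (m n)%:R :> R.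
  by rewrite (le_trans (ltW (truncnS_gt _)))// ler_nat.
by rewrite -ler_expR lnK// posrE (lt_le_trans _ h)// expR_gt0.
Qed.

(** Eventually [cs_rate] is at most m^2, hence 2 n <= m^4 ln (ln n); as ln (ln n) <= 2 sqrt n, this
    gives m^4 >= sqrt n. *)
Lemma node_count_ge : \forall n \near \oo, (2 * 8 ^ scale_exp n <= m n)%N.
Proof.
near=> n.
apply: expn8_scale_exp; first by near: n; exact: nbhs_infty_ge.
have l1 : 1 <= ln (ln n%:R) :> R by near: n; exact: loglog_ge1.
have lm : 1 <= ln (m n)%:R :> R by near: n; exact: ln_m_ge1.
have r1 : cs_rate R n * (ln (m n)%:R / (m n)%:R ^+ 2) <= 1.
  by near: n; exact: (rate_le ltr01).
have m0 : (0 < m n)%N by near: n; exact: m_ge.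
have n0 : (0 < n)%N by near: n; exact: nbhs_infty_gt.
have mr : 0 < (m n)%:R :> R by rewrite ltr0n.
have nr : 0 < n%:R :> R by rewrite ltr0n.
have cs0 : 0 <= cs_rate R n by exact: sqrtr_ge0.
have h1 : cs_rate R n <= (m n)%:R ^+ 2.
  move: r1; rewrite mulrA ler_pdivrMr ?exprn_gt0// mul1r; apply: le_trans.
  by rewrite ler_peMr.
have h2 : cs_rate R n ^+ 2 <= (m n)%:R ^+ 4.
  by rewrite (exprM _ 2 2) lerXn2r ?nnegrE// exprn_ge0// ltW.
move: h2; rewrite cs_rate_sqr// ler_pdivrMr ?(lt_le_trans ltr01 l1)// => h2.
pose s : R := Num.sqrt n%:R.
have s0 : 0 < s by rewrite sqrtr_gt0.
have sn : s ^+ 2 = n%:R by rewrite sqr_sqrtr// ltW.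
have l2 : ln (ln n%:R) <= 2 * s.
  have ln0 : 0 < ln n%:R :> R.
    by rewrite ltNge; apply/negP => h; move: l1; rewrite ln0// ler10.
  apply: (le_trans (ltW (ln_sublinear ln0))).
  by rewrite -sn lnXn// mulr2n; have := ln_sublinear s0; lra.
have h3 : s <= (m n)%:R ^+ 4.
  have : 2 * s ^+ 2 <= (m n)%:R ^+ 4 * (2 * s).
    by rewrite sn (le_trans h2)// ler_wpM2l// exprn_ge0// ltW.
  move=> h; have : s * s <= (m n)%:R ^+ 4 * s by move: h; rewrite expr2; lra.
  by rewrite ler_pM2r.
rewrite -(ler_nat R) -sn natrX (exprM _ 4 2).
by rewrite lerXn2r ?nnegrE// ?(ltW s0)// exprn_ge0// ltW.
Unshelve. all: by end_near. Qed.

Let pi4 : pi <= 4 :> R. Proof. by have := pihalf_02 R; lra. Qed.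

Lemma smooth_interp_rate (F D : R -> R) (C : R) (e : R) : 0 <= C -> 0 < e ->
  (forall y, -1 <= y <= 1 -> `|D y| <= C) ->
  (forall y z, -1 <= y <= 1 -> -1 <= z <= 1 -> `|F z - F y - D y * (z - y)| <= C * (z - y) ^+ 2) ->
  \forall n \near \oo, forall x, -1 <= x <= 1 ->
    cs_rate R n * `|lagrange_interp (m n) F x - F x| <= e.
Proof.
move=> C0 e0 DC FC.
(* 640 = 8 x 16 x 5, from pi^2 <= 16 and 3 + [harmonic_sum] <= 5 ln m; the added 1 allows C = 0. *)
have k0 : 0 < 640 * C + 1 by lra.
near=> n => x xI.
have m1 : (1 < m n)%N by near: n; exact: m_ge.
have lm : 1 <= ln (m n)%:R :> R by near: n; exact: ln_m_ge1.
have r1 : cs_rate R n * (ln (m n)%:R / (m n)%:R ^+ 2) <= e / (640 * C + 1).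
  by near: n; apply: rate_le; exact: divr_gt0.
have cs0 : 0 <= cs_rate R n by exact: sqrtr_ge0.
have mr : 0 < (m n)%:R :> R by rewrite ltr0n (ltnW m1).
have h := lagrange_interp_smooth m1 xI C0 DC FC.
have hh : harmonic_sum R (m n) <= 1 + ln (m n)%:R by apply: harmonic_sum_le_ln; exact: ltnW.
apply: (le_trans (ler_wpM2l cs0 h)).
have p1 : pi ^+ 2 <= 16 :> R by have := pi4; have := pi_gt0 R; nra.
have h2 : 8 * C * (pi / (m n)%:R) ^+ 2 * (3 + harmonic_sum R (m n)) <=
    640 * C * (ln (m n)%:R / (m n)%:R ^+ 2).
  have v0 : 0 <= ((m n)%:R ^+ 2)^-1 :> R by rewrite invr_ge0 exprn_ge0// ltW.
  have hm0 := harmonic_sum_ge0 R (m n).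
  rewrite exprMn exprVn; move: (ln (m n)%:R) ((m n)%:R ^+ 2)^-1 (harmonic_sum R (m n)) v0 hm0 lm hh.
  move=> l v hm v0 hm0 l1 hm1.
  have a1 : pi ^+ 2 * v <= 16 * v by rewrite ler_wpM2r.
  have a2 : 3 + hm <= 5 * l by lra.
  have a3 : pi ^+ 2 * v * (3 + hm) <= 16 * v * (5 * l).
    by apply: ler_pM => //; [rewrite mulr_ge0// sqr_ge0|rewrite addr_ge0].
  have a4 := ler_wpM2l C0 a3; lra.
apply: (le_trans (ler_wpM2l cs0 h2)); rewrite mulrCA.
have : cs_rate R n * (ln (m n)%:R / (m n)%:R ^+ 2) * (640 * C + 1) <= e.
  by rewrite -ler_pdivlMr.
have : 0 <= cs_rate R n * (ln (m n)%:R / (m n)%:R ^+ 2).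
  by rewrite mulr_ge0// divr_ge0 ?exprn_ge0 ?(ltW mr)// (le_trans ler01 lm).
by move: (cs_rate R n * _) => v; lra.
Unshelve. all: by end_near. Qed.

Let quadratic_bound (e v c : R) : 0 <= e -> 1 <= v -> c <= 2 * v -> 48 <= v * e ->
  c * 2 * 6 <= e / 2 * (v * v + 1).
Proof.
move=> e0 v1 cv ve; have v0 : 0 <= v by lra.
have : 0 <= v * (v * e - 48) by rewrite mulr_ge0// subr_ge0.
by lra.
Qed.

Let linear_bound (K e v : R) : 0 < K -> 0 < e -> 8 * (1056 * K) / e <= v ->
  2112 * K <= e / 2 * v.
Proof. by move=> K0 e0; rewrite ler_pdivrMr//; lra. Qed.

Lemma rough_interp_rate (u : nat -> R -> R) (K0 e : R) : 0 < K0 -> 0 < e ->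
  (\forall n \near \oo, forall j x y, (j <= (trunc_log 2 n).+1 %/ 10)%N ->
     -1 <= x <= 1 -> -1 <= y <= 1 -> `|x - y| <= 2 / 8 ^+ j ->
     `|u n x - u n y| <= K0 / 2 ^+ j * Num.sqrt (ln (ln n%:R) / n%:R)) ->
  (forall n, exists U1 U2 : R -> R, [/\ forall y, u n y = U1 y - U2 y,
     forall y z, y <= z -> U1 y <= U1 z, forall y z, y <= z -> U2 y <= U2 z,
     forall y, 0 <= U1 y <= 1 & forall y, 0 <= U2 y <= 1]) ->
  \forall n \near \oo, forall x, -1 <= x <= 1 ->
    cs_rate R n * `|lagrange_interp (m n) (u n) x - u n x| <= e.
Proof.
move=> K00 e0 modu mono; near=> n => x xI.
have l1 : 1 <= ln (ln n%:R) :> R by near: n; exact: loglog_ge1.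
have m1 : (1 < m n)%N by near: n; exact: m_ge.
have n0 : (0 < n)%N by near: n; exact: nbhs_infty_gt.
have m8 : (2 * 8 ^ scale_exp n <= m n)%N by near: n; exact: node_count_ge.
pose j := scale_exp n.
have jbig : 8 * (1056 * K0) / e <= j.+1%:R.
  apply: (le_trans (ltW (truncnS_gt _))); rewrite ler_nat ltnS; apply: scale_exp_ge.
  by near: n; exact: nbhs_infty_ge.
have nbig : 48 / e <= n%:R :> R by near: n; exact: nbhs_infty_ger.
have md : forall j x y, (j <= (trunc_log 2 n).+1 %/ 10)%N ->
     -1 <= x <= 1 -> -1 <= y <= 1 -> `|x - y| <= 2 / 8 ^+ j ->
     `|u n x - u n y| <= K0 / 2 ^+ j * Num.sqrt (ln (ln n%:R) / n%:R).
  by near: n; exact: modu.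
have jl : (j <= (trunc_log 2 n).+1 %/ 10)%N.
  exact: scale_exp_le.
pose S : R := Num.sqrt (ln (ln n%:R) / n%:R).
have S0 : 0 <= S by exact: sqrtr_ge0.
have nr : 0 < n%:R :> R by rewrite ltr0n.
have mr : 0 < (m n)%:R :> R by rewrite ltr0n (ltnW m1).
have cs0 : 0 <= cs_rate R n by exact: sqrtr_ge0.
have w0 : 0 <= K0 / 2 ^+ j * S by rewrite mulr_ge0// divr_ge0 ?(ltW K00)// exprn_ge0.
(* With cut-off n^2 the harmonic sum is of order ln n whatever m n is, and the remaining term 12 /
   (n^2 + 1) beats the crude bound 2 n on the rate. *)
have h := @lagrange_interp_osc R (m n) (u n) x _ (n * n) m1 xI w0 _ (mono n).
have {}h : `|lagrange_interp (m n) (u n) x - u n x| <=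
    2 * (K0 / 2 ^+ j * S * (1 + harmonic_sum R (n * n)) + 6 / (n * n).+1%:R).
  apply: h => y z yI zI yz; apply: md => //; apply: (le_trans yz).
  rewrite ler_pdivrMr//; have e8 : 0 < 8 ^+ j :> R by exact: exprn_gt0.
  have : 2 * 8 ^+ j <= (m n)%:R :> R by rewrite -natrX -natrM ler_nat.
  move=> /(ler_wpM2l (ltW (_ : 0 < 2 / 8 ^+ j))) => /(_ (divr_gt0 (ltr0n _ 2) e8)).
  have -> : 2 / 8 ^+ j * (2 * 8 ^+ j) = 4 :> R by field; rewrite gt_eqF.
  exact: le_trans.
have csS : cs_rate R n * S <= 2.
  rewrite -ler_sqr ?nnegrE ?mulr_ge0// exprMn cs_rate_sqr// sqr_sqrtr; last first.
    by rewrite divr_ge0// (le_trans ler01).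
  have ll0 : 0 < ln (ln n%:R) :> R by exact: lt_le_trans l1.
  have -> : 2 * n%:R / ln (ln n%:R) * (ln (ln n%:R) / n%:R) = 2 :> R.
    by field; rewrite !gt_eqF.
  by rewrite expr2 ler_peMl// ler1n.
have hn : 1 + harmonic_sum R (n * n) <= 132 * j.+1%:R.
  exact: harmonic_scale_exp.
(* The modulus gains 2^-j where the harmonic sum costs a multiple of j + 1. *)
have j2 : j.+1%:R / 2 ^+ j <= 4 / j.+1%:R :> R.
  rewrite ler_pdivrMr ?exprn_gt0// mulrAC ler_pdivlMr ?ltr0n// -expr2.
  by rewrite -!natrX -natrM ler_nat sqr_le_expn2.
have b1 : cs_rate R n * (2 * (K0 / 2 ^+ j * S * (1 + harmonic_sum R (n * n)))) <= e / 2.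
  have -> : cs_rate R n * (2 * (K0 / 2 ^+ j * S * (1 + harmonic_sum R (n * n)))) =
     cs_rate R n * S * (2 * (K0 * ((1 + harmonic_sum R (n * n)) / 2 ^+ j))).
    by field; rewrite expf_neq0.
  have g0 : 0 <= (1 + harmonic_sum R (n * n)) / 2 ^+ j.
    by rewrite divr_ge0 ?exprn_ge0// addr_ge0// harmonic_sum_ge0.
  apply: (@le_trans _ _ (2 * (2 * (K0 * ((1 + harmonic_sum R (n * n)) / 2 ^+ j))))).
    by rewrite ler_wpM2r// mulr_ge0// mulr_ge0// ltW.
  have g1 : (1 + harmonic_sum R (n * n)) / 2 ^+ j <= 132 * (4 / j.+1%:R).
    apply: (@le_trans _ _ (132 * (j.+1%:R / 2 ^+ j))); last by rewrite ler_wpM2l.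
    by rewrite mulrA ler_wpM2r// invr_ge0 exprn_ge0.
  apply: (@le_trans _ _ (2 * (2 * (K0 * (132 * (4 / j.+1%:R)))))).
    by rewrite !ler_wpM2l// ltW.
  have -> : 2 * (2 * (K0 * (132 * (4 / j.+1%:R)))) = 2112 * K0 / j.+1%:R.
    have : j.+1%:R != 0 :> R by rewrite pnatr_eq0.
    by move: (j.+1%:R : R) => v v0; field.
  by rewrite ler_pdivrMr ?ltr0n//; exact: linear_bound.
have b2 : cs_rate R n * (2 * (6 / (n * n).+1%:R)) <= e / 2.
  have n1 : 1 <= n%:R :> R by rewrite ler1n.
  have cs2n := cs_rate_le n0 l1.
  rewrite !mulrA ler_pdivrMr ?ltr0n//.
  have : (n * n).+1%:R = n%:R * n%:R + 1 :> R by rewrite -natrM natr1.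
  move=> ->; move: nbig; rewrite ler_pdivrMr//.
  move: n1 cs2n; move: (cs_rate R n) => c; move: (n%:R : R) => v n1 cs2n h48.
  exact: quadratic_bound (ltW e0) n1 cs2n h48.
apply: (le_trans (ler_wpM2l cs0 h)); rewrite [X in cs_rate R n * X]mulrDr mulrDr.
by apply: le_trans (lerD b1 b2) _; rewrite -splitr.
Unshelve. all: by end_near. Qed.

End scale.

(** * Limits superior and suprema *)

Section limsup.
Variable R : realType.

Lemma limn_esup_le_near (u : nat -> \bar R) (a : \bar R) :
  (\forall n \near \oo, (u n <= a)%E) -> (limn_esup u <= a)%E.
Proof.
move=> ua; rewrite /limn_esup limf_esupE.
apply: (@le_trans _ _ (ereal_sup (u @` [set n | (u n <= a)%E]))).
  by apply: ereal_inf_lbound; exists [set n | (u n <= a)%E].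
by apply: ge_ereal_sup => _ [n un <-].
Qed.

Lemma rate_sup_dist_le (r c : R) (g1 g2 : R -> R) : 0 <= r -> 0 <= c ->
  (forall x, -1 <= x <= 1 -> r * `|g1 x - g2 x| <= c) ->
  (r%:E * sup_dist (-1) 1 g1 g2 <= c%:E)%E.
Proof.
move=> r0 c0 H; have [->|rn0] := eqVneq r 0; first by rewrite mul0e lee_fin.
have rp : 0 < r by rewrite lt_neqAle eq_sym rn0.
apply: (@le_trans _ _ (r%:E * (c / r)%:E)%E).
  rewrite lee_wpmul2l ?lee_fin//; apply: ge_ereal_sup => _ [x xI <-].
  by rewrite lee_fin ler_pdivlMr// mulrC H// -in_itv.
by rewrite -EFinM lee_fin mulrCA mulfV ?mulr1.
Qed.

End limsup.

(** * Values at the Chebyshev nodes *)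

Section interpolation.
Variable R : realType.

Lemma lagrange_interpD m (f g : R -> R) x :
  lagrange_interp m (fun y => f y + g y) x =
  lagrange_interp m f x + lagrange_interp m g x.
Proof.
by rewrite /lagrange_interp -big_split /=; apply: eq_bigr => j _; rewrite mulrDl.
Qed.

(** The end -1 has to be excluded: an atom there is compatible with the regularity of the
    distribution function on [-1, 1]. *)
Lemma cheb_node_itv m (j : 'I_m) : -1 < cheb_node R j <= 1.
Proof.
have /andP[a0 api] := cheb_angle_bound R (ltn_ord j); rewrite cheb_nodeE cos_le1 andbT.
rewrite lt_neqAle cos_geN1 andbT; apply/eqP => cN1.
have := sin_gt0_pi (_ : 0 < cheb_angle R m j < pi); rewrite a0 api => /(_ isT).
have := cos2Dsin2 (cheb_angle R m j); rewrite -cN1 => h s.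
have : 0 < sin (cheb_angle R m j) ^+ 2 by exact: exprn_gt0.
by lra.
Qed.

(** The indicator of p <= x is locally constant away from p = x, and with finitely many subjects all
    the indicators reach their limits from a common n on. *)
Lemma F_hat_eventually h (N : nat) (Y : nat -> R -> R) (p : nat -> R) (x : R) :
  (forall i, phi_hat h n N Y i @[n --> \oo] --> p i) ->
  (forall i, p i != x) ->
  \forall n \near \oo, F_hat h n N Y x = N%:R^-1 * \sum_(i < N) (p i <= x)%R%:R.
Proof.
move=> pc px; have H i : \forall n \near \oo, (phi_hat h n N Y i <= x) = (p i <= x).
  have e0 : 0 < `|p i - x| by rewrite normr_gt0 subr_eq0.
  have /cvgrPdist_lt /(_ _ e0) := pc i; apply: filterS => n /=.
  have [xp|xp|/eqP] := ltgtP (p i) x; last by rewrite (negbTE (px i)).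
    rewrite (@ltr0_norm _ (p i - x)) ?subr_lt0// ltr_norml => /andP[h1 h2]; apply/idP; lra.
  rewrite (@gtr0_norm _ (p i - x)) ?subr_gt0// ltr_norml => /andP[h1 h2]; apply/negbTE; rewrite -ltNge; lra.
have : \forall n \near \oo, forall i : 'I_N, (phi_hat h n N Y i <= x) = (p i <= x).
  by apply: filter_forall => i; exact: H.
apply: filterS => n Hn; rewrite /F_hat /average big_mkord; congr (_ * _).
by apply: eq_bigr => i _; rewrite Hn.
Qed.

End interpolation.

(** * Almost sure rate of the interpolated empirical distribution *)

Section assembly.
Context (R : realType) (d : measure_display) (T : measurableType d)
  (P : probability T R) (phi : nat -> {RV P >-> R}) (F : R -> R) (m : nat -> nat).
Hypothesis phi_indep : mutually_independent P (fun i : nat => sigma_gen [set i] phi).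
Hypothesis phi_cdf : forall i x, cdf (phi i) x = (F x)%:E.
Hypothesis F_C2 : C2_on `[-1, 1] F.
Hypothesis m_oo : m @ \oo --> \oo.
Hypothesis m_rate : cs_rate R N * (ln (m N)%:R / (m N)%:R ^+ 2) @[N --> \oo] --> (0 : R).

Definition empirical_cdf (N : nat) (w : T) (x : R) : R :=
  N%:R^-1 * hits phi `]-oo, x] N w.

Let N11 : -1 <= 1 :> R. Proof. by lra. Qed.

Lemma cdf_lipschitz : exists2 C : R, 1 <= C &
  forall x y, -1 <= x -> x <= y -> y <= 1 -> F y - F x <= C * (y - x).
Proof.
have [C C1 H] := C2_on_taylor N11 F_C2; exists C => // x y x1 xy y1.
have xI : -1 <= x <= 1 by rewrite x1 (le_trans xy).
have yI : -1 <= y <= 1 by rewrite y1 (le_trans x1).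
have [_ h _] := H x y xI yI.
by apply: (le_trans (ler_norm _)); rewrite (le_trans h)// ger0_norm// subr_ge0.
Qed.

Lemma phi_neq i x : -1 < x <= 1 -> {ae P, forall w, phi i w != x}.
Proof.
move=> /andP[x0 x1]; have [C C1 FC] := cdf_lipschitz.
have mx : measurable (phi i @^-1` [set x]) by exact: measurable_funPTI.
exists (phi i @^-1` [set x]); split => //; last first.
  by move=> w /= /negP; rewrite negbK => /eqP.
apply/eqP; rewrite eq_le measure_ge0 andbT; apply/lee_addgt0Pr => e e0; rewrite add0e.
have C0 : 0 < C by lra.
(* The first bound keeps ]x - del, x] inside [-1, 1]; the second makes its mass at most e by the
   Lipschitz bound. *)
pose del := Num.min (x + 1) (e / C).
have del0 : 0 < del by rewrite lt_min divr_gt0// andbT; lra.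
have d1 : del <= x + 1 by rewrite ge_min lexx.
have d2 : del <= e / C by rewrite ge_min lexx orbT.
apply: (@le_trans _ _ (P (phi i @^-1` `]x - del, x]))).
  apply: le_measure; rewrite ?inE//; first exact: measurable_funPTI.
  by move=> w /= ->; rewrite in_itv /= lexx andbT; lra.
rewrite (prob_itv phi_cdf); last by lra.
rewrite lee_fin; apply: (@le_trans _ _ (C * (x - (x - del)))); first by apply: FC; lra.
by rewrite opprB addrCA subrr addr0 mulrC -ler_pdivlMr.
Qed.

Lemma phi_avoids_nodes : {ae P, forall w, forall N i (j : 'I_(m N)), phi i w != cheb_node R j}.
Proof.
have : {ae P, forall w, forall N i k, (k < m N)%N -> phi i w != cos (cheb_angle R (m N) k)}.
  apply: ae_foralln => N; apply: ae_foralln => i; apply: ae_foralln => k.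
  have [km|km] := boolP (k < m N)%N; last by apply: nearW => w.
  have := phi_neq i (@cheb_node_itv R _ (Ordinal km)); rewrite cheb_nodeE.
  by apply: filterS => w ? _.
by apply: filterS => w H N i j; rewrite cheb_nodeE; exact: H.
Qed.

(** The three terms share c as (1 + c)/2 + (c - 1)/4 + (c - 1)/4: only the first needs a constant
    above 1, the others are negligible at this rate. *)
Lemma interp_empirical_rate (c : R) : 1 < c -> {ae P, forall w, \forall N \near \oo,
  forall x, -1 <= x <= 1 ->
    cs_rate R N * `|lagrange_interp (m N) (empirical_cdf N w) x - F x| <= c}.
Proof.
move=> c1; have [C C1 FC] := cdf_lipschitz.
have [C' C'1 HT] := C2_on_taylor N11 F_C2.
have c'1 : 1 < (1 + c) / 2 by lra.
have e0 : 0 < (c - 1) / 4 by lra.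
have [K0 K00 HM] := empirical_modulus_eventually phi_indep phi_cdf C1 FC.
have HL := empirical_lil phi_indep phi_cdf C1 FC c'1.
move: HM HL; apply: filterS2 => w [N1 H1] [N2 H2].
have mono n : exists U1 U2 : R -> R, [/\ forall y, empirical_dev phi F n w y = U1 y - U2 y,
     forall y z, y <= z -> U1 y <= U1 z, forall y z, y <= z -> U2 y <= U2 z,
     forall y, 0 <= U1 y <= 1 & forall y, 0 <= U2 y <= 1].
  exists (empirical_cdf n w), F; split => //.
  - move=> y z yz; rewrite ler_wpM2l ?invr_ge0//; apply: ler_sum => i _.
    rewrite !indicE !mem_setE !in_itv /=; have [py|] := leP (phi i w) y; last by [].
    by rewrite (le_trans py yz).
  - exact: cdf_ndecr phi_cdf.
  - move=> y; rewrite /empirical_cdf /hits.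
    have s0 : 0 <= \sum_(i < n) \1_(`]-oo, y]) (phi i w) :> R by exact: sumr_ge0.
    have s1 : \sum_(i < n) \1_(`]-oo, y]) (phi i w) <= n%:R :> R.
      rewrite -[n in leRHS]card_ord -sum1_card natr_sum; apply: ler_sum => i _.
      by rewrite indicE; case: (_ \in _).
    rewrite mulr_ge0 ?invr_ge0//=; have [->|n0] := posnP n; first by rewrite invr0 mul0r.
    by rewrite ler_pdivrMl ?ltr0n// mulr1.
  - exact: cdf_01 phi_cdf.
have modu : \forall n \near \oo, forall j x y, (j <= (trunc_log 2 n).+1 %/ 10)%N ->
     -1 <= x <= 1 -> -1 <= y <= 1 -> `|x - y| <= 2 / 8 ^+ j ->
     `|empirical_dev phi F n w x - empirical_dev phi F n w y| <=
       K0 / 2 ^+ j * Num.sqrt (ln (ln n%:R) / n%:R).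
  by exists N1 => // n /= /H1.
have hr := rough_interp_rate m_oo m_rate K00 e0 modu mono.
have hs := @smooth_interp_rate R m m_oo m_rate F (derivative_on `[-1, 1] F) C' _
  (ltac:(lra)) e0 (fun y yI => let: And3 h _ _ := HT y y yI yI in h)
  (fun y z yI zI => let: And3 _ _ h := HT y z yI zI in h).
near=> N => x xI.
have N0 : (0 < N)%N by near: N; exact: nbhs_infty_gt.
have l1 : 1 <= ln (ln N%:R) :> R by near: N; exact: loglog_ge1.
have r0 : 0 <= cs_rate R N by exact: sqrtr_ge0.
have N2N : (N2 <= N)%N by near: N; exact: nbhs_infty_ge.
have b1 := ler_wpM2l r0 (H2 N N2N x xI).
rewrite mulrCA cs_rateM// mulr1 in b1.
have b2 : cs_rate R N * `|lagrange_interp (m N) (empirical_dev phi F N w) x -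
   empirical_dev phi F N w x| <= (c - 1) / 4 by move: x xI {b1}; near: N; exact: hr.
have b3 : cs_rate R N * `|lagrange_interp (m N) F x - F x| <= (c - 1) / 4.
  by move: x xI {b1 b2}; near: N; exact: hs.
have -> : empirical_cdf N w = fun y => empirical_dev phi F N w y + F y.
  by apply/funext => y; rewrite subrK.
rewrite lagrange_interpD.
set L1 := lagrange_interp _ _ _ in b2 *; set L2 := lagrange_interp _ _ _ in b3 *.
have -> : L1 + L2 - F x = empirical_dev phi F N w x + (L1 - empirical_dev phi F N w x) + (L2 - F x).
  by ring.
have t := ler_normD (empirical_dev phi F N w x + (L1 - empirical_dev phi F N w x)) (L2 - F x).
have t' := ler_normD (empirical_dev phi F N w x) (L1 - empirical_dev phi F N w x).
have := ler_wpM2l r0 (le_trans t (lerD t' (lexx _))).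
rewrite !mulrDr => /le_trans; apply.
by apply: (le_trans (lerD (lerD b1 b2) b3)); lra.
Unshelve. all: by end_near. Qed.

End assembly.

Lemma mutually_independent_pair (R : realType) (d : measure_display) (T : measurableType d)
    (P : probability T R) (I : choiceType) (G : I -> set (set T)) (i j : I) :
  i != j -> mutually_independent P G -> independent_pair P (G i) (G j).
Proof.
move=> ij GI A B GA GB.
have := GI [fset i; j]%fset (fun k => if k == i then A else B).
have ji : (j == i) = false by rewrite eq_sym (negbTE ij).
have -> : \bigcap_(k in [set` [fset i; j]%fset]) (if k == i then A else B) = A `&` B.
  apply/seteqP; split => w.
    move=> h; split.
      by have := h i; rewrite /= !inE eqxx; exact.
    by have := h j; rewrite /= !inE eqxx orbT ji; exact.
  move=> [Aw Bw] k; rewrite /= !inE => /orP[] /eqP ->; first by rewrite eqxx.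
  by rewrite ji.
move=> ->; last first.
  by move=> k; rewrite !inE => /orP[] /eqP ->; rewrite ?eqxx ?ji.
rewrite (perm_big [:: i; j]).
  by rewrite !big_cons big_nil /= eqxx ji mule1.
apply: uniq_perm; rewrite ?fset_uniq//=; first by rewrite inE ij.
by move=> k; rewrite !inE.
Qed.

Theorem proposition7 (R : realType) (d : measure_display) (T : measurableType d)
  (P : probability T R)
  (sigma gamma H h : R)
  (B BH : nat -> R -> {RV P >-> R}) (phi : nat -> {RV P >-> R})
  (F f : R -> R) (m : nat -> nat)
  (sigma_gt0 : 0 < sigma) (gamma_gt0 : 0 < gamma)
  (H_gt : 2^-1 < H) (H_lt1 : H < 1) (h_gt0 : 0 < h)
  (BM : forall i, brownian_motion (B i))
  (fBM : forall i, fractional_brownian_motion H (BH i))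
  (indep_noise : mutually_independent P (fun k : nat + nat =>
     match k with
     | inl i => sigma_gen [set t : R | 0 <= t] (fun t => B i t)
     | inr i => sigma_gen [set t : R | 0 <= t] (fun t => BH i t)
     end))
  (phi_indep : mutually_independent P (fun i : nat => sigma_gen [set i] phi))
  (phi_cdf : forall i x, cdf (phi i) x = (F x)%:E)
  (F_supp : forall i, P (phi i @^-1` `[-1, 1]) = 1%E)
  (f_meas : measurable_fun [set: R] f) (f_ge0 : forall x, 0 <= f x)
  (F_density : forall x,
     (F x)%:E = (\int[lebesgue_measure]_(y in `]-oo, x]) (f y)%:E)%E)
  (phi_indep_noise : independent_pair P
     (sigma_gen [set: nat] phi)
     (sigma_gen [set it : nat * R | 0 <= it.2]
        (fun it => mixed_fbm sigma gamma B BH it.1 it.2)))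
  (A1 : forall i, ('E_P[fun w => (phi i w ^+ 4)%R] < +oo)%E)
  (A2 : C2_on `[-1, 1] F)
  (A3 : [/\ bounded_on `[-1, 1] f, derivable_on `[-1, 1] f &
            bounded_on `[-1, 1] (derivative_on `[-1, 1] f)])
  (m_ge1 : forall N, (1 <= m N)%N)
  (m_oo : m @ \oo --> \oo)
  (m_rate : cs_rate R N * (ln (m N)%:R / (m N)%:R ^+ 2) @[N --> \oo] --> (0 : R)) :
  {ae P, forall w,
    (limn_esup (fun N => limn_esup (fun n =>
       (cs_rate R N)%:E *
       sup_dist (-1) 1
         (lagrange_interp (m N)
            (F_hat h n N
               (log_process sigma phi (mixed_fbm sigma gamma B BH) w)))
         F)) <= 1)%E}.

Proof.
have noise i := noise_lln sigma gamma H_gt H_lt1 h_gt0 (BM i) (fBM i)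
  (@mutually_independent_pair R d T P _ _ (inl i) (inr i) isT indep_noise).
have {}noise := ae_foralln noise.
have avoid := phi_avoids_nodes m phi_cdf A2.
(* Countably many constants decreasing to 1, so that one null set serves them all. *)
have c_gt1 k : 1 < 1 + k.+1%:R^-1 :> R by rewrite ltrDl invr_gt0.
have rate := ae_foralln (fun k => interp_empirical_rate phi_indep phi_cdf A2 m_oo m_rate (c_gt1 k)).
move: noise avoid rate; apply: filterS3 => w noise avoid rate.
set M := mixed_fbm _ _ _ _; set Y := log_process _ _ _ _.
have YE i k : increment h (Y i) k =
    (phi i w - sigma ^+ 2 / 2) * h + noise_incr sigma gamma h (B i) (BH i) k w.
  rewrite /increment /Y /log_process /M /mixed_fbm /noise_incr -(natr1 k).
  by ring.
have phi_hatP N i : (0 < N)%N -> phi_hat h n N Y i @[n --> \oo] --> phi i w.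
  move=> N0; have := @phi_hat_cvg R sigma gamma H h gamma_gt0 H_gt h_gt0 Y _ _ N N0 YE
    (fun i => (noise i).1) (fun i => (noise i).2) i.
  by rewrite (_ : phi i w - _ + _ = phi i w)//; field.
apply/lee_addgt0Pr => e e0.
have [k ke] : exists k, k.+1%:R^-1 <= e.
  exists (Num.truncn e^-1); rewrite -[leRHS]invrK lef_pV2 ?posrE ?invr_gt0//.
  by rewrite ltW// truncnS_gt.
apply: (@le_trans _ _ (1 + k.+1%:R^-1)%:E); last by rewrite EFinD leeD2l.
apply: limn_esup_le_near; near=> N; apply: limn_esup_le_near.
have N0 : (0 < N)%N by near: N; exact: nbhs_infty_gt.
have rN : forall x, -1 <= x <= 1 -> cs_rate R N *
    `|lagrange_interp (m N) (empirical_cdf phi N w) x - F x| <= 1 + k.+1%:R^-1.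
  by near: N; exact: rate.
(* Interpolation reads [F_hat] at m N points only: for fixed N its values there, and with them the
   whole interpolant, are eventually those of the empirical distribution function. *)
have : \forall n \near \oo, forall j : 'I_(m N),
    F_hat h n N Y (cheb_node R j) = empirical_cdf phi N w (cheb_node R j).
  apply: filter_forall => j.
  have := F_hat_eventually (fun i => phi_hatP N i N0) (fun i => avoid N i j).
  apply: filterS => n ->; congr (_ * _); apply: eq_bigr => i _.
  by rewrite indicE mem_setE in_itv.
apply: filterS => n nodes; apply: rate_sup_dist_le.
- exact: sqrtr_ge0.
- exact: le_trans ler01 (ltW (c_gt1 k)).
move=> x xI; rewrite (_ : lagrange_interp _ _ x =
    lagrange_interp (m N) (empirical_cdf phi N w) x); first exact: rN.
by apply: eq_bigr => j _; rewrite nodes.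
Unshelve. all: by end_near. Qed.
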